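(* Let $K$ be an algebraically closed field of characteristic $0$ and let $C\subset\mathbb{P}^2$ be a smooth plane curve over $K$ of degree $d=6$. Then $$\delta'[3]\le 12.$$ Furthermore, the equality holds if and only if $C$ is projectively equivalent to the curve defined by $$X^6+Y^6+Z^6-10(X^3Y^3+Y^3Z^3+Z^3X^3)=0.$$
   Context: For $P\in\mathbb{P}^2$, $\pi_P:C\dashrightarrow\mathbb{P}^1$ is the projection from $P$, and $G[P]=\{\tau\in\mathrm{Bir}(C)\mid \pi_P\circ\tau=\pi_P\}$. $P$ is called quasi-Galois if $|G[P]|\ge 2$. For an integer $n\ge 2$, $\delta'[n]$ denotes the number of quasi-Galois points $P\in\mathbb{P}^2\setminus C$ with $|G[P]|=n$. Two plane curves are projectively equivalent if a linear transformation of $\mathbb{P}^2$ maps one onto the other. *)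

(* Defs.v *)
From HB Require Import structures.
From mathcomp Require Import all_boot all_order all_algebra.
From mathcomp Require Export mpoly.

Set Implicit Arguments.
Unset Strict Implicit.
Unset Printing Implicit Defensive.

Import GRing.Theory.
Local Open Scope ring_scope.

(* The set of E-classes of elements satisfying S has exactly n members
   (E is meant to be an equivalence relation on S). *)
Definition has_card_mod (T : Type) (E : T -> T -> Prop) (S : T -> Prop)
    (n : nat) : Prop :=
  exists t : 'I_n -> T,
    [/\ forall i, S (t i),
        forall i j, E (t i) (t j) -> i = j
      & forall x, S x -> exists i, E x (t i)].

Definition has_card (T : Type) (S : T -> Prop) (n : nat) : Prop :=
  has_card_mod (@eq T) S n.

Section PlaneCurves.
Variable K : fieldType.

Definition point : Type := {L : {vspace 'rV[K]_3} | \dim L == 1%N}.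

(* Vanishing on the line P of K^3; for a homogeneous G this is the vanishing
   at one (equivalently any) vector of homogeneous coordinates of P. *)
Definition vanishes_at (G : {mpoly K[3]}) (P : point) : Prop :=
  forall v : 'rV[K]_3, v \in val P -> G.@[v 0] = 0.

Definition smooth_plane_curve (d : nat) (F : {mpoly K[3]}) : Prop :=
  [/\ F != 0, F \is d.-homog
    & forall P, vanishes_at F P -> exists i, ~ vanishes_at (mderiv i F) P].

(* Below, F is an equation of the plane curve C. *)
Definition vanishes_on (F G : {mpoly K[3]}) : Prop :=
  forall P, vanishes_at F P -> vanishes_at G P.

(* (f_0 : ... : f_(n-1)) is a rational map from C to P^(n-1)
   (C is irreducible in all uses, being smooth). *)
Definition ratmap (F : {mpoly K[3]}) (n : nat) (f : n.-tuple {mpoly K[3]}) :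
    Prop :=
  (exists e : nat, forall i, tnth f i \is e.-homog)
  /\ (exists i, ~ vanishes_on F (tnth f i)).

(* f and g represent the same rational map from C to P^(n-1). *)
Definition ratmap_eq (F : {mpoly K[3]}) (n : nat)
    (f g : n.-tuple {mpoly K[3]}) : Prop :=
  [/\ ratmap F f, ratmap F g
    & forall i j,
        vanishes_on F (tnth f i * tnth g j - tnth f j * tnth g i)].

Definition ratmap_id : 3.-tuple {mpoly K[3]} := [tuple 'X_i | i < 3].

(* g o f; it need not be a ratmap when f maps C into the base locus of g. *)
Definition ratmap_comp (n : nat) (g : n.-tuple {mpoly K[3]})
    (f : 3.-tuple {mpoly K[3]}) : n.-tuple {mpoly K[3]} :=
  [tuple comp_mpoly f (tnth g i) | i < n].

Definition ratself (F : {mpoly K[3]}) (f : 3.-tuple {mpoly K[3]}) : Prop :=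
  ratmap F f /\ vanishes_on F (comp_mpoly f F).

(* Bir(C), up to ratmap_eq. *)
Definition birational_self (F : {mpoly K[3]}) (f : 3.-tuple {mpoly K[3]}) :
    Prop :=
  ratself F f /\
  exists g, [/\ ratself F g,
                ratmap_eq F (ratmap_comp g f) ratmap_id
              & ratmap_eq F (ratmap_comp f g) ratmap_id].

(* The projection from P is Q |-> (l_0(Q) : l_1(Q)), where l_0 and l_1 are
   linear forms with P as only common zero; it is well defined up to a linear
   change of coordinates of P^1. *)
Definition is_projection (P : point) (l : 2.-tuple {mpoly K[3]}) : Prop :=
  (forall i, tnth l i \is 1.-homog)
  /\ (forall Q : point, (forall i, vanishes_at (tnth l i) Q) <-> Q = P).

(* G[P], up to ratmap_eq. *)
Definition in_G (F : {mpoly K[3]}) (P : point) (t : 3.-tuple {mpoly K[3]}) :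
    Prop :=
  birational_self F t /\
  exists2 l, is_projection P l & ratmap_eq F (ratmap_comp l t) l.

Definition card_G (F : {mpoly K[3]}) (P : point) (n : nat) : Prop :=
  has_card_mod (@ratmap_eq F 3) (in_G F P) n.

(* |G[P]| >= 2 *)
Definition quasi_galois (F : {mpoly K[3]}) (P : point) : Prop :=
  exists s t, [/\ in_G F P s, in_G F P t & ~ ratmap_eq F s t].

(* delta'[n] = m; in particular the set of points being counted is finite. *)
Definition delta'_eq (F : {mpoly K[3]}) (n m : nat) : Prop :=
  has_card
    (fun P => [/\ ~ vanishes_at F P, quasi_galois F P & card_G F P n]) m.

Definition proj_equiv (F G : {mpoly K[3]}) : Prop :=
  exists2 phi : 'End('rV[K]_3), lker phi == 0%VS
  & forall Q : point, vanishes_at G Q <->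
      exists2 P : point, vanishes_at F P & val Q = (phi @: val P)%VS.

Definition hesse_sextic : {mpoly K[3]} :=
  let X := 'X_(inord 0) in let Y := 'X_(inord 1) in let Z := 'X_(inord 2) in
  X ^+ 6 + Y ^+ 6 + Z ^+ 6
    - 10%:R * (X ^+ 3 * Y ^+ 3 + Y ^+ 3 * Z ^+ 3 + Z ^+ 3 * X ^+ 3).

End PlaneCurves.

(* Main.v *)
(* An element of G[P] is linear: comparing the two affine charts of the curve
   around P, on which the coordinate ring is integrally closed, shows that it is
   the homology v |-> v + la(v) p, where p spans P.  For a sextic, |G[P]| = 3
   means that there is such a homology of order 3 and none of order 6.  The
   Hessian of F, a nonzero form of degree 12, vanishes on the axes la = 0 of
   these homologies, and distinct points have distinct axes: hence the bound 12.

   If there are 12 points, the homology of order 3 at one of them permutes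
   them and fixes that point, so it fixes a second one.  The two homologies
   commute, and in a basis adapted to them F becomes
     e1 X^6 + e2 Y^6 + e3 Z^6 + a X^3 Y^3 + b X^3 Z^3 + c Y^3 Z^3,
   with Hessian 27 XYZ h(X^3, Y^3, Z^3) for a ternary cubic h.  The other axes
   lie on the Hessian; counting them shows that one has an equation
   al X + be Y + ga Z = 0 with al be ga <> 0, say X + Y + Z = 0 after rescaling.
   Then h vanishes at (x^3, y^3, z^3) whenever x + y + z = 0, which determines
   the coefficients of F up to a scalar. *)

From HB Require Import structures.
Require Import Defs.
From mathcomp Require Import all_boot all_order all_algebra.
From mathcomp Require Import all_fingroup all_solvable all_field.
From mathcomp Require Import ring zify.
From Stdlib Require Import Classical.

Set Implicit Arguments.
Unset Strict Implicit.
Unset Printing Implicit Defensive.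

Import GRing.Theory.
Local Open Scope ring_scope.

(** * Integral closedness of smooth affine curves *)

(** Since P lies off C, taking P = (0:0:1) makes F monic in Z. Both charts are then finite over a
    line, and division by F replaces the function field. An element of G[P] keeps X/Y, so only its
    third coordinate has to be found; divided by another coordinate it is integral over a chart,
    hence a polynomial there, and the comparison of the two charts leaves degree at most 1.
    Cancelling in identities on C requires irreducibility, which is deduced from smoothness: a
    splitting would give a nontrivial idempotent regular on both charts, hence constant.

    In the case of equality the third vertex of the adapted basis need not be one of the 12 points,
    so b = c = 0 must be excluded by a count: the Hessian would then be supported on a curve of
    degree 9. The condition on the cubic h leaves two values, 2 and -10, for the mixed coefficient
    relative to the pure one; the value 2 gives the square of X^3 + Y^3 + Z^3, which is singular.
    Conversely, the Hesse sextic has a point of order 3 at each coordinate vertex, and its Fourier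
    and diagonal symmetries carry these to nine more. *)

Lemma poly_factorX (R : idomainType) (p : {poly R}) : p != 0 ->
  exists k q, p = 'X^k * q /\ q`_0 != 0.
Proof.
move: {2}(size p) (leqnn (size p)) => n; elim: n p => [|n IHn] p.
  by rewrite leqn0 size_poly_eq0 => /eqP->; rewrite eqxx.
move=> le_pn p0; have [p00|p00] := eqVneq p`_0 0; last first.
  by exists 0%N, p; rewrite expr0 mul1r.
have: root p 0 by rewrite /root horner_coef0 p00.
move/factor_theorem => [q]; rewrite subr0 => Dp.
have q0 : q != 0 by apply: contraNneq p0 => q0; rewrite Dp q0 mul0r.
have [|k [r [Dq r0]]] := IHn q _ q0.
  by move: le_pn; rewrite Dp size_mulX.
by exists k.+1, r; split=> //; rewrite Dp Dq exprS; ring.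
Qed.

Section Fiber.
Variable K : closedFieldType.
Notation PP := {poly {poly K}}.

(** In [PP] the inner variable is x and the outer one is y, so that [p.[y%:P].[x]] is p(x, y). This
    is the restriction p(c, y) to a fiber of the projection to the x-line. *)
Definition spec (c : K) : PP -> {poly K} := map_poly (horner_eval c).
HB.instance Definition _ c := GRing.RMorphism.on (spec c).

Definition lift_cst : {poly K} -> PP := map_poly polyC.
HB.instance Definition _ := GRing.RMorphism.on lift_cst.

Lemma spec_lift c q : spec c (lift_cst q) = q.
Proof.
apply/polyP=> i; rewrite /spec /lift_cst !coef_map /= horner_evalE hornerC.
by [].
Qed.

Lemma spec_horner c y (p : PP) : (spec c p).[y] = p.[y%:P].[c].
Proof.
rewrite -[in RHS]horner_evalE -horner_map /= horner_evalE.
by rewrite hornerC.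
Qed.

Definition xsub (c : K) : PP := ('X - c%:P)%:P.

Lemma spec_xsub c : spec c (xsub c) = 0.
Proof. by rewrite /spec /xsub map_polyC /= horner_evalE !hornerE subrr. Qed.

Lemma spec_decomp c (p : PP) : exists p1, p = lift_cst (spec c p) + xsub c * p1.
Proof.
exists (map_poly (fun q => (q - q.[c]%:P) %/ ('X - c%:P)) p).
apply/polyP=> i; rewrite coefD coefCM /lift_cst /spec !coef_map /=.
rewrite coef_map_id0 ?horner0 ?subr0 ?div0p //= horner_evalE mulrC divpK; first by rewrite addrC subrK.
by rewrite dvdp_XsubCl /root !hornerE subrr.
Qed.

Lemma spec_deriv_in c (p p1 : PP) : p = lift_cst (spec c p) + xsub c * p1 ->
  spec c (map_poly deriv p) = spec c p1.
Proof.
move=> Dp; apply/polyP=> i; rewrite /spec !coef_map /= /horner_eval.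
rewrite [in LHS]Dp coefD coefCM coef_map /= derivD derivM.
by rewrite derivC derivXsubC !hornerE subrr; ring.
Qed.

Lemma spec_deriv c (p : PP) : spec c p^`() = (spec c p)^`().
Proof. by rewrite /spec deriv_map. Qed.

Lemma monic_spec c (p : PP) : p \is monic -> spec c p \is monic.
Proof. exact: monic_map. Qed.

(* The substitution x = c + s^m z, y = y0 + s, with s as the outer variable. *)
Definition blowup (m : nat) (c y0 : K) : PP -> PP :=
  horner_eval (y0%:P%:P + 'X) \o
  map_poly (horner_eval (c%:P%:P + 'X^m * 'X%:P) \o map_poly (polyC \o polyC)).
HB.instance Definition _ m c y0 := GRing.RMorphism.on (blowup m c y0).

Lemma blowup_xsub m c y0 : blowup m c y0 (xsub c) = 'X^m * 'X%:P.
Proof.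
rewrite /blowup /xsub /= map_polyC /= /horner_eval hornerC rmorphB /= map_polyX map_polyC /=.
by rewrite !hornerE; ring.
Qed.

Lemma blowup_lift m c y0 q :
  blowup m c y0 (lift_cst q) = lift_cst (q \Po ('X + y0%:P)).
Proof.
elim/poly_ind: q => [|q d IHq]; first by rewrite comp_poly0 !rmorph0.
rewrite comp_poly_MXaddC !rmorphD !rmorphM /= IHq; congr (_ * _ + _).
  rewrite /blowup /lift_cst /= !map_polyX rmorphD /= map_polyX map_polyC /=.
  by rewrite /horner_eval !hornerE addrC.
rewrite /blowup /lift_cst /= !map_polyC /= /horner_eval !hornerE /=.
by rewrite map_polyC /= hornerC.
Qed.

Lemma blowup_coef0 m c y0 p : (0 < m)%N ->
  (blowup m c y0 p)`_0 = (spec c p).[y0]%:P.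
Proof.
move=> m0; have [p1 ->] := spec_decomp c p.
rewrite !rmorphD !rmorphM /= spec_lift spec_xsub mul0r addr0.
rewrite blowup_xsub blowup_lift coefD -mulrA coefXnM m0 addr0.
rewrite coef_map /= -horner_coef0 horner_comp !hornerE.
by [].
Qed.

(* If f(c, y) does not divide a(c, y), take a root y0 of f(c, y) of higher
   multiplicity m than its multiplicity in a(c, y).  After the substitution
   [blowup m c y0], the lowest terms in s of both sides show that a nonconstant
   polynomial in z divides a nonzero constant. *)
Lemma integral_over_fiber (f a Q : PP) (c : K) (n : nat) (g : nat -> PP) :
  f \is monic ->
  (forall y, f.[y%:P].[c] = 0 ->
     (f^`()).[y%:P].[c] != 0 \/ (map_poly deriv f).[y%:P].[c] != 0) ->
  (0 < n)%N ->
  a ^+ n + \sum_(i < n) g i * xsub c ^+ (n - i) * a ^+ i = Q * f ->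
  exists a' q, a = xsub c * a' + q * f.
Proof.
move=> fmon fsm n0 Eq.
set f0 := spec c f; set a0 := spec c a.
have f0mon : f0 \is monic by apply: monic_spec.
have f0n0 : f0 != 0 by apply: monic_neq0.
have [dv|ndv] := boolP (f0 %| a0).
  have [a1 Da] := spec_decomp c a; have [f1 Df] := spec_decomp c f.
  have Da0 : a0 = a0 %/ f0 * f0 by rewrite divpK.
  exists (a1 - lift_cst (a0 %/ f0) * f1), (lift_cst (a0 %/ f0)).
  by rewrite [in RHS]Df {1}Da -/a0 -/f0 {1}Da0 rmorphM /=; ring.
have a0n0 : a0 != 0 by apply: contraNneq ndv => ->; rewrite dvdp0.
set d := gcdp f0 a0.
have d0 : d != 0 by rewrite gcdp_eq0 (negPf f0n0).
have Df0 : f0 = f0 %/ d * d by rewrite divpK // dvdp_gcdl.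
have Da0 : a0 = a0 %/ d * d by rewrite divpK // dvdp_gcdr.
have cop : coprimep (f0 %/ d) (a0 %/ d).
  by rewrite coprimep_div_gcd // f0n0.
have sf1 : size (f0 %/ d) != 1%N.
  apply: contra ndv => /size_poly1P[e e0 De].
  rewrite Df0 De mul_polyC dvdpZl //.
  by rewrite dvdp_gcdr.
have /closed_rootP[y /eqP fy] := sf1.
have ay : ~~ root (a0 %/ d) y by apply: coprimep_root cop _; apply/eqP.
have [k [d1 d1y Dd]] := multiplicity_XsubC d y.
rewrite d0 /= in d1y.
have [m' [f2 f2y Df2]] := multiplicity_XsubC (f0 %/ d) y.
have fd0 : f0 %/ d != 0 by apply: contraNneq f0n0 => h; rewrite Df0 h mul0r.
rewrite fd0 /= in f2y.
have m'0 : (0 < m')%N.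
  case: m' Df2 => // Df2; move: fy; rewrite Df2 expr0 mulr1 => fy.
  by move: f2y; rewrite /root fy eqxx.
(* [m] and [k] are the multiplicities of [y] as a root of f(c, y) and of a(c, y). With x - c of
   weight [m], the orders in s of f and a become exactly [m] and [k]. *)
pose m := (m' + k)%N; have m0 : (0 < m)%N by rewrite /m; lia.
have [a1 Da] := spec_decomp c a; have [f1 Df] := spec_decomp c f.
rewrite -/a0 in Da; rewrite -/f0 in Df.
pose phi := blowup m c y.
have phiX : lift_cst (('X - y%:P) \Po ('X + y%:P)) = 'X :> PP.
  by rewrite comp_polyB comp_polyX comp_polyC addrK /lift_cst map_polyX.
have phif : phi f = 'X^m * (phi (lift_cst (f2 * d1)) + 'X%:P * phi f1).
  rewrite /phi {1}Df Df0 Df2 Dd !rmorphD !rmorphM /= !rmorphXn /= blowup_xsub.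
  by rewrite (blowup_lift _ _ _ ('X - y%:P)) phiX /m exprD; ring.
pose A := phi (lift_cst (a0 %/ d * d1)) + 'X^m' * 'X%:P * phi a1.
have phia : phi a = 'X^k * A.
  rewrite /phi {1}Da {1}Da0 {2}Dd /A !rmorphD !rmorphM /= !rmorphXn /= blowup_xsub.
  by rewrite (blowup_lift _ _ _ ('X - y%:P)) phiX /m exprD /phi !rmorphM /=; ring.
pose B := \sum_(i < n) phi (g i) * 'X^(m' * (n - i)) * 'X%:P ^+ (n - i) * A ^+ i.
have phiE : phi (Q * f) = 'X^(k * n) * (A ^+ n + B).
  rewrite /phi -Eq rmorphD rmorphXn /= -/phi phia exprMn -exprM mulrDr; congr (_ + _).
  rewrite /phi rmorph_sum /= /B mulr_sumr; apply: eq_bigr => i _.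
  rewrite !rmorphM !rmorphXn /= -/phi phia /phi blowup_xsub !exprMn -!exprM /m.
  have -> : (k * n = k * (n - i) + k * i)%N by rewrite -mulnDr subnK // ltnW.
  rewrite mulnDl !exprD; ring.
have A0 : A`_0 = ((a0 %/ d).[y] * d1.[y])%:P.
  rewrite /A coefD -!mulrA coefXnM m'0 addr0 /phi blowup_coef0 //.
  by rewrite spec_lift hornerM.
have B0 : B`_0 = 0.
  rewrite /B coef_sum big1 // => i _.
  rewrite [phi _ * _]mulrC -!mulrA coefXnM muln_gt0 m'0 subn_gt0 ltn_ord //.
pose F := phi (lift_cst (f2 * d1)) + 'X%:P * phi f1.
have F0 : F`_0 = (f2.[y] * d1.[y])%:P + 'X * (spec c f1).[y]%:P.
  rewrite /F coefD coefCM /phi !blowup_coef0 //.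
  by rewrite spec_lift hornerM.
have a0y : (a0 %/ d).[y] * d1.[y] != 0 by rewrite mulf_neq0.
have f0y : f2.[y] * d1.[y] != 0 by rewrite mulf_neq0.
have AB0 : (A ^+ n + B)`_0 = ((a0 %/ d).[y] * d1.[y])%:P ^+ n.
  by rewrite coefD B0 addr0 -horner_coef0 hornerE horner_coef0 A0.
have AB0n : (A ^+ n + B)`_0 != 0.
  by rewrite AB0 expf_neq0 // polyC_eq0.
have F0n : F`_0 != 0.
  rewrite F0; apply/eqP => /(congr1 (fun p : {poly K} => p`_0)).
  rewrite coefD coefC coefXM /= addr0 coef0 => /eqP; exact/negP.
have phiQf : phi (Q * f) != 0.
  rewrite phiE mulf_neq0 ?expf_neq0 ?polyX_eq0 //.
  by apply: contraNneq AB0n => ->; rewrite coef0.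
have [Q0|Q0] := eqVneq (phi Q) 0; first by rewrite /phi rmorphM /= -/phi Q0 mul0r eqxx in phiQf.
have [j [R [DQ R0]]] := poly_factorX Q0.
have := phiE; rewrite /phi rmorphM /= -/phi DQ phif -/F => EE.
have {}EE : 'X^(j + m) * (R * F) = 'X^(k * n) * (A ^+ n + B) :> PP.
  by rewrite -EE exprD; ring.
have RF0 : (R * F)`_0 != 0 by rewrite -horner_coef0 hornerM !horner_coef0 mulf_neq0.
(* Both cofactors have a nonzero constant term in s, so the orders in s agree. *)
have jm : (j + m = k * n)%N.
  have [lt|lt|//] := ltngtP (j + m)%N (k * n)%N.
    move/(congr1 (fun p : PP => p`_(j + m))): EE.
    by rewrite !coefXnM ltnn lt subnn => /eqP; rewrite (negPf RF0).
  move/(congr1 (fun p : PP => p`_(k * n))): EE.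
  by rewrite !coefXnM ltnn lt subnn => /esym/eqP; rewrite (negPf AB0n).
move: EE; rewrite jm => /mulfI; rewrite expf_neq0 ?polyX_eq0 // => /(_ isT) EE.
(* k = 0 would force m = 0. With k > 0, [y] is a multiple root of f(c, y); the y-derivative of f
   vanishes there, so smoothness makes the x-derivative, the value of [spec c f1] at [y],
   nonzero. *)
have k0 : (0 < k)%N.
  rewrite lt0n; apply: contraTneq m0 => k0; move/eqP: jm.
  by rewrite k0 mul0n addn_eq0 -lt0n => /andP[_ /eqP ->].
have fy0 : f.[y%:P].[c] = 0.
  by rewrite -spec_horner -/f0 Df0 hornerM fy mul0r.
have f'y : (f^`()).[y%:P].[c] = 0.
  rewrite -spec_horner spec_deriv -/f0 Df0 derivM hornerD !hornerM fy mul0r addr0.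
  suff -> : d.[y] = 0 by rewrite mulr0.
  by rewrite Dd hornerM horner_exp hornerXsubC subrr expr0n eqn0Ngt k0 mulr0.
have [] := fsm y fy0; first by rewrite f'y eqxx.
rewrite -spec_horner (spec_deriv_in Df) => f1y.
have := congr1 (fun p : PP => p`_0) EE.
rewrite AB0 -horner_coef0 hornerM !horner_coef0 F0 => E0.
have : size (R`_0 * ((f2.[y] * d1.[y])%:P + 'X * (spec c f1).[y]%:P)) = 1%N.
  by rewrite E0 -polyC_exp size_polyC expf_neq0.
move/eqP; rewrite size_mul_eq1 => /andP[_].
by rewrite addrC [_ * _%:P]mulrC size_MXaddC polyC_eq0 (negPf f1y) size_polyC f1y.
Qed.
End Fiber.

Lemma horner_eq0 (K : closedFieldType) (p : {poly K}) : (forall x, p.[x] = 0) -> p = 0.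
Proof.
move=> h; apply/eqP; apply/negPn/negP => /closed_nonrootP[x].
by rewrite /root h eqxx.
Qed.

Lemma horner_generic_eq0 (K : closedFieldType) (E p : {poly K}) : E != 0 ->
  (forall x, E.[x] != 0 -> p.[x] = 0) -> p = 0.
Proof.
move=> E0 h; have : E * p = 0.
  apply: horner_eq0 => x; rewrite hornerM; have [->|/h->] := eqVneq E.[x] 0.
    by rewrite mul0r.
  by rewrite mulr0.
by move/eqP; rewrite mulf_eq0 (negPf E0) => /eqP.
Qed.

Lemma deriv_eq0_size (R : idomainType) (p : {poly R}) :
  [pchar R] =i pred0 -> (1 < size p)%N -> p^`() != 0.
Proof.
move=> /pcharf0P ch sp; apply: contraTneq sp => dp0; rewrite -leqNgt.
apply/leq_sizeP => -[//|j] _; have /(congr1 (fun q : {poly R} => q`_j)) := dp0.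
rewrite coef_deriv coef0 -mulr_natr => /eqP.
by rewrite mulf_eq0 ch orbF => /eqP.
Qed.

(** * Smooth affine curves that are monic in y: cancellation, separability, zeros *)

Section Affine.
Variable K : closedFieldType.
Notation PP := {poly {poly K}}.

Definition affine_smooth (f : PP) := forall x y, f.[y%:P].[x] = 0 ->
  (f^`()).[y%:P].[x] != 0 \/ (map_poly deriv f).[y%:P].[x] != 0.

Lemma monic_rem (f p : PP) : f \is monic -> exists q r,
  p = q * f + r /\ (size r < size f)%N.
Proof.
move=> fm; exists (Pdiv.Ring.rdivp p f), (Pdiv.Ring.rmodp p f).
by rewrite -Pdiv.RingMonic.rdivp_eq // Pdiv.Ring.ltn_rmodpN0 // monic_neq0.
Qed.

Lemma monic_small (f q r : PP) : f \is monic -> r = q * f -> (size r < size f)%N -> r = 0.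
Proof.
move=> fm ->; have [->|q0] := eqVneq q 0; first by rewrite mul0r.
rewrite (size_mul q0) ?monic_neq0 //.
by move: q0; rewrite -size_poly_gt0; case: (size q) => // n _; rewrite addSn /= ltnNge leq_addl.
Qed.

Lemma scalar_reduce (f a a' q : PP) (N : {poly K}) : f \is monic ->
  a = N%:P * a' + q * f -> (size a < size f)%N ->
  exists2 r, a = N%:P * r & (size r < size f)%N.
Proof.
move=> fm Da sa; have [q1 [r [Dr sr]]] := monic_rem a' fm.
exists r => //; apply/eqP; rewrite -subr_eq0; apply/eqP.
apply: (@monic_small f (N%:P * q1 + q)) => //; first by rewrite Da Dr; ring.
apply: leq_ltn_trans (size_polyD _ _) _; rewrite gtn_max sa size_polyN.
by apply: leq_ltn_trans sr; rewrite mul_polyC size_scale_leq.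
Qed.

Lemma cancel_xsub1 (f p r : PP) c : f \is monic ->
  xsub c * p = r * f -> exists r', p = r' * f.
Proof.
move=> fm Dp; have [r1 Dr] := spec_decomp c r.
have : spec c r * spec c f = 0.
  by rewrite -rmorphM -Dp rmorphM /= spec_xsub mul0r.
move/eqP; rewrite mulf_eq0 (negPf (monic_neq0 (monic_spec c fm))) orbF => /eqP r0.
exists r1; move: Dp; rewrite Dr r0 rmorph0 add0r -mulrA; apply: mulfI.
by rewrite polyC_eq0 polyXsubC_eq0.
Qed.

Lemma cancel_xsub (f p r : PP) c n : f \is monic ->
  xsub c ^+ n * p = r * f -> exists r', p = r' * f.
Proof.
move=> fm; elim: n p r => [|n IHn] p r; first by rewrite expr0 mul1r; exists r.
by rewrite exprS -mulrA => /(cancel_xsub1 fm)[r']; apply: IHn.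
Qed.

Lemma exp_congr (R : comNzRingType) (a b q f : R) n : a = b + q * f ->
  exists r, a ^+ n = b ^+ n + r * f.
Proof.
move=> Da; elim: n => [|n [r IHn]]; first by exists 0; rewrite mul0r addr0.
by exists (q * b ^+ n + a * r); rewrite !exprS IHn {1 2}Da; ring.
Qed.

Lemma sum_congr (R : comNzRingType) (f : R) n (u v : 'I_n -> R) :
  (forall i, exists r, u i = v i + r * f) ->
  exists r, \sum_(i < n) u i = \sum_(i < n) v i + r * f.
Proof.
elim: n u v => [|n IHn] u v h; first by exists 0; rewrite !big_ord0 mul0r addr0.
have [r0 D0] := h ord0; have [r Dr] := IHn _ _ (fun i => h (lift ord0 i)).
by exists (r0 + r); rewrite !big_ord_recl D0 Dr; ring.
Qed.

(** The relation says that a / N is integral over K[x, y]/(f). The linear factors of N are cancelled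
    one at a time: [integral_over_fiber] makes a divisible by x - c modulo f, and the quotient
    satisfies the same relation for the remaining factor of N. *)
Lemma integral_closed (f : PP) (N : {poly K}) (a Q : PP) (n : nat) (g : nat -> PP) :
  f \is monic -> affine_smooth f -> N != 0 -> (0 < n)%N ->
  a ^+ n + \sum_(i < n) g i * N%:P ^+ (n - i) * a ^+ i = Q * f ->
  exists a' q, a = N%:P * a' + q * f.
Proof.
move=> fm fs N0 n0; move: {2}(size N) (leqnn (size N)) N0 => k.
elim: k N a Q => [|k IHk] N a Q.
  by rewrite leqn0 size_poly_eq0 => /eqP-> /eqP.
move=> sN N0 EQ; have [/eqP/size_poly1P[c c0 DN]|/closed_rootP[c]] := eqVneq (size N) 1%N.
  exists (c^-1%:P%:P * a), 0; rewrite mul0r addr0 DN mulrA -!polyCM divff //.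
  by rewrite mul1r.
move/factor_theorem => [N' DN].
have N'0 : N' != 0 by apply: contraNneq N0 => N'0; rewrite DN N'0 mul0r.
have DNP : N%:P = xsub c * N'%:P by rewrite DN mulrC polyCM.
have [||a1 [q1 Da]] := @integral_over_fiber K f a Q c n (fun i => g i * N'%:P ^+ (n - i)) fm _ n0.
- by move=> y; apply: fs.
- by rewrite -EQ; congr (_ + _); apply: eq_bigr => i _; rewrite DNP exprMn; ring.
pose S := a1 ^+ n + \sum_(i < n) g i * N'%:P ^+ (n - i) * a1 ^+ i.
have [r1 Dr1] := exp_congr n Da.
have [r2 Dr2] : exists r, \sum_(i < n) g i * N%:P ^+ (n - i) * a ^+ i =
   \sum_(i < n) g i * N%:P ^+ (n - i) * (xsub c * a1) ^+ i + r * f.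
  apply: sum_congr => i; have [r Dr] := exp_congr i Da.
  by exists (g i * N%:P ^+ (n - i) * r); rewrite Dr; ring.
have Es : \sum_(i < n) g i * N%:P ^+ (n - i) * (xsub c * a1) ^+ i =
    xsub c ^+ n * \sum_(i < n) g i * N'%:P ^+ (n - i) * a1 ^+ i.
  rewrite mulr_sumr; apply: eq_bigr => i _.
  rewrite DNP !exprMn.
  have -> : xsub c ^+ n = xsub c ^+ (n - i) * xsub c ^+ i.
    by rewrite -exprD subnK // ltnW.
  by ring.
have : xsub c ^+ n * S = (Q - r1 - r2) * f.
  by rewrite !mulrBl -EQ Dr1 Dr2 Es /S exprMn; ring.
case/(cancel_xsub fm) => r Dr.
have [|a' [q Da1]] := IHk N' a1 r _ N'0 Dr.
  by move: sN; rewrite DN size_Mmonic ?monicXsubC // size_XsubC addn2.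
by exists a', (xsub c * q + q1); rewrite Da Da1 DNP; ring.
Qed.

(* A square factor g of f gives a = f / g with a^2 divisible by f; integral
   closedness then makes a divisible by every power of x. *)
Lemma affine_separable (f : PP) : [pchar K] =i pred0 ->
  f \is monic -> affine_smooth f -> separable_poly f.
Proof.
move=> ch fm fs; have f0 := monic_neq0 fm.
apply/separable_polyP; split=> [u v uvf|u _ su]; last first.
  by apply: deriv_eq0_size su => p; rewrite pchar_poly ch.
apply: contraT => ncop; set g := gcdp u v.
have ggf : g * g %| f by apply: dvdp_trans uvf; rewrite dvdp_mul ?dvdp_gcdl ?dvdp_gcdr.
have [[c B] /= c0 DB] := Pdiv.Idomain.dvdpP _ _ ggf.
have cf0 : c *: f != 0 by rewrite -mul_polyC mulf_eq0 polyC_eq0 (negPf c0).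
have := cf0; rewrite DB !mulf_eq0 !negb_or => /and3P[B0 g0 _].
have sg : (1 < size g)%N.
  by move: ncop; rewrite /coprimep neq_ltn ltnS leqn0 size_poly_eq0 (negPf g0).
have Bg0 : B * g != 0 by rewrite mulf_neq0.
set a : PP := B * g in Bg0; have a0 : a != 0 := Bg0.
have Dcf : c *: f = a * g by rewrite DB mulrA.
have sa : (size a < size f)%N.
  rewrite -(size_scale f c0) Dcf (size_mul a0 g0).
  by case: (size g) sg => [|[|m]] // _; rewrite !addnS /= ltnS leq_addr.
have DD : a ^+ 2 = (B * c%:P) * f by rewrite -mulrA mul_polyC DB /a; ring.
pose M := (\max_(i < size a) size (a`_i)%R)%N.
have HM i : (size (a`_i)%R <= M)%N.
  case: (ltnP i (size a)) => hi; last by rewrite nth_default // size_poly0.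
  exact: (leq_bigmax (Ordinal hi)).
have [|||a' [q Da]] := @integral_closed f ('X^M) a (B * c%:P) 2 (fun=> 0) fm fs.
- by rewrite expf_neq0 ?polyX_eq0.
- by [].
- by rewrite big1 ?addr0 // => i _; rewrite !mul0r.
have [r Dr _] := scalar_reduce fm Da sa.
case/eqP: a0; apply/polyP=> i; rewrite coef0; apply/eqP; apply: contraT => ai0.
have := HM i; rewrite Dr coefCM mulrC size_mulXn; last first.
  by apply: contraNneq ai0 => ri0; rewrite Dr coefCM ri0 mulr0.
move: ai0; rewrite Dr coefCM mulf_eq0 negb_or => /andP[_].
by rewrite -size_poly_gt0 => r0; rewrite -{2}[M]addn0 leq_add2l leqNgt r0.
Qed.

Lemma separable_dvd_roots (p q : {poly K}) : separable_poly p ->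
  (forall y, root p y -> root q y) -> p %| q.
Proof.
move=> sp h; have p0 := separable_poly_neq0 sp.
have [->|q0] := eqVneq q 0; first exact: dvdp0.
set d := gcdp p q; have Dp : p = p %/ d * d by rewrite divpK // dvdp_gcdl.
have [/eqP/size_poly1P[e e0 De]|/closed_rootP[y ry]] := eqVneq (size (p %/ d)) 1%N.
  by rewrite Dp De mul_polyC dvdpZl // dvdp_gcdr.
have rp : root p y by rewrite Dp rootM ry.
have rd : root d y by rewrite root_gcd rp h.
have /separable_polyP[/(_ ('X - y%:P) ('X - y%:P)) + _] := sp.
rewrite coprimepp size_XsubC => H.
have /H // : ('X - y%:P) * ('X - y%:P) %| p.
by rewrite Dp dvdp_mul // dvdp_XsubCl.
Qed.

(** Let r be the remainder of g modulo f. A Bezout identity between f and its y-derivative shows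
    that f(x, y) is separable in y for all but finitely many x; there r(x, y) has too many roots for
    its degree, so the coefficients of r vanish at almost all x. The factor [E] allows finitely many
    fibers to be ignored. *)
Lemma nullstellensatz_affine (f g : PP) (E : {poly K}) : f \is monic ->
  separable_poly f -> E != 0 ->
  (forall x y, E.[x] != 0 -> f.[y%:P].[x] = 0 -> g.[y%:P].[x] = 0) ->
  exists q, g = q * f.
Proof.
move=> fm fsep E0 h; have [q [r [Dg sr]]] := monic_rem g fm.
suff r0 : r = 0 by exists q; rewrite Dg r0 addr0.
have := fsep; rewrite unlock => /Pdiv.Idomain.Bezout_coprimepP[[u v] /= ].
case/Pdiv.Idomain.eqpP => -[c1 c2] /= /andP[c10 c20] Duv.
apply/polyP=> i; rewrite coef0; apply: (@horner_generic_eq0 _ (E * c2)).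
  by rewrite mulf_neq0.
move=> x; rewrite hornerM mulf_eq0 negb_or => /andP[Ex c2x].
have sf : separable_poly (spec x f).
  rewrite unlock; apply/Bezout_coprimepP; exists (c1.[x] *: spec x u, c1.[x] *: spec x v).
  rewrite /= -!scalerAl -scalerDr -spec_deriv -!rmorphM -rmorphD /=.
  have <- : spec x (c2 *: 1) = c1.[x] *: spec x (u * f + v * f^`()).
    by rewrite -Duv /spec map_polyZ /=.
  by rewrite /spec map_polyZ /= rmorph1 alg_polyC polyC_eqp1.
have dv : spec x f %| spec x r.
  apply: separable_dvd_roots sf _ => y; rewrite /root !spec_horner => /eqP fy.
  have := h x y Ex fy; rewrite Dg !hornerE fy mulr0 add0r => ->; exact: eqxx.
have sx0 : spec x r = 0.
  apply/eqP; apply: contraLR (sr) => sr0; rewrite -leqNgt.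
  have := dvdp_leq sr0 dv; rewrite size_map_poly_id0; last first.
    by rewrite (monicP fm) rmorph1 oner_neq0.
  by move/leq_trans; apply; apply: size_poly.
by have := congr1 (fun p : {poly K} => p`_i) sx0; rewrite coef_map coef0.
Qed.

End Affine.

(** * Irreducibility from two affine charts *)

Section TwoCharts.
Variable K : closedFieldType.
Notation PP := {poly {poly K}}.

(** The reciprocal polynomial x^n q(1/x), for q of degree at most n. *)
Definition revp (n : nat) (q : {poly K}) := \poly_(i < n.+1) q`_(n - i).

Lemma horner_revp n (q : {poly K}) (x : K) : (size q <= n.+1)%N -> x != 0 ->
  (revp n q).[x] = x ^+ n * q.[x^-1].
Proof.
move=> sq x0; rewrite horner_poly (horner_coef_wide _ sq) mulr_sumr.
rewrite (reindex_inj rev_ord_inj) /=; apply: eq_bigr => i _.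
have le_in : (i <= n)%N by rewrite -ltnS.
rewrite subSS subKn // exprVn mulrCA; congr (_ * _).
have -> : x ^+ n = x ^+ (n - i) * x ^+ i by rewrite -exprD subnK.
by rewrite mulfK // expf_neq0.
Qed.

(** As a Laurent polynomial, x^e q(1/x) has no term of degree above e. This turns regularity at
    infinity into a bound on degrees. *)
Lemma size_pole_bound (E p q : {poly K}) (j e : nat) : E != 0 -> p != 0 ->
  (forall x, x != 0 -> E.[x] != 0 -> p.[x] * x ^+ j = x ^+ e * q.[x^-1]) ->
  (size p + j <= e.+1)%N.
Proof.
move=> E0 p0 h; pose n := size q.
have Dp : p * 'X^(j + n) = 'X^e * revp n q.
  apply/eqP; rewrite -subr_eq0; apply/eqP.
  apply: (@horner_generic_eq0 _ ('X * E)); first by rewrite mulf_neq0 ?polyX_eq0.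
  move=> x; rewrite !hornerE mulf_eq0 negb_or => /andP[x0 Ex].
  rewrite horner_revp // ?leqnSn // exprD mulrA h //; ring.
have : (size (p * 'X^(j + n))%R <= e + n.+1)%N.
  rewrite Dp mulrC; have [->|r0] := eqVneq (revp n q) 0; first by rewrite mul0r size_poly0.
  by rewrite size_mulXn // leq_add2l size_poly.
by rewrite size_mulXn //; lia.
Qed.

Lemma cancel_const (f p r : PP) (N : {poly K}) : f \is monic -> N != 0 ->
  N%:P * p = r * f -> exists r', p = r' * f.
Proof.
move=> fm N0 Dp; have [q [s [Ds ss]]] := monic_rem p fm.
have : N%:P * s = 0.
  apply: (@monic_small _ f (r - N%:P * q)) => //; first by rewrite mulrBl -Dp Ds; ring.
  by apply: leq_ltn_trans ss; rewrite mul_polyC size_scale_leq.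
move/eqP; rewrite mulf_eq0 polyC_eq0 (negPf N0) => /eqP s0.
by exists q; rewrite Ds s0 addr0.
Qed.

Lemma bezout_clear (f u : PP) : coprimep f u ->
  exists N a b, N != 0 /\ N%:P = a * u + b * f.
Proof.
case/Pdiv.Idomain.Bezout_coprimepP => -[b a] /= /Pdiv.Idomain.eqpP[[c1 c2]] /=.
case/andP => c10 c20 D; exists c2, (c1 *: a), (c1 *: b); split=> //.
by rewrite -!scalerAl -scalerDr [_ * u + _]addrC D -mul_polyC mulr1.
Qed.

(** Bezout over K(x) gives N = a u modulo f, so v / u equals a v / N, a fraction to which
    [integral_closed] applies; N is cancelled afterwards. *)
Lemma integral_fraction (f u v Q : PP) n (g : nat -> PP) :
  f \is monic -> affine_smooth f -> coprimep f u -> (0 < n)%N ->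
  v ^+ n + \sum_(i < n) g i * u ^+ (n - i) * v ^+ i = Q * f ->
  exists a q, v = a * u + q * f.
Proof.
move=> fm fs fu n0 EQ; have [N [a [b [N0 DN]]]] := bezout_clear fu.
have [r1 Dr1] : exists r, \sum_(i < n) g i * N%:P ^+ (n - i) * (a * v) ^+ i =
   \sum_(i < n) g i * (a * u) ^+ (n - i) * (a * v) ^+ i + r * f.
  apply: sum_congr => i; have [r Dr] := exp_congr (n - i) DN.
  by exists (g i * r * (a * v) ^+ i); rewrite Dr; ring.
have Es : \sum_(i < n) g i * (a * u) ^+ (n - i) * (a * v) ^+ i =
    a ^+ n * \sum_(i < n) g i * u ^+ (n - i) * v ^+ i.
  rewrite mulr_sumr; apply: eq_bigr => i _; rewrite !exprMn.
  have -> : a ^+ n = a ^+ (n - i) * a ^+ i by rewrite -exprD subnK // ltnW.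
  by ring.
have [|a' [q Da]] := @integral_closed K f N (a * v) (a ^+ n * Q + r1) n g fm fs N0 n0.
  by rewrite Dr1 Es mulrDl -mulrA -EQ exprMn; ring.
have [r Dr] : exists r, v - a' * u = r * f.
  apply: (@cancel_const f _ (q * u + b * v - b * a' * u + b * a' * u) N) => //.
  have -> : N%:P * (v - a' * u) = (a * u + b * f) * v - N%:P * a' * u.
    by rewrite -DN; ring.
  have -> : (a * u + b * f) * v = (a * v) * u + b * f * v by ring.
  by rewrite Da; ring.
by exists a', r; rewrite -Dr; ring.
Qed.

Variables (f1 f2 : PP) (d : nat).
Hypothesis charK : [pchar K] =i pred0.
Hypotheses (f1m : f1 \is monic) (f2m : f2 \is monic).
Hypotheses (f1s : affine_smooth f1) (f2s : affine_smooth f2).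
Hypotheses (sf1 : size f1 = d.+1) (sf2 : size f2 = d.+1).
Hypothesis f12 : forall w y, w != 0 ->
  f2.[y%:P].[w] = w ^+ d * f1.[(y / w)%:P].[w^-1].

(* In the second chart the idempotent can only have a pole at w = 0, and it has
   none by integral closedness: it is regular on the whole projective curve. *)
Lemma idempotent_const (e Q : PP) : (size e <= d)%N -> e ^+ 2 - e = Q * f1 ->
  exists c, e = c%:P%:P.
Proof.
have aux s k m : (s + k <= m -> s <= (m - k).+1)%N by lia.
have aux2 s k m : (s + k <= m -> k <= m)%N by lia.
(* [n] bounds the total degree of [e], so w^n e(1/w, y/w) is a polynomial: this is [b]. *)
move=> se EQ; pose n := (\max_(j < d) (size (e`_j)%R + j))%N.
have Hn j : (j < d)%N -> (size (e`_j)%R + j <= n)%N.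
  by move=> jd; exact: (leq_bigmax (Ordinal jd)).
pose b : PP := \poly_(j < d) revp (n - j) e`_j.
have Hb w y : w != 0 -> b.[y%:P].[w] = w ^+ n * e.[(y / w)%:P].[w^-1].
  move=> w0; rewrite horner_poly (horner_coef_wide _ se) !horner_sum mulr_sumr.
  apply: eq_bigr => j _; have := Hn j (ltn_ord j) => hj.
  rewrite -!rmorphXn /= !hornerM !hornerC horner_revp //; last by apply: aux hj.
  rewrite expr_div_n -{2}(@subnK j n); last by apply: aux2 hj.
  by rewrite exprD; field; rewrite expf_neq0.
have [|||q Dq] := @nullstellensatz_affine K f2 (b ^+ 2 - 'X^n%:P * b) 'X f2m.
- by apply: affine_separable.
- by rewrite polyX_eq0.
- move=> w y; rewrite hornerX => w0; rewrite f12 // => /eqP.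
  rewrite mulf_eq0 expf_eq0 (negPf w0) andbF /= => /eqP f10.
  rewrite !hornerE !Hb // ?hornerXn.
  have := congr1 (fun p : PP => p.[(y / w)%:P].[w^-1]) EQ.
  rewrite !hornerE f10 mulr0; set v := e.[_, _] => Ev.
  transitivity (w ^+ n * w ^+ n * (v ^+ 2 - v)); first by rewrite /=; ring.
  by rewrite Ev mulr0.
(* b^2 - w^n b = 0 on the second chart makes b / w^n integral: the coefficient is -1 at i = 1 and 0
   at i = 0. *)
have [|||b' [r Db]] := @integral_closed K f2 'X^n b q 2
    (fun i => if i == 1%N then -1 else 0) f2m f2s.
- by rewrite expf_neq0 // polyX_eq0.
- by [].
- by rewrite big_ord_recr big_ord1 /= !mul0r add0r subn1 -Dq; ring.
have [|c Dc _] := scalar_reduce f2m Db.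
  by rewrite sf2 ltnS size_poly.
(* [size] exceeds the degree by one, so the bound 1 means total degree 0. *)
have small j : e`_j != 0 -> (size (e`_j)%R + j <= 1)%N.
  move=> ej; have jd : (j < d)%N.
    by rewrite ltnNge; apply: contra ej => dj; rewrite nth_default // (leq_trans se).
  apply: (@size_pole_bound 1 _ c`_j) => //; first exact: oner_neq0.
  move=> x x0 _; have := congr1 (fun p : PP => (p`_j).[x^-1]) Dc.
  have hj := Hn j jd.
  rewrite coef_poly jd coefCM hornerM horner_revp ?invr_eq0 //; last by apply: aux hj.
  rewrite hornerXn invrK expr0 mul1r -[in X in _ = X -> _](@subnK j n); last by apply: aux2 hj.
  rewrite exprD -mulrA => /mulfI ->; last by rewrite expf_neq0 ?invr_eq0.
  by rewrite exprVn mulrAC mulVf ?mul1r // expf_neq0.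
exists (e`_0)`_0; apply/polyP => j; rewrite coefC.
have [->|j0] := posnP j.
  apply: size1_polyC; have [->|/small] := eqVneq e`_0 0; first by rewrite size_poly0.
  by rewrite addn0.
apply/eqP; apply: contraT => ej.
by have := small j ej; move: ej; rewrite -size_poly_gt0; case: (size _) => // m _; lia.
Qed.

(** A gcd that is a proper factor A gives c f1 = A B with A and B coprime over K(x), by
    separability. From N = b A + a B, the fraction b A / N is idempotent modulo f1, hence integral,
    hence a constant 0 or 1, and either value makes one of the two factors trivial. *)
Lemma affine_irreducible (g : PP) : (exists q, g = q * f1) \/ coprimep f1 g.
Proof.
have [cop|ncop] := boolP (coprimep f1 g); [by right|left].
have f10 := monic_neq0 f1m.
set A := gcdp f1 g; have Af : A %| f1 by apply: dvdp_gcdl.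
have A0 : A != 0 by rewrite gcdp_eq0 (negPf f10).
have sA : (1 < size A)%N.
  by move: ncop; rewrite /coprimep neq_ltn ltnS leqn0 size_poly_eq0 (negPf A0).
have [[c B] /= c0 DB] := Pdiv.Idomain.dvdpP _ _ Af.
have [sB|sB] := leqP (size B) 1%N.
  have fA : f1 %| A.
    have [e De] : exists e, B = e%:P by exists B`_0; apply: size1_polyC.
    apply/Pdiv.Idomain.dvdpP; exists (e, c%:P) => /=; last first.
      by rewrite mul_polyC DB De mul_polyC.
    apply: contraNneq c0 => e0; move: DB; rewrite De e0 mul0r -mul_polyC => /eqP.
    by rewrite mulf_eq0 polyC_eq0 (negPf f10) orbF.
  have /Pdiv.Idomain.dvdpP[[c' q] /= c'0 Dq] : f1 %| g by apply: dvdp_trans fA (dvdp_gcdr _ _).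
  by apply: (@cancel_const f1 g q c') => //; rewrite mul_polyC.
exfalso.
have sep := affine_separable charK f1m f1s.
have cAB : coprimep A B.
  have /separable_polyP[h _] := sep; apply: h.
  by apply/Pdiv.Idomain.dvdpP; exists (c, 1); rewrite //= mul1r mulrC.
have [N [a [b [N0 DN]]]] := bezout_clear cAB.
have AB : A * B = c%:P * f1 by rewrite mulrC -DB mul_polyC.
pose x := b * A.
have [||x' [q Dx]] := @integral_closed K f1 N x (- (a * b * c%:P)) 2
    (fun i => if i == 1%N then -1 else 0) f1m f1s N0.
- by [].
- rewrite big_ord_recr big_ord1 /= !mul0r add0r subn1.
  have -> : x ^+ 2 + -1 * N%:P ^+ 1 * x ^+ 1 = - (a * b) * (A * B).
    by rewrite expr1 DN /x; ring.
  by rewrite AB; ring.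
have [q1 [e [De se]]] := monic_rem x' f1m.
rewrite sf1 ltnS in se.
have Dxe : x = N%:P * e + (N%:P * q1 + q) * f1 by rewrite Dx De; ring.
have [Q DQ] : exists Q, e ^+ 2 - e = Q * f1.
  pose t := N%:P * q1 + q.
  apply: (@cancel_const f1 _ (- (a * b * c%:P) - t * (N%:P * e + x) + N%:P * t) (N ^+ 2)).
  - by [].
  - by rewrite expf_neq0.
  have -> : (N ^+ 2)%:P = N%:P * N%:P :> PP by rewrite expr2 polyCM.
  have Et : t * f1 = x - N%:P * e by rewrite Dxe /t; ring.
  transitivity (- (a * b) * (c%:P * f1) - (t * f1) * (N%:P * e + x) + N%:P * (t * f1)).
    by rewrite Et -AB DN /x; ring.
  by ring.
have [k Dk] := idempotent_const se DQ.
have : e ^+ 2 - e = 0.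
  apply: (@monic_small _ f1 Q) => //.
  rewrite Dk -rmorphXn -rmorphB -rmorphXn -rmorphB /= sf1 ltnS.
  apply: leq_trans (size_polyC_leq1 _) _.
  by rewrite -ltnS -sf1; apply: leq_trans sA (dvdp_leq f10 Af).
have aux (m n : nat) : (0 < m -> 1 < n -> true = (n + m).-1 :> nat -> False)%N by lia.
(* If f1 divides r U, then V divides c N, which is constant in y, although V has positive degree in
   y. *)
have contr (U V r s : PP) : (1 < size V)%N -> U * V = c%:P * f1 -> N%:P = r * U + s * V ->
    forall q', r * U = q' * f1 -> False.
  move=> sV UV DN' q' Dq.
  have : c%:P * N%:P = V * (q' * U + s * c%:P).
    rewrite DN' Dq.
    transitivity (q' * (c%:P * f1) + s * V * c%:P); first by ring.
    by rewrite -UV; ring.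
  rewrite -polyCM => /(congr1 (fun p : PP => size p)).
  rewrite size_polyC mulf_neq0 // => H.
  have V0 : V != 0 by rewrite -size_poly_gt0 (leq_trans _ sV).
  have [w0|w0] := eqVneq (q' * U + s * c%:P) 0; first by rewrite w0 mulr0 size_poly0 in H.
  move: H; rewrite size_mul // => H; move: w0 sV H.
  by rewrite -size_poly_gt0; apply: aux.
move/eqP; rewrite Dk expr2 -[X in _ - X]mulr1 -mulrBr mulf_eq0 !polyC_eq0 => /orP[/eqP k0|].
  have DN' : N%:P = b * A + a * B by rewrite DN addrC.
  apply: (contr A B b a sB AB DN' (N%:P * q1 + q)).
  by rewrite -/x Dxe Dk k0 mulr0 add0r.
rewrite subr_eq0 -!polyC1 !(inj_eq (@polyC_inj _)) => /eqP k1.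
have BA : B * A = c%:P * f1 by rewrite mulrC.
apply: (contr B A a b sA BA DN (- (N%:P * q1 + q))).
have -> : a * B = N%:P - x.
  by rewrite DN /x; ring.
by rewrite Dxe Dk k1; ring.
Qed.

End TwoCharts.

(** * Ternary forms *)

Definition o0 : 'I_3 := ord0.
Definition o1 : 'I_3 := lift ord0 ord0.
Definition o2 : 'I_3 := lift ord0 (lift ord0 ord0).

Lemma ord3P (i : 'I_3) : [\/ i = o0, i = o1 | i = o2].
Proof.
case: i => [[|[|[|//]]] lti]; [apply: Or31|apply: Or32|apply: Or33]; exact: val_inj.
Qed.

Lemma forall3 (P : 'I_3 -> Prop) : P o0 -> P o1 -> P o2 -> forall i, P i.
Proof. by move=> ? ? ? i; case: (ord3P i) => ->. Qed.

Lemma big3 (R : Type) (idx : R) (op : Monoid.law idx) (F : 'I_3 -> R) :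
  \big[op/idx]_(i < 3) F i = op (op (F o0) (F o1)) (F o2).
Proof. by rewrite !big_ord_recl big_ord0 Monoid.mulm1 Monoid.mulmA. Qed.

(** The triple (a, b, c), by matching on the value of the index so that it computes on [o0], [o1]
    and [o2]. *)
Definition h3 (T : Type) (a b c : T) : 'I_3 -> T :=
  fun i => if val i is n.+1 then if n is _.+1 then c else b else a.

Lemma mdeg3 (m : 'X_{1..3}) : mdeg m = (m o0 + m o1 + m o2)%N.
Proof. by rewrite mdegE big3. Qed.

Section MmapGeneral.
Variables (n : nat) (R : comNzRingType).

Lemma mmap_rmorph (S S' : comNzRingType) (f : {rmorphism R -> S})
  (g : {rmorphism S -> S'}) (h : 'I_n -> S) (p : {mpoly R[n]}) :
  g (mmap f h p) = mmap (g \o f) (g \o h) p.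
Proof.
rewrite /mmap rmorph_sum; apply: eq_bigr => m _; rewrite rmorphM; congr (_ * _).
by rewrite /mmap1 rmorph_prod; apply: eq_bigr => i _; rewrite rmorphXn.
Qed.

Lemma mmap_ext (S : comNzRingType) (f f' : {rmorphism R -> S}) (h h' : 'I_n -> S)
  (p : {mpoly R[n]}) : f =1 f' -> h =1 h' -> mmap f h p = mmap f' h' p.
Proof.
move=> ff hh; rewrite /mmap; apply: eq_bigr => m _; rewrite ff; congr (_ * _).
by rewrite /mmap1; apply: eq_bigr => i _; rewrite hh.
Qed.

Lemma mmap_homog (S : comNzRingType) (f : {rmorphism R -> S}) (h : 'I_n -> S) t d
  (p : {mpoly R[n]}) : p \is d.-homog ->
  mmap f (fun i => t * h i) p = t ^+ d * mmap f h p.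
Proof.
move=> /dhomogP hp; rewrite /mmap mulr_sumr; apply: eq_big_seq => m mp.
rewrite mulrCA; congr (_ * _); rewrite /mmap1 -(hp m mp) /= mdegE expr_sum -big_split /=.
by apply: eq_bigr => i _; rewrite exprMn.
Qed.

(** The chain rule, for an arbitrary derivation so that one proof serves the y-derivative and the
    coefficientwise x-derivative of a chart, partial derivatives after a linear substitution, and
    derivatives along a line. *)
Lemma mmap_derivation (S : comNzRingType) (f : {rmorphism R -> S}) (h : 'I_n -> S)
  (D : {additive S -> S}) (p : {mpoly R[n]}) :
  (forall a b, D (a * b) = D a * b + a * D b) -> (forall c, D (f c) = 0) ->
  D (mmap f h p) = \sum_i mmap f h p^`M(i) * D (h i).
Proof.
move=> DM Df.
have D1 : D 1 = 0 by rewrite -(rmorph1 f) Df.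
have DX m : D (mmap1 h m) = \sum_i mmap f h ('X_[m])^`M(i) * D (h i).
  have DXn (x : S) k : D (x ^+ k) = x ^+ k.-1 *+ k * D x.
    elim: k => [|k IHk]; first by rewrite expr0 D1 mulr0n mul0r.
    rewrite exprS DM IHk /=; case: k {IHk} => [|k].
      by rewrite expr0 mulr0n !mul0r mulr0 mulr1 addr0 mulr1n mul1r.
    by rewrite /= mulrA mulrnAr -exprS [in RHS]mulrS mulrDl mulrC.
  have Dprod (r : seq 'I_n) : uniq r -> D (\prod_(i <- r) h i ^+ m i) =
      \sum_(i <- r) ((m i)%:R * h i ^+ (m i).-1 * \prod_(j <- r | j != i) h j ^+ m j) * D (h i).
    elim: r => [|a r IHr] /=; first by rewrite !big_nil.
    case/andP => ar ur; rewrite !big_cons DM DXn IHr // eqxx /=.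
    congr (_ + _).
      have -> : \prod_(j <- r | j != a) h j ^+ m j = \prod_(j <- r) h j ^+ m j.
        rewrite big_seq_cond [RHS]big_seq; apply: eq_bigl => j.
        by have [jr|//] := boolP (j \in r); rewrite /= (memPn ar).
      by rewrite -[_ *+ m a]mulr_natl; ring.
    rewrite mulr_sumr; apply: eq_big_seq => i ir.
    by rewrite big_cons (_ : a != i) ?(memPn ar) 1?eq_sym ?(memPn ar) //; ring.
  rewrite /mmap1 Dprod ?index_enum_uniq //; apply: eq_bigr => i _; congr (_ * _).
  rewrite mderivX mmapZ rmorph_nat mmapX /mmap1 -mulrA; congr (_ * _).
  rewrite [in RHS](bigD1 i) //= mnmBE mnm1E eqxx subn1; congr (_ * _).
  by apply: eq_bigr => j ji; rewrite mnmBE mnm1E eq_sym (negPf ji) subn0.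
elim/mpolyind: p => [|c m p _ _ IHp].
  by rewrite !raddf0 big1 // => i _; rewrite mderiv0 mmap0 mul0r.
rewrite mmapD raddfD /= IHp mmapZ mmapX DM Df mul0r add0r DX mulr_sumr -big_split /=.
by apply: eq_bigr => i _; rewrite mderivD mderivZ mmapD mmapZ; ring.
Qed.

Lemma euler d (p : {mpoly R[n]}) : p \is d.-homog ->
  \sum_i 'X_i * p^`M(i) = p *+ d.
Proof.
move=> /dhomogP hp; rewrite [in RHS](mpolyE p) -sumrMnl.
under eq_bigr => i _ do rewrite [in p^`M(i)](mpolyE p) raddf_sum mulr_sumr.
rewrite exchange_big /=; apply: eq_big_seq => m mp.
rewrite -(hp m mp) /= mdegE -sumrMnr; apply: eq_bigr => i _.
rewrite mderivZ mderivX -!scalerAr -mpolyXD scaler_nat -scalerMnr.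
have [->|mi] := posnP (m i); first by rewrite !mulr0n.
by rewrite addmC submK // lep1mP -lt0n.
Qed.

Lemma dhomog_mderiv d (p : {mpoly R[n]}) i : p \is d.+1.-homog ->
  p^`M(i) \is d.-homog.
Proof.
move=> /dhomogP hp; rewrite (mpolyE p) raddf_sum big_seq rpred_sum //= => m mp.
rewrite mderivZ mderivX; apply/rpredZ.
have [->|mi] := posnP (m i); first by rewrite scale0r rpred0.
apply/rpredZ; rewrite dhomogX /=; have := hp m mp; rewrite /= => hm.
by rewrite -eqSS -hm -{2}(@submK _ U_(i)%MM m) ?lep1mP -?lt0n // mdegD mdeg1 addn1.
Qed.

End MmapGeneral.

Section Charts.
Variable K : closedFieldType.
Notation PP := {poly {poly K}}.
Notation MP := {mpoly K[3]}.

(** The substitution (p(x), q(x), y). It is used as [chart 'X 1], giving F(x, 1, y), and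
    [chart 1 'X], giving F(1, x, y); together these cover all points except (0:0:1). *)
Definition chart (p q : {poly K}) : MP -> PP :=
  mmap (polyC \o polyC) (h3 p%:P q%:P 'X).
HB.instance Definition _ p q := GRing.RMorphism.on (chart p q).

Lemma meval_mmap (v : 'I_3 -> K) G : G.@[v] = mmap idfun v G.
Proof. by []. Qed.

Lemma meval_homog (v : 'I_3 -> K) t d (G : MP) : G \is d.-homog ->
  G.@[fun i => t * v i] = t ^+ d * G.@[v].
Proof. exact: mmap_homog. Qed.

Lemma meval_homog3 a b c t d (G : MP) : G \is d.-homog ->
  G.@[h3 (t * a) (t * b) (t * c)] = t ^+ d * G.@[h3 a b c].
Proof.
by move=> hG; rewrite -(meval_homog _ _ hG); apply: meval_eq; apply: forall3.
Qed.

Lemma chartE p q (G : MP) x y : (chart p q G).[y%:P].[x] = G.@[h3 p.[x] q.[x] y].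
Proof.
transitivity ((horner_eval x \o horner_eval y%:P) (chart p q G)); first by [].
rewrite mmap_rmorph meval_mmap.
apply: mmap_ext => [c /=|]; first by rewrite !horner_evalE !hornerC.
by apply: forall3; rewrite /= !horner_evalE ?hornerX !hornerC.
Qed.

Lemma chart_deriv p q (G : MP) : (chart p q G)^`() = chart p q G^`M(o2).
Proof.
rewrite /chart mmap_derivation; first last.
- by move=> c; rewrite /= derivC.
- by move=> a b; rewrite /= derivM.
by rewrite big3 /= !derivC !mulr0 !add0r derivX mulr1.
Qed.

Lemma map_deriv_mul (a b : PP) : map_poly deriv (a * b) =
  map_poly deriv a * b + a * map_poly deriv b.
Proof.
apply/polyP=> i; rewrite coefD coef_map /= !coefM raddf_sum -big_split /=.
by apply: eq_bigr => j _; rewrite derivM !coef_map.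
Qed.

Lemma chart_deriv_in p q (G : MP) : map_poly deriv (chart p q G) =
  chart p q G^`M(o0) * p^`()%:P + chart p q G^`M(o1) * q^`()%:P.
Proof.
rewrite /chart mmap_derivation; first last.
- by move=> c; rewrite /= map_polyC /= derivC.
- exact: map_deriv_mul.
rewrite big3 /= !map_polyC /=.
have -> : map_poly deriv 'X = 0 :> PP.
  apply/polyP => i; rewrite coef_map coefX coef0 /=.
  by case: eqP => _; rewrite ?derivC // -polyC1 derivC.
by rewrite mulr0 addr0.
Qed.

Lemma size_chart p q (G : MP) d : G \is d.-homog -> (size (chart p q G) <= d.+1)%N.
Proof.
move=> /dhomogP hG; apply/leq_sizeP => j dj; rewrite /chart /mmap coef_sum big_seq big1 // => m mG.
rewrite /mmap1 big3 /= -!rmorphXn /= -!mulrA !coefCM coefXn.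
have := hG m mG; rewrite /= mdeg3 => hm.
by rewrite (_ : j == m o2 = false) ?mulr0 //; apply/eqP; move: hm dj; lia.
Qed.

Lemma coef_chart p q (G : MP) d : G \is d.-homog ->
  (chart p q G)`_d = (G.@[h3 0 0 1])%:P.
Proof.
move=> /dhomogP hG; rewrite /chart /mmap coef_sum mevalE rmorph_sum.
apply: eq_big_seq => m mG; have := hG m mG; rewrite /= mdeg3 => hm.
rewrite /mmap1 !big3 /= -!rmorphXn /= -!mulrA !coefCM coefXn.
rewrite !expr1n mulr1 rmorphM /=; congr (_ * _).
have [dm|dm] := eqVneq d (m o2).
  have [-> ->] : m o0 = 0%N /\ m o1 = 0%N by lia.
  by rewrite !expr0 !mulr1.
rewrite !mulr0 -exprD expr0n addn_eq0.
case: eqP => [m0|_] /=; last by rewrite mulr0n.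
by case: eqP => [m1|_] /=; rewrite ?mulr0n //; move/eqP: dm; lia.
Qed.

(** Homogenising the monic polynomial of the chart in (u, v): when (pu : qu : v) is on the curve,
    this is the equation of integral dependence of v / u. *)
Lemma chart_homog_expand p q (G : MP) d x u v : G \is d.-homog -> G.@[h3 0 0 1] = 1 ->
  G.@[h3 (p.[x] * u) (q.[x] * u) v] =
  v ^+ d + \sum_(j < d) ((chart p q G)`_j).[x] * u ^+ (d - j) * v ^+ j.
Proof.
move=> hG G1.
have -> : v ^+ d + \sum_(j < d) ((chart p q G)`_j).[x] * u ^+ (d - j) * v ^+ j =
   \sum_(j < d.+1) ((chart p q G)`_j).[x] * u ^+ (d - j) * v ^+ j.
  by rewrite big_ord_recr /= (coef_chart _ _ hG) G1 hornerC mul1r subnn expr0 mul1r addrC.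
have [->|u0] := eqVneq u 0.
  rewrite !mulr0 big_ord_recr /= (coef_chart _ _ hG) G1 hornerC mul1r subnn expr0 mul1r.
  rewrite big1 ?add0r; last first.
    by move=> i _; rewrite expr0n subn_eq0 leqNgt ltn_ord mulr0 mul0r.
  have := meval_homog3 0 0 1 v hG; rewrite G1 !mulr1 !mulr0 => <-; congr (_.@[_]).
rewrite -[v](mulfVK u0) [v / u * u]mulrC ![_ * u]mulrC (meval_homog3 _ _ _ _ hG) -chartE.
rewrite (horner_coef_wide _ (size_chart p q hG)) horner_sum mulr_sumr.
apply: eq_bigr => j _; rewrite -rmorphXn /= hornerM hornerC.
have jd : (j <= d)%N by rewrite -ltnS.
rewrite (_ : u ^+ d = u ^+ (d - j) * u ^+ j); last by rewrite -exprD subnK.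
by rewrite (mulrC u (v / u)) mulfVK //  expr_div_n; field; rewrite expf_neq0.
Qed.

End Charts.

(** * Forms vanishing on a smooth curve that avoids (0:0:1) *)

Section SmoothForm.
Variable K : closedFieldType.
Notation PP := {poly {poly K}}.
Notation MP := {mpoly K[3]}.

Definition nonzero (v : 'I_3 -> K) := exists i, v i != 0.

Definition smooth_form (F : MP) := forall v, nonzero v -> F.@[v] = 0 ->
  exists i, F^`M(i).@[v] != 0.

Definition van (F G : MP) := forall v, nonzero v -> F.@[v] = 0 -> G.@[v] = 0.

Lemma euler_eval d (G : MP) (v : 'I_3 -> K) : G \is d.-homog ->
  v o0 * G^`M(o0).@[v] + v o1 * G^`M(o1).@[v] + v o2 * G^`M(o2).@[v] = d%:R * G.@[v].
Proof.
move=> /euler/(congr1 (meval v)); rewrite big3 /= !mevalD !mevalM !mevalXU mevalMn => ->.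
by rewrite mulr_natl.
Qed.

Lemma h3E (v : 'I_3 -> K) : v =1 h3 (v o0) (v o1) (v o2).
Proof. exact: forall3. Qed.

Variables (d : nat) (F : MP).
Hypothesis charK : [pchar K] =i pred0.
Hypotheses (hF : F \is d.-homog) (F1 : F.@[h3 0 0 1] = 1) (sF : smooth_form F).

Lemma chart_size p q : size (chart p q F) = d.+1.
Proof.
apply/eqP; rewrite eqn_leq size_chart //= ltnNge; apply/negP => /leq_sizeP/(_ d (leqnn d)).
by rewrite (coef_chart _ _ hF) F1 => /eqP; rewrite polyC_eq0 oner_eq0.
Qed.

Lemma chart_monic p q : chart p q F \is monic.
Proof. by rewrite monicE lead_coefE chart_size (coef_chart _ _ hF) F1 eqxx. Qed.

(** By Euler's identity at a zero of F, the partial derivative in the coordinate set to 1 vanishes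
    as soon as the other two do. *)
Lemma chart1_smooth : affine_smooth (chart 'X 1 F).
Proof.
move=> x y; rewrite chart_deriv chart_deriv_in !hornerE !chartE !hornerE /= derivC derivX.
rewrite !hornerE => F0; set v := h3 x 1 y in F0 *.
have nv : nonzero v by exists o1; rewrite oner_neq0.
have := euler_eval v hF; rewrite F0 mulr0 /= mul1r => Eu.
have [i] := sF nv F0; case: (ord3P i) => -> Fi; [by right| |by left].
have [F2|] := eqVneq (F^`M(o2)).@[v] 0; [right|by left].
apply: contraNneq Fi => F00; move: Eu; rewrite F00 F2 !mulr0 add0r addr0 => ->.
by [].
Qed.

Lemma chart2_smooth : affine_smooth (chart 1 'X F).
Proof.
move=> x y; rewrite chart_deriv chart_deriv_in !hornerE !chartE !hornerE /= derivC derivX.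
rewrite !hornerE => F0; set v := h3 1 x y in F0 *.
have nv : nonzero v by exists o0; rewrite oner_neq0.
have := euler_eval v hF; rewrite F0 mulr0 /= mul1r => Eu.
have [i] := sF nv F0; case: (ord3P i) => -> Fi; [ |by right|by left].
have [F2|] := eqVneq (F^`M(o2)).@[v] 0; [right|by left].
apply: contraNneq Fi => F00; move: Eu; rewrite F00 F2 !mulr0 !addr0 => ->.
by [].
Qed.

Lemma chart_swap (G : MP) e (w y : K) : G \is e.-homog -> w != 0 ->
  G.@[h3 1 w y] = w ^+ e * G.@[h3 w^-1 1 (y / w)].
Proof.
move=> hG w0; rewrite -(meval_homog3 _ _ _ _ hG); apply: meval_eq.
by apply: forall3; rewrite /h3 /= ?mulr1 ?mulfV // mulrC mulfVK.
Qed.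

Lemma chart_swap' (G : MP) e (w y : K) : G \is e.-homog -> w != 0 ->
  G.@[h3 w 1 y] = w ^+ e * G.@[h3 1 w^-1 (y / w)].
Proof.
move=> hG w0; rewrite -(meval_homog3 _ _ _ _ hG); apply: meval_eq.
by apply: forall3; rewrite /h3 /= ?mulr1 ?mulfV // mulrC mulfVK.
Qed.

Lemma chart1_irreducible g : (exists q, g = q * chart 'X 1 F) \/ coprimep (chart 'X 1 F) g.
Proof.
apply: (affine_irreducible (f2 := chart 1 'X F) (d := d)) => //; rewrite ?chart_size ?chart_monic //.
- exact: chart1_smooth.
- exact: chart2_smooth.
by move=> w y w0; rewrite !chartE !hornerE (chart_swap _ hF).
Qed.

Lemma chart2_irreducible g : (exists q, g = q * chart 1 'X F) \/ coprimep (chart 1 'X F) g.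
Proof.
apply: (affine_irreducible (f2 := chart 'X 1 F) (d := d)) => //; rewrite ?chart_size ?chart_monic //.
- exact: chart2_smooth.
- exact: chart1_smooth.
by move=> w y w0; rewrite !chartE !hornerE (chart_swap' _ hF).
Qed.

Lemma chart1_separable : separable_poly (chart 'X 1 F).
Proof. exact: affine_separable charK (chart_monic _ _) chart1_smooth. Qed.

Lemma chart2_separable : separable_poly (chart 1 'X F).
Proof. exact: affine_separable charK (chart_monic _ _) chart2_smooth. Qed.

Lemma meval_h3 (G : MP) v : G.@[v] = G.@[h3 (v o0) (v o1) (v o2)].
Proof. by apply: meval_eq; apply: h3E. Qed.

(** The affine zero theorem fills in the exceptional fibers of the first chart, then the fiber w = 0
    of the second; the remaining point (0:0:1) is not on the curve. *)
Lemma van_chart1 (E : {poly K}) (G : MP) e : G \is e.-homog -> E != 0 ->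
  (forall x y, E.[x] != 0 -> F.@[h3 x 1 y] = 0 -> G.@[h3 x 1 y] = 0) -> van F G.
Proof.
move=> hG E0 h.
have [||q Dq] := @nullstellensatz_affine K (chart 'X 1 F) (chart 'X 1 G) E _ chart1_separable E0.
- exact: chart_monic.
- by move=> x y; rewrite !chartE !hornerE; apply: h.
have h1 x y : F.@[h3 x 1 y] = 0 -> G.@[h3 x 1 y] = 0.
  move=> Fxy; have := congr1 (fun p : PP => p.[y%:P].[x]) Dq.
  by rewrite !hornerE !chartE !hornerE Fxy mulr0.
have [|||q' Dq'] := @nullstellensatz_affine K (chart 1 'X F) (chart 1 'X G) 'X _ chart2_separable.
- exact: chart_monic.
- by rewrite polyX_eq0.
- move=> w y; rewrite !chartE !hornerE => w0; rewrite (chart_swap _ hF) // (chart_swap _ hG) //.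
  move/eqP; rewrite mulf_eq0 expf_eq0 (negPf w0) andbF /= => /eqP/h1->.
  by rewrite mulr0.
have h2 x y : F.@[h3 1 x y] = 0 -> G.@[h3 1 x y] = 0.
  move=> Fxy; have := congr1 (fun p : PP => p.[y%:P].[x]) Dq'.
  by rewrite !hornerE !chartE !hornerE Fxy mulr0.
move=> v nv; rewrite (meval_h3 F) (meval_h3 G).
have [v1|v1] := eqVneq (v o1) 0; last first.
  have D (H : MP) k : H \is k.-homog -> H.@[h3 (v o0) (v o1) (v o2)] =
      v o1 ^+ k * H.@[h3 (v o0 / v o1) 1 (v o2 / v o1)].
    move=> hH; rewrite -(meval_homog3 _ _ _ _ hH); apply: meval_eq.
    by apply: forall3; rewrite /h3 /= ?mulr1 // mulrC mulfVK.
  rewrite (D _ _ hF) (D _ _ hG) => /eqP; rewrite mulf_eq0 expf_eq0 (negPf v1) andbF /=.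
  by move/eqP/h1->; rewrite mulr0.
have [v0|v0] := eqVneq (v o0) 0; last first.
  have D (H : MP) k : H \is k.-homog -> H.@[h3 (v o0) (v o1) (v o2)] =
      v o0 ^+ k * H.@[h3 1 (v o1 / v o0) (v o2 / v o0)].
    move=> hH; rewrite -(meval_homog3 _ _ _ _ hH); apply: meval_eq.
    by apply: forall3; rewrite /h3 /= ?mulr1 // mulrC mulfVK.
  rewrite (D _ _ hF) (D _ _ hG) => /eqP; rewrite mulf_eq0 expf_eq0 (negPf v0) andbF /=.
  by move/eqP/h2->; rewrite mulr0.
have v2 : v o2 != 0.
  by case: nv => i; case: (ord3P i) => ->; rewrite ?v0 ?v1 ?eqxx.
have -> : F.@[h3 (v o0) (v o1) (v o2)] = v o2 ^+ d.
  rewrite -[RHS]mulr1 -F1 -(meval_homog3 _ _ _ _ hF); apply: meval_eq.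
  by rewrite v0 v1 !mulr0 mulr1.
by move/eqP; rewrite expf_eq0 (negPf v2) andbF.
Qed.

Lemma van_dvd (G : MP) : van F G -> exists q, chart 'X 1 G = q * chart 'X 1 F.
Proof.
move=> vG; apply: (@nullstellensatz_affine K _ _ 1 _ chart1_separable).
- exact: chart_monic.
- exact: oner_neq0.
move=> x y _; rewrite !chartE; apply: vG.
by exists o1; rewrite /= hornerC oner_neq0.
Qed.

Lemma van_dvd2 (G : MP) : van F G -> exists q, chart 1 'X G = q * chart 1 'X F.
Proof.
move=> vG; apply: (@nullstellensatz_affine K _ _ 1 _ chart2_separable).
- exact: chart_monic.
- exact: oner_neq0.
move=> x y _; rewrite !chartE; apply: vG.
by exists o0; rewrite /= hornerC oner_neq0.
Qed.

Lemma dvd_van (G : MP) e q : G \is e.-homog -> chart 'X 1 G = q * chart 'X 1 F -> van F G.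
Proof.
move=> hG Dq; apply: (@van_chart1 1 G e hG); first exact: oner_neq0.
move=> x y _ Fxy; have := congr1 (fun p : PP => p.[y%:P].[x]) Dq.
by rewrite !hornerE !chartE !hornerE Fxy mulr0.
Qed.

Lemma dvd_van2 (G : MP) e q : G \is e.-homog -> chart 1 'X G = q * chart 1 'X F -> van F G.
Proof.
move=> hG Dq; apply: (@van_chart1 'X G e hG); first by rewrite polyX_eq0.
move=> x y; rewrite hornerX => x0; rewrite (chart_swap' _ hF) // (chart_swap' _ hG) //.
move/eqP; rewrite mulf_eq0 expf_eq0 (negPf x0) andbF /= => /eqP Fxy.
have := congr1 (fun p : PP => p.[(y / x)%:P].[x^-1]) Dq.
by rewrite !hornerE !chartE !hornerE Fxy mulr0 => ->; rewrite mulr0.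
Qed.

(** If F does not divide G in the first chart, then G is invertible modulo F over K(x) by
    irreducibility, and can be cancelled. *)
Lemma van_mul (G H : MP) e e' : G \is e.-homog -> H \is e'.-homog ->
  van F (G * H) -> van F G \/ van F H.
Proof.
move=> hG hH /van_dvd[q]; rewrite rmorphM /= => Dq.
have [[r Dr]|cG] := chart1_irreducible (chart 'X 1 G); first by left; apply: dvd_van hG Dr.
right; have [N [a [b [N0 DN]]]] := bezout_clear cG.
have [|r Dr] := @cancel_const K (chart 'X 1 F) (chart 'X 1 H) (a * q + b * chart 'X 1 H) N
   (chart_monic _ _) N0.
  by rewrite DN mulrDl -mulrA Dq; ring.
exact: dvd_van hH Dr.
Qed.

(** Subtracting from G the multiple of F with the same coefficient of Z^d leaves a form of degree
    less than d in y on each chart; being divisible by the monic F there, it is zero. *)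
Lemma van_same_degree (G : MP) : G \is d.-homog -> van F G ->
  forall v, G.@[v] = G.@[h3 0 0 1] * F.@[v].
Proof.
move=> hG vG; set c := G.@[h3 0 0 1].
have hC : G - c *: F \is d.-homog by rewrite rpredB // dhomogZ.
have vC : van F (G - c *: F).
  by move=> v nv Fv; rewrite mevalB mevalZ Fv vG // mulr0 subrr.
have chart0 p q (r : PP) : chart p q (G - c *: F) = r * chart p q F -> chart p q (G - c *: F) = 0.
  move=> Dr; apply: (@monic_small _ (chart p q F) r) => //; first exact: chart_monic.
  rewrite chart_size ltnS; apply/leq_sizeP => j; rewrite leq_eqVlt => /orP[/eqP <-|dj].
    by rewrite (coef_chart _ _ hC) mevalB mevalZ F1 mulr1 subrr.
  by have /leq_sizeP/(_ j dj) := size_chart p q hC.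
have [r1 /chart0 c1] := van_dvd vC; have [r2 /chart0 c2] := van_dvd2 vC.
move=> v; apply/eqP; rewrite -subr_eq0 -mevalZ -mevalB meval_h3; apply/eqP.
have [v1|v1] := eqVneq (v o1) 0; last first.
  have <- : v o1 ^+ d * (G - c *: F).@[h3 (v o0 / v o1) 1 (v o2 / v o1)] =
      (G - c *: F).@[h3 (v o0) (v o1) (v o2)].
    rewrite -(meval_homog3 _ _ _ _ hC); apply: meval_eq.
    by apply: forall3; rewrite /h3 /= ?mulr1 // mulrC mulfVK.
  have := congr1 (fun p : PP => p.[(v o2 / v o1)%:P].[v o0 / v o1]) c1.
  by rewrite chartE !hornerE => ->; rewrite mulr0.
have [v0|v0] := eqVneq (v o0) 0; last first.
  have <- : v o0 ^+ d * (G - c *: F).@[h3 1 (v o1 / v o0) (v o2 / v o0)] =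
      (G - c *: F).@[h3 (v o0) (v o1) (v o2)].
    rewrite -(meval_homog3 _ _ _ _ hC); apply: meval_eq.
    by apply: forall3; rewrite /h3 /= ?mulr1 // mulrC mulfVK.
  have := congr1 (fun p : PP => p.[(v o2 / v o0)%:P].[v o1 / v o0]) c2.
  by rewrite chartE !hornerE => ->; rewrite mulr0.
have -> : (G - c *: F).@[h3 (v o0) (v o1) (v o2)] = v o2 ^+ d * (G - c *: F).@[h3 0 0 1].
  rewrite -(meval_homog3 _ _ _ _ hC); apply: meval_eq.
  by rewrite v0 v1 !mulr0 mulr1.
by rewrite mevalB mevalZ F1 mulr1 subrr mulr0.
Qed.

End SmoothForm.

(** * Elements of G[P] are homologies *)

Section Linearize.
Variable K : closedFieldType.
Notation PP := {poly {poly K}}.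
Notation MP := {mpoly K[3]}.

Variables (d : nat) (F : MP).
Hypotheses (charK : [pchar K] =i pred0) (d1 : (1 < d)%N).
Hypotheses (hF : F \is d.-homog) (F1 : F.@[h3 0 0 1] = 1) (sF : smooth_form F).

Lemma chart_quotient p q (U V : PP) : let f := chart p q F in
  affine_smooth f -> coprimep f U ->
  (forall x y, F.@[h3 p.[x] q.[x] y] = 0 ->
    F.@[h3 (p.[x] * U.[y%:P].[x]) (q.[x] * U.[y%:P].[x]) V.[y%:P].[x]] = 0) ->
  exists (a Q : PP), (size a <= d)%N /\ V = a * U + Q * f.
Proof.
move=> f fs cU h; have fm : f \is monic by apply: (chart_monic hF).
have fsep := affine_separable charK fm fs.
have [||Q DQ] := @nullstellensatz_affine K f
    (V ^+ d + \sum_(j < d) (f`_j)%:P * U ^+ (d - j) * V ^+ j) 1 fm fsep.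
- exact: oner_neq0.
- move=> x y _; rewrite chartE => /h; rewrite (chart_homog_expand _ _ _ _ _ hF F1) => E0.
  rewrite -[RHS]E0 hornerD hornerD !horner_exp horner_sum horner_sum; congr (_ + _).
  by apply: eq_bigr => j _; rewrite !hornerM !horner_exp hornerC.
have [a [r Dr]] := @integral_fraction K f U V Q d (fun j => (f`_j)%:P) fm fs cU (ltnW d1) DQ.
have [q1 [s [Ds ss]]] := monic_rem a fm.
exists s, (q1 * U + r); split; last by rewrite Dr Ds; ring.
by move: ss; rewrite (chart_size hF F1) ltnS.
Qed.

(** The map t keeps the ratio X : Y. So t2 / t1 is a polynomial a1 on the chart Y = 1 and t2 / t0 a
    polynomial a2 on the chart X = 1, related by a1(x, y) = x a2(1/x, y/x); this symmetry at
    infinity bounds the total degree of a1 by 1. *)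
Lemma linearize (t0 t1 t2 : MP) e :
  t0 \is e.-homog -> t1 \is e.-homog -> t2 \is e.-homog ->
  van F (t0 * 'X_o1 - t1 * 'X_o0) -> ~ (van F t0 /\ van F t1) ->
  (forall v, nonzero v -> F.@[v] = 0 -> F.@[h3 t0.@[v] t1.@[v] t2.@[v]] = 0) ->
  exists a b c, forall v, nonzero v -> F.@[v] = 0 ->
    t2.@[v] * v o0 = (a * v o0 + b * v o1 + c * v o2) * t0.@[v] /\
    t2.@[v] * v o1 = (a * v o0 + b * v o1 + c * v o2) * t1.@[v].
Proof.
move=> h0 h1 h2 v01 nv01 Ft.
have t01 x y : F.@[h3 x 1 y] = 0 -> t0.@[h3 x 1 y] = x * t1.@[h3 x 1 y].
  move=> Fxy; have /v01/(_ Fxy) : nonzero (h3 x 1 y) by exists o1; rewrite oner_neq0.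
  rewrite mevalB !mevalM !mevalXU /h3 /= mulr1 => /eqP.
  by rewrite subr_eq0 mulrC => /eqP.
have t10 x y : F.@[h3 1 x y] = 0 -> t1.@[h3 1 x y] = x * t0.@[h3 1 x y].
  move=> Fxy; have /v01/(_ Fxy) : nonzero (h3 1 x y) by exists o0; rewrite oner_neq0.
  rewrite mevalB !mevalM !mevalXU /h3 /= mulr1 => /eqP.
  by rewrite subr_eq0 mulrC => /eqP.
pose U1 := chart 'X 1 t1; pose U2 := chart 1 'X t0.
have nv1 : ~ van F t1.
  move=> vt1; apply: nv01; split=> //.
  apply: (van_chart1 (e := e) (E := 1) charK hF F1 sF) => //; first exact: oner_neq0.
  move=> x y _ Fxy; rewrite t01 // vt1 ?mulr0 //.
  by exists o1; rewrite oner_neq0.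
have nv0 : ~ van F t0.
  move=> vt0; apply: nv01; split=> //.
  have [q Dq] := van_dvd2 charK hF F1 sF vt0.
  have [||q' Dq'] := @nullstellensatz_affine K (chart 1 'X F) (chart 1 'X t1) 1
      (chart_monic hF F1 _ _) (chart2_separable charK hF F1 sF).
  - exact: oner_neq0.
  - move=> x y _; rewrite !chartE !hornerE => Fxy; rewrite t10 // vt0 ?mulr0 //.
    by exists o0; rewrite oner_neq0.
  exact: (dvd_van2 charK hF F1 sF h1 Dq').
have c1 : coprimep (chart 'X 1 F) U1.
  have [[q Dq]|//] := chart1_irreducible charK hF F1 sF U1.
  by case: nv1; apply: (dvd_van charK hF F1 sF h1 Dq).
have c2 : coprimep (chart 1 'X F) U2.
  have [[q Dq]|//] := chart2_irreducible charK hF F1 sF U2.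
  by case: nv0; apply: (dvd_van2 charK hF F1 sF h0 Dq).
have [|a1 [Q1 [sa1 Da1]]] := @chart_quotient 'X 1 U1 (chart 'X 1 t2) (chart1_smooth hF sF) c1.
  move=> x y; rewrite /U1 !chartE !hornerE => Fxy.
  by rewrite -t01 // Ft //; exists o1; rewrite oner_neq0.
have [|a2 [Q2 [sa2 Da2]]] := @chart_quotient 1 'X U2 (chart 1 'X t2) (chart2_smooth hF sF) c2.
  move=> x y; rewrite /U2 !chartE !hornerE => Fxy.
  by rewrite -t10 // Ft //; exists o0; rewrite oner_neq0.
have [N [al [be [N0 DN]]]] := bezout_clear c1.
pose n := (\max_(j < d) (size (a2`_j)%R + j))%N.
have Hn j : (j < d)%N -> (size (a2`_j)%R + j <= n)%N.
  by move=> jd; exact: (leq_bigmax (Ordinal jd)).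
have aux s k m : (s + k <= m -> s <= (m - k).+1)%N by lia.
have aux2 s k m : (s + k <= m -> k <= m)%N by lia.
(* [b] is x^(n+1) a2(1/x, y/x). It agrees with x^n a1 on the curve, and both have degree less than
   [d] in y, so they are equal as polynomials. *)
pose b : PP := \poly_(j < d) ('X * revp (n - j) a2`_j).
have Hb w y : w != 0 -> b.[y%:P].[w] = w ^+ n * (w * a2.[(y / w)%:P].[w^-1]).
  move=> w0; rewrite horner_poly (horner_coef_wide _ sa2) !horner_sum !mulr_sumr.
  apply: eq_bigr => j _; have := Hn j (ltn_ord j) => hj.
  rewrite -!rmorphXn /= !hornerM !hornerC hornerX horner_revp //; last by apply: aux hj.
  rewrite expr_div_n -{2}(@subnK j n); last by apply: aux2 hj.
  by rewrite exprD; field; rewrite expf_neq0.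
have fm1 := chart_monic hF F1 'X 1.
have [||Q DQ] := @nullstellensatz_affine K (chart 'X 1 F) ('X^n%:P * a1 - b) ('X * N)
    fm1 (chart1_separable charK hF F1 sF).
- by rewrite mulf_neq0 ?polyX_eq0.
- move=> x y; rewrite hornerM hornerX mulf_eq0 negb_or => /andP[x0 Nx].
  rewrite chartE !hornerE => Fxy; rewrite Hb // ?hornerXn -mulrBr; apply/eqP; rewrite mulf_eq0.
  apply/orP; right; have := congr1 (fun p : PP => p.[y%:P].[x]) DN.
  rewrite !hornerE !chartE !hornerE Fxy mulr0 addr0 => DNx.
  have t1x : t1.@[h3 x 1 y] != 0 by apply: contraNneq Nx => t1x; rewrite DNx t1x mulr0.
  have := congr1 (fun p : PP => p.[y%:P].[x]) Da1.
  rewrite !hornerE !chartE !hornerE Fxy mulr0 addr0 => Dt2.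
  have Fxy' : F.@[h3 1 x^-1 (y / x)] = 0.
    by move/eqP: Fxy; rewrite (chart_swap' _ hF) // mulf_eq0 expf_eq0 (negPf x0) andbF => /eqP.
  have := congr1 (fun p : PP => p.[(y / x)%:P].[x^-1]) Da2.
  rewrite !hornerE !chartE !hornerE Fxy' mulr0 addr0 => Dt2'.
  move: Dt2; rewrite (chart_swap' _ h2) // Dt2' -[a2.[_].[_] * _]mulrC mulrA.
  rewrite -(chart_swap' _ h0) // t01 // => Dt2.
  by rewrite -(inj_eq (mulIf t1x)) mulrBl -Dt2 mul0r subr_eq0; apply/eqP; ring.
have Dab : 'X^n%:P * a1 = b.
  apply/eqP; rewrite -subr_eq0; apply/eqP.
  apply: (@monic_small _ (chart 'X 1 F) Q) => //; rewrite (chart_size hF F1) ltnS.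
  apply: leq_trans (size_polyD _ _) _; rewrite geq_max size_polyN size_poly andbT.
  by rewrite mul_polyC (leq_trans (size_scale_leq _ _)).
(* In terms of [size], the bound 2 means total degree at most 1: only the coefficients of x, 1 and y
   survive. *)
have small j : a1`_j != 0 -> (size (a1`_j)%R + j <= 2)%N.
  move=> aj; have jd : (j < d)%N.
    by rewrite ltnNge; apply: contra aj => dj; rewrite nth_default // (leq_trans sa1).
  apply: (@size_pole_bound K 1 _ a2`_j) => //; first exact: oner_neq0.
  move=> x x0 _; have := congr1 (fun p : PP => (p`_j).[x]) Dab.
  have hj := Hn j jd.
  rewrite coefCM coef_poly jd !hornerM hornerXn hornerX horner_revp //; last by apply: aux hj.
  rewrite -[in X in X = _ -> _](@subnK j n); last by apply: aux2 hj.
  rewrite exprD expr1 -mulrA => E0; apply: (@mulfI _ (x ^+ (n - j))); first by rewrite expf_neq0.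
  by rewrite [_ * x ^+ j]mulrC E0; ring.
pose al0 := (a1`_0)`_1; pose al1 := (a1`_0)`_0; pose al2 := (a1`_1)`_0.
have Ha1 x y : a1.[y%:P].[x] = al0 * x + al1 + al2 * y.
  have sa : (size a1 <= 2)%N.
    apply/leq_sizeP => j j2; apply/eqP; apply: contraT => aj.
    by have := small j aj; move: aj; rewrite -size_poly_gt0; move: j2; case: (size _) => // m; lia.
  have s0 : (size (a1`_0)%R <= 2)%N.
    by have [->|/small] := eqVneq a1`_0 0; rewrite ?size_poly0 // addn0.
  have s1 : (size (a1`_1)%R <= 1)%N.
    by have [->|/small] := eqVneq a1`_1 0; rewrite ?size_poly0 // addn1.
  rewrite (horner_coef_wide _ sa) !big_ord_recl big_ord0 /= expr0 mulr1 expr1 addr0.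
  rewrite hornerD hornerM hornerC (horner_coef_wide _ s0) !big_ord_recl big_ord0 /=.
  rewrite (horner_coef_wide _ s1) big_ord_recl big_ord0 /= /al0 /al1 /al2.
  by rewrite /bump /= !expr0 expr1; ring.
exists al0, al1, al2.
pose A : MP := al0 *: 'X_o0 + al1 *: 'X_o1 + al2 *: 'X_o2.
have hX i : ('X_i : MP) \is 1.-homog by rewrite dhomogX /= mdeg1.
have hA : A \is 1.-homog by rewrite !rpredD // dhomogZ.
have eA v : A.@[v] = al0 * v o0 + al1 * v o1 + al2 * v o2.
  by rewrite !mevalD !mevalZ !mevalXU.
have key x y : F.@[h3 x 1 y] = 0 -> t2.@[h3 x 1 y] = A.@[h3 x 1 y] * t1.@[h3 x 1 y].
  move=> Fxy; have := congr1 (fun p : PP => p.[y%:P].[x]) Da1.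
  by rewrite !hornerE !chartE !hornerE Fxy mulr0 addr0 Ha1 eA /h3 /= mulr1.
have hM (G H : MP) k l : G \is k.-homog -> H \is l.-homog -> (k + l = e.+1)%N ->
    G * H \is e.+1.-homog.
  by move=> hG hH <-; apply: dhomogM.
have hM0 i : t2 * 'X_i \is e.+1.-homog by apply: hM h2 (hX i) _; rewrite addn1.
have hM1 t : t \is e.-homog -> A * t \is e.+1.-homog.
  by move=> ht; apply: hM hA ht _; rewrite add1n.
have g0 : van F (t2 * 'X_o0 - A * t0).
  apply: (van_chart1 (e := e.+1) (E := 1) charK hF F1 sF); last first.
  - move=> x y _ Fxy; rewrite mevalB !mevalM mevalXU key // t01 // (_ : h3 x 1 y o0 = x) //; ring.
  - exact: oner_neq0.
  by apply: rpredB; [apply: hM0|apply: hM1].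
have g1 : van F (t2 * 'X_o1 - A * t1).
  apply: (van_chart1 (e := e.+1) (E := 1) charK hF F1 sF); last first.
  - move=> x y _ Fxy; rewrite mevalB !mevalM mevalXU key // (_ : h3 x 1 y o1 = 1) //; ring.
  - exact: oner_neq0.
  by apply: rpredB; [apply: hM0|apply: hM1].
move=> v nv Fv; rewrite -eA; split; apply/eqP; rewrite -subr_eq0.
  by have := g0 v nv Fv; rewrite mevalB !mevalM mevalXU => ->.
by have := g1 v nv Fv; rewrite mevalB !mevalM mevalXU => ->.
Qed.

End Linearize.

(** * Linear substitutions, and the preceding results at an arbitrary center p off the curve *)

Section Subst.
Variable K : closedFieldType.
Notation MP := {mpoly K[3]}.
Notation rV3 := 'rV[K]_3.
Implicit Types (F G : MP) (v w p : rV3) (M : 'M[K]_3).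

Local Notation ev G v := (meval (fun_of_matrix v 0) G).

Lemma nonzeroP v : nonzero (v 0) <-> v != 0.
Proof.
split=> [[i vi]|]; first by apply: contraNneq vi => ->; rewrite mxE.
by case/rV0Pn => i; exists i.
Qed.

Lemma ev_fun G (f : 'I_3 -> K) : G.@[f] = ev G (\row_i f i).
Proof. by apply: meval_eq => i; rewrite mxE. Qed.

Lemma smooth_formP F : smooth_form F <->
  (forall v, v != 0 -> ev F v = 0 -> exists i, ev F^`M(i) v != 0).
Proof.
split=> [h v /nonzeroP nv|h f nf]; first exact: h.
rewrite ev_fun => Ff; have [|i Fi] := h (\row_i f i) _ Ff.
  by apply/nonzeroP; case: nf => i fi; exists i; rewrite mxE.
by exists i; rewrite ev_fun.
Qed.

Lemma vanP F G : van F G <-> (forall v, v != 0 -> ev F v = 0 -> ev G v = 0).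
Proof.
split=> [h v /nonzeroP nv|h f nf]; first exact: h.
rewrite (ev_fun F f) (ev_fun G f); apply: h; apply/nonzeroP; case: nf => i fi; exists i; by rewrite mxE.
Qed.

Definition linform (c : 'cV[K]_3) : MP := \sum_i c i 0 *: 'X_i.

Lemma ev_linform c v : ev (linform c) v = (v *m c) 0 0.
Proof.
rewrite /linform raddf_sum mxE; apply: eq_bigr => i _ /=.
by rewrite mevalZ mevalXU mulrC.
Qed.

Lemma linform_homog c : linform c \is 1.-homog.
Proof. by apply: rpred_sum => i _; rewrite dhomogZ // dhomogX /= mdeg1. Qed.

Lemma linformP (l : MP) : l \is 1.-homog -> exists c : 'cV[K]_3, forall v : rV3, ev l v = (v *m c) 0 0.
Proof.
move=> hl; exists (\col_i l^`M(i).@[fun=> 0]) => v.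
have cst i : (l^`M(i)).@[v 0] = (l^`M(i)).@[fun=> 0].
  have := meval_homog (v 0) 0 (dhomog_mderiv i hl); rewrite expr0 mul1r => <-.
  by apply: meval_eq => j; rewrite mul0r.
have := congr1 (meval (v 0)) (euler hl); rewrite mulr1n => <-.
rewrite raddf_sum mxE; apply: eq_bigr => i _ /=.
by rewrite mevalM mevalXU cst mxE.
Qed.

Definition subm M G : MP := G \mPo [tuple linform (col i M) | i < 3].

Lemma ev_subm M G v : ev (subm M G) v = ev G (v *m M).
Proof.
rewrite /subm comp_mpoly_meval; apply: meval_eq => i.
rewrite tnth_mktuple ev_linform !mxE; apply: eq_bigr => j _.
by rewrite !mxE.
Qed.

Lemma comp_homog n (t : n.-tuple MP) (G : {mpoly K[n]}) d e : G \is d.-homog ->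
  (forall i, tnth t i \is e.-homog) -> G \mPo t \is (d * e).-homog.
Proof.
move=> /dhomogP hG ht; rewrite comp_mpolyE big_seq rpred_sum //= => m mG.
apply: rpredZ; rewrite -(hG m mG) /= mdegE.
elim: (index_enum _) => [|i r IHr]; first by rewrite !big_nil dhomog1.
rewrite !big_cons mulnDl dhomogM //.
by rewrite mulnC; elim: (m i) => [|k IHk]; rewrite ?expr0 ?muln0 ?dhomog1 // exprS mulnS dhomogM.
Qed.

Lemma subm_homog M G d : G \is d.-homog -> subm M G \is d.-homog.
Proof.
move=> hG; rewrite -[d]muln1; apply: comp_homog hG _ => i.
by rewrite tnth_mktuple linform_homog.
Qed.

Lemma mderiv_linform c i : (linform c)^`M(i) = (c i 0)%:MP.
Proof.
rewrite /linform raddf_sum (bigD1 i) //= big1 ?addr0 => [|j ji].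
  rewrite mderivZ mderivX mnm1E eqxx scale1r (_ : (U_(i) - U_(i))%MM = 0%MM).
    by rewrite mpolyX0 -mul_mpolyC mulr1.
  by apply/mnmP => j; rewrite mnmBE subnn mnm0E.
by rewrite mderivZ mderivX mnm1E (negPf ji) scale0r scaler0.
Qed.

Lemma mderiv_subm M G i : (subm M G)^`M(i) = \sum_j M i j *: subm M G^`M(j).
Proof.
rewrite /subm /comp_mpoly (@mmap_derivation _ _ _ _ _ (mderiv i)).
- apply: eq_bigr => j _; rewrite tnth_mktuple /= mderiv_linform mxE.
  by rewrite mulrC mul_mpolyC.
- by move=> a b; rewrite /= mderivM.
- by move=> c; rewrite /= mderivC.
Qed.

Lemma ev_mderiv_subm M G v i :
  ev (subm M G)^`M(i) v = \sum_j M i j * ev G^`M(j) (v *m M).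
Proof.
rewrite mderiv_subm raddf_sum; apply: eq_bigr => j _ /=.
by rewrite mevalZ ev_subm.
Qed.

Lemma mulmx_unit_neq0 M v : M \in unitmx -> v != 0 -> v *m M != 0.
Proof.
by move=> uM; apply: contraNneq => /(congr1 (mulmx^~ (invmx M))) /=; rewrite mulmxK // mul0mx => ->.
Qed.

Lemma smooth_subm M F : M \in unitmx -> smooth_form F -> smooth_form (subm M F).
Proof.
move=> uM /smooth_formP sF; apply/smooth_formP => v v0; rewrite ev_subm => Fv.
have [j Fj] := sF _ (mulmx_unit_neq0 uM v0) Fv.
suff /rV0Pn[i] : (\row_j ev F^`M(j) (v *m M)) *m M^T != 0.
  rewrite mxE => h; exists i; rewrite ev_mderiv_subm.
  apply: contraNneq h => h0; rewrite -[X in _ == X]h0; apply/eqP; apply: eq_bigr => k _.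
  by rewrite !mxE mulrC.
apply: mulmx_unit_neq0; first by rewrite unitmx_tr.
by apply/rV0Pn; exists j; rewrite mxE.
Qed.

Lemma smooth_scale (c : K) F : c != 0 -> smooth_form F -> smooth_form (c *: F).
Proof.
move=> c0 sF v nv; rewrite mevalZ => /eqP; rewrite mulf_eq0 (negPf c0) => /eqP/(sF v nv)[i Fi].
by exists i; rewrite mderivZ mevalZ mulf_neq0.
Qed.

Lemma row_basis p : p != 0 -> exists2 M, M \in unitmx & row o2 M = p.
Proof.
move=> p0; have rp : \rank p = 1%N.
  by apply/eqP; rewrite eqn_leq rank_leq_row lt0n mxrank_eq0.
pose c := col_ebase p 0 0; pose E := row_ebase p.
have Dp : p = c *: row o0 E.
  rewrite -{1}[p]mulmx_ebase rp [col_ebase p]mx11_scalar mul_scalar_mx -/c -/E -scalemxAl.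
  congr (_ *: _); apply/rowP => j; rewrite !mxE big3 /= !mxE /= mul1r !mul0r !addr0.
  by [].
have c0 : c != 0 by apply: contraNneq p0 => c0; rewrite Dp c0 scale0r.
exists (c *: xrow o0 o2 E); last first.
  by rewrite linearZ /= [RHS]Dp; congr (_ *: _); apply/rowP => j; rewrite !mxE tpermR.
by rewrite unitmxZ ?unitfE // xrowE unitmx_mul unitmx_perm row_ebase_unit.
Qed.

Definition par v w := forall i j, v 0 i * w 0 j = v 0 j * w 0 i.

Lemma par_mul v w M : par v w -> par (v *m M) (w *m M).
Proof.
move=> h i j; rewrite !mxE !mulr_suml.
under eq_bigr do rewrite mulr_sumr; under [RHS]eq_bigr do rewrite mulr_sumr.
rewrite exchange_big /=; apply: eq_bigr => k _; apply: eq_bigr => l _.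
have := h k l => hkl.
transitivity (v 0 l * w 0 k * (M l i * M k j)); first by ring.
by rewrite -hkl; ring.
Qed.

Definition homol (la : 'cV[K]_3) p : 'M[K]_3 := 1%:M + la *m p.

Lemma mul_homol v la p : v *m homol la p = v + (v *m la) 0 0 *: p.
Proof. by rewrite mulmxDr mulmx1 mulmxA [v *m la]mx11_scalar mul_scalar_mx !mxE. Qed.

Lemma mul_col_h3 v a b c :
  (v *m (\col_i h3 a b c i)) 0 0 = v 0 o0 * a + v 0 o1 * b + v 0 o2 * c.
Proof. by rewrite mxE big3 !mxE. Qed.

Lemma par_h3 (t0 t1 t2 w0 w1 a : K) : t0 * w1 = t1 * w0 ->
  t2 * w0 = a * t0 -> t2 * w1 = a * t1 ->
  par (\row_i h3 t0 t1 t2 i) (\row_i h3 w0 w1 a i).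
Proof.
move=> e2 e0 e1; apply: forall3; apply: forall3; rewrite !mxE /h3 //=.
- by rewrite e0 mulrC.
- by rewrite e1 mulrC.
- by rewrite e0 mulrC.
- by rewrite e1 mulrC.
Qed.

Section Based.
Variables (d : nat) (F : MP) (p : rV3).
Hypotheses (charK : [pchar K] =i pred0) (d1 : (1 < d)%N).
Hypotheses (hF : F \is d.-homog) (sF : smooth_form F) (Fp : ev F p != 0).

Lemma base_neq0 : p != 0.
Proof.
apply: contraNneq Fp => ->; have := meval_homog (fun=> 0) 0 hF.
have d0 : (d == 0%N) = false by case: (d) d1.
rewrite expr0n d0 [_%:R * _]mul0r.
by move=> <-; apply/eqP; apply: meval_eq => i; rewrite mxE mul0r.
Qed.

Lemma row_o2 M : row o2 M = (\row_j h3 0 0 1 j) *m M.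
Proof.
rewrite rowE; congr (_ *m _); apply/rowP; apply: forall3; rewrite !mxE /h3 //=.
Qed.

Lemma normalized M : M \in unitmx -> row o2 M = p ->
  let F' := (ev F p)^-1 *: subm M F in
  [/\ F' \is d.-homog, F'.@[h3 0 0 1] = 1, smooth_form F' &
      forall v, ev F' v = (ev F p)^-1 * ev F (v *m M)].
Proof.
move=> uM rM F'; split; first by rewrite dhomogZ // subm_homog.
- by rewrite mevalZ (ev_fun (subm M F)) ev_subm -row_o2 rM mulVf.
- by apply: smooth_scale (smooth_subm uM sF); rewrite invr_eq0.
by move=> v; rewrite mevalZ ev_subm.
Qed.

Lemma van_subm M c G : M \in unitmx -> c != 0 -> van (c *: subm M F) (subm M G) <-> van F G.
Proof.
move=> uM c0; split=> /vanP h; apply/vanP => v v0.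
  move=> Fv; have := h (v *m invmx M) (mulmx_unit_neq0 _ v0).
  rewrite mevalZ !ev_subm mulmxKV // Fv mulr0; apply => //.
  by rewrite unitmx_inv.
rewrite mevalZ !ev_subm => /eqP; rewrite mulf_eq0 (negPf c0) => /eqP; apply: h.
exact: mulmx_unit_neq0.
Qed.

Lemma van_mul_form (G H : MP) e e' : G \is e.-homog -> H \is e'.-homog ->
  van F (G * H) -> van F G \/ van F H.
Proof.
move=> hG hH v; have [M uM rM] := row_basis base_neq0.
have [hF' F'1 sF' _] := normalized uM rM.
have c0 : (ev F p)^-1 != 0 by rewrite invr_eq0.
have := @van_mul K d _ charK hF' F'1 sF' (subm M G) (subm M H) e e'
  (subm_homog M hG) (subm_homog M hH).
by rewrite -rmorphM !van_subm //; apply.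
Qed.

Lemma van_same_degree_form (G : MP) : G \is d.-homog -> van F G ->
  forall v, ev G v = ev G p / ev F p * ev F v.
Proof.
move=> hG vG v; have [M uM rM] := row_basis base_neq0.
have [hF' F'1 sF' evF'] := normalized uM rM.
have c0 : (ev F p)^-1 != 0 by rewrite invr_eq0.
have := @van_same_degree K d _ charK hF' F'1 sF' (subm M G) (subm_homog M hG) _
  ((v *m invmx M) 0).
rewrite ev_subm evF' mulmxKV // (ev_fun (subm M G)) ev_subm -row_o2 rM mulrA; apply.
exact/van_subm.
Qed.

(** The columns of [C] are the two forms of the projection and a form with value 1 at p. In these
    coordinates p is (0:0:1) and the projection is (X:Y), the setting of [linearize]. *)
Lemma linearize_form (t : 3.-tuple MP) e (l : 'I_2 -> MP) :
  (forall i, tnth t i \is e.-homog) -> (forall i, l i \is 1.-homog) ->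
  (forall v, (forall i, ev (l i) v = 0) <-> exists c, v = c *: p) ->
  let lt i := l i \mPo t in
  van F (lt 0 * l 1 - lt 1 * l 0) -> ~ (van F (lt 0) /\ van F (lt 1)) ->
  (forall v, v != 0 -> ev F v = 0 -> ev F (\row_i (tnth t i).@[v 0]) = 0) ->
  exists la, forall v, v != 0 -> ev F v = 0 ->
    par (\row_i (tnth t i).@[v 0]) (v *m homol la p).
Proof.
move=> ht hl lp lt v01 nv Ft.
have [c0 Dc0] := linformP (hl 0); have [c1 Dc1] := linformP (hl 1).
have [k pk] : exists k, p 0 k != 0 by apply/rV0Pn/base_neq0.
pose c2 : 'cV[K]_3 := \col_i (if i == k then (p 0 k)^-1 else 0).
have pc2 : (p *m c2) 0 0 = 1.
  rewrite mxE (bigD1 k) //= big1 ?addr0 => [|j /negPf jk].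
    by rewrite mxE eqxx mulfV.
  by rewrite mxE jk mulr0.
pose C : 'M[K]_3 := \matrix_(i, j) h3 (c0 i 0) (c1 i 0) (c2 i 0) j.
have vC (v : rV3) i : (v *m C) 0 i = h3 ((v *m c0) 0 0) ((v *m c1) 0 0) ((v *m c2) 0 0) i.
  by move: i; apply: forall3; rewrite !mxE /h3 /=; apply: eq_bigr => i _; rewrite !mxE /h3 /=.
have lpp i : ev (l i) p = 0 by move: i; apply/lp; exists 1; rewrite scale1r.
have pC : p *m C = \row_j h3 0 0 1 j.
  by apply/rowP; apply: forall3; rewrite vC [RHS]mxE /h3 /= ?pc2 // -?Dc0 -?Dc1 lpp.
have uC : C \in unitmx.
  rewrite -row_free_unit -kermx_eq0; apply/eqP/row_matrixP => i; rewrite row0.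
  have : row i (kermx C) *m C = 0 by rewrite -row_mul mulmx_ker row0.
  move: (row i _) => v vC0.
  have [c Dv] : exists c, v = c *: p.
    apply/lp => j; have : val j = 0%N \/ val j = 1%N by case: j => [[|[|//]] ?]; [left|right].
    case=> jE; [have -> : j = 0 by apply: val_inj|have -> : j = 1 by apply: val_inj].
      by rewrite Dc0; have := vC v o0; rewrite vC0 mxE.
    by rewrite Dc1; have := vC v o1; rewrite vC0 mxE.
  have := vC v o2; rewrite vC0 mxE /h3 /= Dv -scalemxAl mxE pc2 mulr1 => <-.
  by rewrite scale0r.
set M := invmx C; have uM : M \in unitmx by rewrite unitmx_inv.
have rM : row o2 M = p by rewrite row_o2 -pC mulmxK.
have [hF' F'1 sF' evF'] := normalized uM rM; set F' := _ *: _ in hF' F'1 sF' evF'.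
have c0' : (ev F p)^-1 != 0 by rewrite invr_eq0.
pose t' k := subm M (\sum_j C j k *: tnth t j).
have ht' kk : t' kk \is e.-homog.
  by apply: subm_homog; apply: rpred_sum => j _; rewrite dhomogZ.
have evt (w : rV3) kk : ev (t' kk) w = ((\row_i (tnth t i).@[(w *m M) 0]) *m C) 0 kk.
  rewrite ev_subm raddf_sum mxE; apply: eq_bigr => j _ /=.
  by rewrite mevalZ !mxE mulrC.
have evl (w : rV3) : ev (t' o0) w = ev (lt 0) (w *m M) /\ ev (t' o1) w = ev (lt 1) (w *m M).
  rewrite !evt !vC /h3 /= /lt !comp_mpoly_meval -Dc0 -Dc1.
  by split; apply: meval_eq => i; rewrite mxE.
have evX (w : rV3) : w 0 o0 = ev (l 0) (w *m M) /\ w 0 o1 = ev (l 1) (w *m M).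
  by rewrite Dc0 Dc1; split; rewrite -{1}[w](mulmxKV uC) vC.
have [] := @linearize K d F' charK d1 hF' F'1 sF' (t' o0) (t' o1) (t' o2) e (ht' _) (ht' _) (ht' _).
- apply/vanP => w w0; rewrite evF' => /eqP; rewrite mulf_eq0 (negPf c0') => /eqP FwM.
  rewrite mevalB !mevalM !mevalXU; have [-> ->] := evl w; have [-> ->] := evX w.
  have /vanP/(_ _ (mulmx_unit_neq0 uM w0) FwM) := v01.
  by rewrite mevalB !mevalM.
- case=> v0 v1; apply: nv; split; apply/vanP => v vn0 Fv.
    have := (@vanP _ _).1 v0 _ (mulmx_unit_neq0 uC vn0).
    by have [-> _] := evl (v *m C); rewrite evF' /M mulmxK // Fv mulr0; apply.
  have := (@vanP _ _).1 v1 _ (mulmx_unit_neq0 uC vn0).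
  by have [_ ->] := evl (v *m C); rewrite evF' /M mulmxK // Fv mulr0; apply.
- move=> f nf; rewrite ev_fun; set w := \row_i f i => Fw.
  have w0 : w != 0.
    by apply/nonzeroP; case: nf => i fi; exists i; rewrite mxE.
  have FwM : ev F (w *m M) = 0.
    by move/eqP: Fw; rewrite evF' mulf_eq0 (negPf c0') => /eqP.
  rewrite ev_fun evF'; have := Ft _ (mulmx_unit_neq0 uM w0) FwM => Ft0.
  rewrite [X in X *m M](_ : _ = (\row_i (tnth t i).@[(w *m M) 0]) *m C).
    by rewrite /M mulmxK // Ft0 mulr0.
  by apply/rowP; apply: forall3; rewrite [LHS]mxE /h3 /= ev_fun evt.
(* A homology adds la(v) p to v, so the Z-coefficient of the new third coordinate exceeds that of la
   by 1. *)
move=> a [b [c H]]; pose la := C *m (\col_i h3 a b (c - 1) i); exists la => v v0 Fv.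
suff h : par ((\row_i (tnth t i).@[v 0]) *m C) (v *m homol la p *m C).
  by have := par_mul M h; rewrite /M !mulmxK.
set w := v *m C; have Dv : v = w *m M by rewrite /w /M mulmxK.
have w0 : w != 0 by apply: mulmx_unit_neq0.
have Fw : ev F' w = 0 by rewrite evF' -Dv Fv mulr0.
have [E0 E1] := H (w 0) ((nonzeroP w).2 w0) Fw.
have E2 : ev (t' o0) w * w 0 o1 = ev (t' o1) w * w 0 o0.
  have [-> ->] := evl w; have [-> ->] := evX w; rewrite -Dv.
  have /vanP/(_ _ v0 Fv) := v01; rewrite mevalB !mevalM => /eqP.
  by rewrite subr_eq0 => /eqP.
pose A := a * w 0 o0 + b * w 0 o1 + c * w 0 o2.
have DW : v *m homol la p *m C = \row_i h3 (w 0 o0) (w 0 o1) A i.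
  have Ela : (v *m la) 0 0 = w 0 o0 * a + w 0 o1 * b + w 0 o2 * (c - 1).
    by rewrite /la mulmxA mul_col_h3.
  rewrite mul_homol mulmxDl -scalemxAl pC Ela -/w; move: (w) @A => u A.
  apply/rowP; apply: forall3; rewrite !mxE /h3 /= ?mulr0 ?addr0 //.
  by rewrite /A; ring.
have DT : (\row_i (tnth t i).@[v 0]) *m C = \row_i h3 (ev (t' o0) w) (ev (t' o1) w) (ev (t' o2) w) i.
  by apply/rowP; apply: forall3; rewrite [RHS]mxE /h3 /= evt -Dv.
by rewrite DW DT; apply: par_h3.
Qed.

End Based.
End Subst.

(** * Points as lines of vectors, and rational maps given by matrices *)

Section Points.
Variable K : closedFieldType.
Notation MP := {mpoly K[3]}.
Notation rV3 := 'rV[K]_3.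
Implicit Types (F G : MP) (v w p : rV3) (M : 'M[K]_3).
Local Notation ev G v := (meval (fun_of_matrix v 0) G).

Definition pt p (p0 : p != 0) : point K :=
  exist (fun L : {vspace rV3} => \dim L == 1%N) <[p]>%VS
    (introT eqP (etrans (dim_vline p) (congr1 nat_of_bool p0))).

Lemma point_gen (P : point K) : exists2 p, p != 0 & val P = <[p]>%VS.
Proof.
case: P => L /= /eqP dL; exists (vpick L).
  by rewrite vpick0; apply/eqP => L0; move: dL; rewrite L0 dimv0.
apply/esym/eqP; rewrite eqEdim -memvE memv_pick dL dim_vline vpick0.
by have [L0|//] := eqVneq L 0%VS; move: dL; rewrite L0 dimv0.
Qed.

Lemma ev_scale G e (c : K) v : G \is e.-homog -> ev G (c *: v) = c ^+ e * ev G v.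
Proof.
by move=> hG; rewrite -(meval_homog _ _ hG); apply: meval_eq => i; rewrite mxE.
Qed.

Lemma vanishes_atP G e p (P : point K) : G \is e.-homog -> val P = <[p]>%VS ->
  vanishes_at G P <-> ev G p = 0.
Proof.
move=> hG DP; split=> [h|Gp v]; first by apply: h; rewrite DP memv_line.
by rewrite DP => /vlineP[c ->]; rewrite (ev_scale _ _ hG) Gp mulr0.
Qed.

Lemma vanishes_onP F G d e : F \is d.-homog -> G \is e.-homog ->
  vanishes_on F G <-> van F G.
Proof.
move=> hF hG; split=> [h|/vanP h P].
  apply/vanP => v v0 Fv; apply/(vanishes_atP (P := pt v0) hG erefl)/h.
  exact/(vanishes_atP (P := pt v0) hF erefl).
have [p p0 DP] := point_gen P.
by move=> /(vanishes_atP hF DP) Fp; apply/(vanishes_atP hG DP)/h.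
Qed.

Lemma eq_line p q : p != 0 -> <[p]>%VS = <[q]>%VS :> {vspace rV3} ->
  exists2 c, c != 0 & p = c *: q.
Proof.
move=> p0 E; have : p \in <[q]>%VS by rewrite -E memv_line.
by case/vlineP => c Dp; exists c => //; apply: contraNneq p0 => c0; rewrite Dp c0 scale0r.
Qed.

Lemma line_scale (c : K) p : c != 0 -> <[c *: p]>%VS = <[p]>%VS.
Proof.
move=> c0; apply/eqP; rewrite eqEsubv -!memvE memvZ ?memv_line //=.
by apply/vlineP; exists c^-1; rewrite scalerA mulVf // scale1r.
Qed.

Definition homt (la : 'cV[K]_3) p : 3.-tuple MP := [tuple linform (col i (homol la p)) | i < 3].

Lemma ev_homt la p v i : ev (tnth (homt la p) i) v = (v *m homol la p) 0 i.
Proof. by rewrite tnth_mktuple ev_linform !mxE; apply: eq_bigr => j _; rewrite !mxE. Qed.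

Lemma homt_homog la p i : tnth (homt la p) i \is 1.-homog.
Proof. by rewrite tnth_mktuple linform_homog. Qed.

Section Curve.
Variables (d : nat) (F : MP).
Hypotheses (charK : [pchar K] =i pred0) (d1 : (1 < d)%N).
Hypotheses (hF : F \is d.-homog) (sF : smooth_form F).

(* By [in_G_homol_sym], these [la] are the elements of G[P] when p spans P. *)
Definition homol_sym p (la : 'cV[K]_3) := 1 + (p *m la) 0 0 != 0 /\
  forall v, ev F (v *m homol la p) = (1 + (p *m la) 0 0) ^+ d * ev F v.

Section AtP.
Variables (p : rV3).
Hypothesis Fp : ev F p != 0.

Lemma base_point_neq0 : p != 0.
Proof. exact: base_neq0 d1 hF Fp. Qed.

(** A linear form has degree less than that of F in each chart, so divisibility by F there forces it
    to vanish. *)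
Lemma van_linear c : van F (linform c) -> c = 0.
Proof.
move=> vc; have [M uM rM] := row_basis base_point_neq0.
have [hF' F'1 sF' _] := normalized hF sF Fp uM rM.
have c0 : (ev F p)^-1 != 0 by rewrite invr_eq0.
have vM : van ((ev F p)^-1 *: subm M F) (subm M (linform c)) by apply/van_subm.
have hG : subm M (linform c) \is 1.-homog by rewrite subm_homog // linform_homog.
have chart0 (p' q' : {poly K}) (r : {poly {poly K}}) : chart p' q' (subm M (linform c)) =
   r * chart p' q' ((ev F p)^-1 *: subm M F) -> chart p' q' (subm M (linform c)) = 0.
  move=> Dr; apply: (monic_small _ Dr); first exact: chart_monic hF' F'1 _ _.
  by rewrite (chart_size hF' F'1); apply: leq_ltn_trans (size_chart _ _ hG) _.
have [r1 /chart0 c1] := van_dvd charK hF' F'1 sF' vM.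
have [r2 /chart0 c2] := van_dvd2 charK hF' F'1 sF' vM.
have E1 x y : (subm M (linform c)).@[h3 x 1 y] = 0.
  by have := congr1 (fun p : {poly {poly K}} => p.[y%:P].[x]) c1; rewrite chartE !hornerE.
have E2 x y : (subm M (linform c)).@[h3 1 x y] = 0.
  by have := congr1 (fun p : {poly {poly K}} => p.[y%:P].[x]) c2; rewrite chartE !hornerE.
have Mc : M *m c = 0.
  have EE (f : 'I_3 -> K) : (subm M (linform c)).@[f] =
      f o0 * (M *m c) o0 0 + f o1 * (M *m c) o1 0 + f o2 * (M *m c) o2 0.
    by rewrite ev_fun ev_subm ev_linform -mulmxA mxE big3 !(mxE _ (fun _ => f)).
  have e0 := E1 0 0; have e1 := E2 0 0; have e2 := E1 0 1.
  rewrite !EE /h3 /= ?mul0r ?mul1r ?addr0 ?add0r in e0 e1 e2.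
  rewrite e0 add0r in e2.
  by apply/colP; apply: forall3; rewrite [RHS]mxE.
by rewrite -[c](mulKmx uM) Mc mulmx0.
Qed.

Lemma ratmap_homogs n (f : n.-tuple MP) : ratmap F f ->
  exists e, forall i, tnth f i \is e.-homog.
Proof. by case. Qed.

Lemma ratmap_eq_sym n (f g : n.-tuple MP) : ratmap_eq F f g -> ratmap_eq F g f.
Proof.
case=> rf rg h; split=> // i j P /(h j i) /= E v vP.
have := E v vP; rewrite !mevalB !mevalM => E1.
by rewrite -[RHS]E1 [in RHS]mulrC; congr (_ - _); rewrite mulrC.
Qed.

Lemma ratmap_eqP n (f g : n.-tuple MP) e e' :
  (forall i, tnth f i \is e.-homog) -> (forall i, tnth g i \is e'.-homog) ->
  ratmap_eq F f g <-> [/\ exists i, ~ van F (tnth f i), exists i, ~ van F (tnth g i) &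
    forall v, v != 0 -> ev F v = 0 -> forall i j,
      ev (tnth f i) v * ev (tnth g j) v = ev (tnth f j) v * ev (tnth g i) v].
Proof.
move=> hf hg.
have hh i j : tnth f i * tnth g j - tnth f j * tnth g i \is (e + e').-homog.
  by rewrite rpredB // dhomogM.
split=> [[[_ [i fi]] [_ [j gj]] h]|[[i fi] [j gj] h]]; split.
- by exists i => vf; apply: fi; apply/(vanishes_onP hF (hf i)).
- by exists j => vf; apply: gj; apply/(vanishes_onP hF (hg j)).
- move=> v v0 Fv k l; have /vanP/(_ v v0 Fv) := (vanishes_onP hF (hh k l)).1 (h k l).
  by rewrite mevalB !mevalM => /eqP; rewrite subr_eq0 => /eqP.
- by split; [exists e|exists i => vf; apply: fi; apply/(vanishes_onP hF (hf i))].
- by split; [exists e'|exists j => vf; apply: gj; apply/(vanishes_onP hF (hg j))].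
- move=> k l; apply/(vanishes_onP hF (hh k l))/vanP => v v0 Fv.
  by rewrite mevalB !mevalM (h v v0 Fv k l) subrr.
Qed.

Lemma van_cancel G H e e' : G \is e.-homog -> H \is e'.-homog -> ~ van F G ->
  (forall v, v != 0 -> ev F v = 0 -> ev G v * ev H v = 0) -> van F H.
Proof.
move=> hG hH nG h; have [] // := @van_mul_form K d F p charK d1 hF sF Fp G H e e' hG hH.
by apply/vanP => v v0 Fv; rewrite mevalM h.
Qed.

(** The minors of f and h vanish only after multiplication by a coordinate of g; one that is not
    identically zero on C can be cancelled by irreducibility. *)
Lemma ratmap_eq_trans n (f g h : n.-tuple MP) :
  ratmap_eq F f g -> ratmap_eq F g h -> ratmap_eq F f h.
Proof.
move=> fg gh; have [rf rg _] := fg; have [_ rh _] := gh.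
have [e hf] := ratmap_homogs rf; have [e' hg] := ratmap_homogs rg; have [e2 hh] := ratmap_homogs rh.
have [nf [k nk] E1] := (ratmap_eqP hf hg).1 fg; have [_ nh E2] := (ratmap_eqP hg hh).1 gh.
apply/(ratmap_eqP hf hh); split=> // v v0 Fv i j.
have hij : tnth f i * tnth h j - tnth f j * tnth h i \is (e + e2).-homog.
  by rewrite rpredB // dhomogM.
suff /vanP/(_ v v0 Fv) : van F (tnth f i * tnth h j - tnth f j * tnth h i).
  by rewrite mevalB !mevalM => /eqP; rewrite subr_eq0 => /eqP.
apply: (van_cancel (hg k) hij nk) => u u0 Fu.
rewrite mevalB !mevalM; have F1 := E1 u u0 Fu; have F2 := E2 u u0 Fu.
rewrite mulrBr; apply/eqP; rewrite subr_eq0; apply/eqP.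
transitivity (ev (tnth f i) u * (ev (tnth g k) u * ev (tnth h j) u)); first by ring.
rewrite (F2 k j) mulrA (F1 i j).
transitivity (ev (tnth f j) u * (ev (tnth g i) u * ev (tnth h k) u)); first by ring.
by rewrite (F2 i k); ring.
Qed.

Lemma mul_homol_comp la mu : homol la p *m homol mu p =
  homol (la + mu + (p *m mu) 0 0 *: la) p.
Proof.
rewrite /homol mulmxDl mul1mx mulmxDr mulmx1.
have -> : la *m p *m (mu *m p) = (p *m mu) 0 0 *: (la *m p).
  rewrite -mulmxA [p *m _]mulmxA [p *m mu]mx11_scalar mul_scalar_mx -scalemxAr !mxE.
  by [].
by rewrite !mulmxDl -scalemxAl -!addrA; congr (_ + _); rewrite addrCA.
Qed.

Lemma homol_p la : p *m homol la p = (1 + (p *m la) 0 0) *: p.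
Proof. by rewrite mul_homol scalerDl scale1r. Qed.

Lemma homt_neq0 la : exists i, ~ van F (tnth (homt la p) i).
Proof.
apply: NNPP => H; have Hi i : van F (tnth (homt la p) i).
  by apply: NNPP => Hi; apply: H; exists i.
have T0 : homol la p = 0.
  apply/matrixP => i j; have := Hi j; rewrite tnth_mktuple => /van_linear/colP/(_ i).
  by rewrite !mxE.
have : (\rank (1%:M : 'M[K]_3) <= 1)%N.
  have -> : 1%:M = (- la) *m p by apply/eqP; rewrite mulNmx -addr_eq0 -/(homol la p) T0.
  exact: leq_trans (mxrankM_maxr _ _) (rank_leq_row _).
by rewrite mxrank1.
Qed.

(** A minor of v + la(v) p and v + mu(v) p is, up to sign, (la - mu)(v) times the corresponding
    minor of v and p. The latter is a nonzero linear form in v for suitable indices, so la - mu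
    vanishes on C. *)
Lemma homt_inj la mu : ratmap_eq F (homt la p) (homt mu p) -> la = mu.
Proof.
move/(ratmap_eqP (homt_homog la p) (homt_homog mu p)) => [_ _ E].
have p0 := base_point_neq0; have /rV0Pn[k pk] := p0.
have [j jk] : exists j : 'I_3, j != k.
  by have [->|k0] := eqVneq k o0; [exists o1|exists o0; rewrite eq_sym].
pose c : 'cV[K]_3 := p 0 k *: delta_mx j 0 - p 0 j *: delta_mx k 0.
have evc v : ev (linform c) v = p 0 k * v 0 j - p 0 j * v 0 k.
  by rewrite ev_linform mulmxBr -!scalemxAr -!colE !mxE.
have nc : ~ van F (linform c).
  move/van_linear/colP/(_ j)/eqP; rewrite !mxE eqxx (negPf jk) mulr1 mulr0 subr0.
  exact/negP.
apply/eqP; rewrite -subr_eq0; apply/eqP; apply: van_linear.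
apply: (van_cancel (linform_homog c) (linform_homog _) nc) => v v0 Fv.
have := E v v0 Fv k j; rewrite !ev_homt !mul_homol evc ev_linform mulmxBr.
have EE (A B : 'M[K]_1) : (A - B) 0 0 = A 0 0 - B 0 0 by rewrite !mxE.
rewrite EE; move: (_ *m la) (_ *m mu) => a b; rewrite !mxE => E1.
have {}E1 : (v 0 k + a 0 0 * p 0 k) * (v 0 j + b 0 0 * p 0 j) -
  (v 0 j + a 0 0 * p 0 j) * (v 0 k + b 0 0 * p 0 k) = 0 by rewrite E1 subrr.
by rewrite -[RHS]E1; ring.
Qed.

End AtP.
End Curve.
End Points.

Section Group.
Variable K : closedFieldType.
Notation MP := {mpoly K[3]}.
Notation rV3 := 'rV[K]_3.
Implicit Types (G : MP) (v w : rV3) (M : 'M[K]_3).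
Local Notation ev G v := (meval (fun_of_matrix v 0) G).

Variables (d : nat) (F : MP).
Hypotheses (charK : [pchar K] =i pred0) (d1 : (1 < d)%N).
Hypotheses (hF : F \is d.-homog) (sF : smooth_form F).
Variables (p : rV3) (P : point K).
Hypotheses (Fp : ev F p != 0) (DP : val P = <[p]>%VS).

Let p0 : p != 0 := base_point_neq0 d1 hF Fp.

Definition rowt (t : 3.-tuple MP) v : rV3 := \row_i ev (tnth t i) v.

Lemma ev_ratmap_comp n (l : n.-tuple MP) t v i :
  ev (tnth (ratmap_comp l t) i) v = ev (tnth l i) (rowt t v).
Proof.
by rewrite tnth_mktuple comp_mpoly_meval; apply: meval_eq => j; rewrite mxE.
Qed.

Lemma proj_zero l : is_projection P l ->
  forall v, (forall i, ev (tnth l i) v = 0) <-> exists c, v = c *: p.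
Proof.
case=> hl lP v; split=> [lv|[c ->] i].
  have [->|v0] := eqVneq v 0; first by exists 0; rewrite scale0r.
  have : pt v0 = P by apply/lP => i; apply/(vanishes_atP (P := pt v0) (hl i) erefl).
  move/(congr1 val) => /= E; have [|c _ ->] := @eq_line _ v p v0; last by exists c.
  by rewrite -DP; exact: E.
rewrite (ev_scale _ _ (hl i)).
by rewrite ((vanishes_atP (hl i) DP).1 ((lP P).2 erefl i)) mulr0.
Qed.

(** [linearize_form] yields the homology. The factor by which it multiplies F is read off at its
    eigenvector p, where F does not vanish. *)
Lemma in_G_homol_sym t : in_G F P t ->
  exists la, homol_sym d F p la /\ ratmap_eq F t (homt la p).
Proof.
move=> [[[rt vFt] [g [[rg vFg] _ tg]]] [l pl ltl]].
have [e ht] := ratmap_homogs rt; have [e' hg] := ratmap_homogs rg.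
have hl := pl.1.
have hlt i : tnth (ratmap_comp l t) i \is (1 * e).-homog.
  by rewrite tnth_mktuple; apply: comp_homog (hl i) ht.
have [[i nlt] [i' nl] Elt] := (ratmap_eqP hF hlt hl).1 ltl.
have I2 (j : 'I_2) : j = 0 \/ j = 1.
  by case: j => [[|[|//]] ?]; [left|right]; apply: val_inj.
have Ft v : v != 0 -> ev F v = 0 -> ev F (rowt t v) = 0.
  move=> v0 Fv; have /vanP/(_ v v0 Fv) := (vanishes_onP hF (comp_homog hF ht)).1 vFt.
  by rewrite comp_mpoly_meval => <-; apply: meval_eq => j; rewrite mxE.
have Fg v : v != 0 -> ev F v = 0 -> ev F (rowt g v) = 0.
  move=> v0 Fv; have /vanP/(_ v v0 Fv) := (vanishes_onP hF (comp_homog hF hg)).1 vFg.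
  by rewrite comp_mpoly_meval => <-; apply: meval_eq => j; rewrite mxE.
have [||||la Hla] := @linearize_form K d F p charK d1 hF sF Fp t e (tnth l) ht hl.
- exact: proj_zero.
- apply/vanP => v v0 Fv; have := Elt v v0 Fv 0 1; rewrite !tnth_mktuple => E.
  by rewrite mevalB !mevalM E subrr.
- case=> v0 v1; apply: nlt; rewrite tnth_mktuple.
  by case: (I2 i) => ->.
- exact: Ft.
have [k nk] : exists k, ~ van F (tnth t k).
  by case: rt => _ [k nk]; exists k => vk; apply: nk; apply/(vanishes_onP hF (ht k)).
have rtT : ratmap_eq F t (homt la p).
  apply/(ratmap_eqP hF ht (homt_homog la p)); split; first by exists k.
    exact: (homt_neq0 charK d1 hF sF Fp la).
  move=> v v0 Fv a b; rewrite !ev_homt; have := Hla v v0 Fv a b.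
  by rewrite !mxE.
exists la; split=> //.
rewrite /homol_sym; set b := 1 + _; split.
  (* If b = 0, the homology maps into the plane la = 0. Let g be the inverse of t. Either la
     vanishes on C through t o g = id, whence la = 0 and b = 1; or the homology kills g(v) for all v
     on C, so that g(v) is a multiple of p lying on C, that is, zero. *)
  apply/eqP => b0.
  have Tla (u : rV3) : u *m homol la p *m la = 0.
    rewrite mul_homol mulmxDl -scalemxAl; apply/matrixP => i0 j0.
    rewrite !ord1 [RHS]mxE [LHS]mxE [X in _ + X]mxE.
    by rewrite -{1}[(u *m la) 0 0]mulr1 -mulrDr -/b b0 mulr0.
  pose X := linform la \mPo ratmap_comp t g.
  have htg i0 : tnth (ratmap_comp t g) i0 \is (e * e').-homog.
    by rewrite tnth_mktuple; apply: comp_homog.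
  have hX : X \is (1 * (e * e')).-homog by apply: comp_homog (linform_homog la) htg.
  have evX v : ev X v = (rowt t (rowt g v) *m la) 0 0.
    rewrite comp_mpoly_meval -ev_linform; apply: meval_eq => j.
    by rewrite ev_ratmap_comp [RHS]mxE.
  have hid i0 : tnth (@ratmap_id K) i0 \is 1.-homog by rewrite tnth_mktuple dhomogX /= mdeg1.
  have [[j nj] _ Eid] := (ratmap_eqP hF htg hid).1 tg.
  have evid v i0 : ev (tnth (@ratmap_id K) i0) v = v 0 i0 by rewrite tnth_mktuple mevalXU.
  have [vX|nX] := classic (van F X).
    have la0 : la = 0.
      apply: (van_linear charK d1 hF sF Fp).
      apply: (van_cancel charK d1 hF sF Fp (htg j) (linform_homog la) nj) => v v0 Fv.
      have /vanP/(_ v v0 Fv) := vX; rewrite evX => X0.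
      rewrite ev_linform mxE mulr_sumr.
      transitivity (v 0 j * (rowt t (rowt g v) *m la) 0 0); last by rewrite X0 mulr0.
      rewrite mxE mulr_sumr; apply: eq_bigr => a _.
      have := Eid v v0 Fv a j; rewrite !evid !ev_ratmap_comp => E.
      transitivity (la a 0 * (ev (tnth t j) (rowt g v) * v 0 a)); first by ring.
      by rewrite -E [rowt t _ 0 a]mxE; ring.
    by move/eqP: b0; rewrite /b la0 mulmx0 mxE addr0 oner_eq0.
  have vY a : van F (tnth (homt la p) a \mPo g).
    apply: (van_cancel charK d1 hF sF Fp hX (comp_homog (homt_homog la p a) hg) nX) => v v0 Fv.
    have -> : ev (tnth (homt la p) a \mPo g) v = (rowt g v *m homol la p) 0 a.
      by rewrite comp_mpoly_meval -ev_homt; apply: meval_eq => c; rewrite [RHS]mxE.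
    have [->|gv0] := eqVneq (rowt g v) 0; first by rewrite mul0mx mxE mulr0.
    rewrite evX; have := Hla _ gv0 (Fg v v0 Fv); rewrite -/(rowt t _) => pr.
    rewrite mxE mulr_suml.
    transitivity (rowt t (rowt g v) 0 a * (rowt g v *m homol la p *m la) 0 0).
      rewrite [(_ *m homol la p *m la) 0 0]mxE mulr_sumr; apply: eq_bigr => c _.
      transitivity (la c 0 * (rowt t (rowt g v) 0 c * (rowt g v *m homol la p) 0 a)); first by ring.
      by rewrite (pr c a); ring.
    by rewrite Tla [X in _ * X]mxE mulr0.
  case: rg => _ [a na]; apply: na; apply/(vanishes_onP hF (hg a))/vanP => v v0 Fv.
  have gT : rowt g v *m homol la p = 0.
    apply/rowP => c; have /vanP/(_ v v0 Fv) := vY c.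
    rewrite comp_mpoly_meval => E; rewrite [RHS]mxE -E -ev_homt; apply: meval_eq => c'.
    by rewrite [LHS]mxE.
  have Dg : rowt g v = - (rowt g v *m la) 0 0 *: p.
    by apply/eqP; rewrite scaleNr -addr_eq0 -mul_homol gT.
  have := Fg v v0 Fv; rewrite Dg (ev_scale _ _ hF) => /eqP.
  rewrite mulf_eq0 (negPf Fp) orbF expf_eq0 => /andP[_ /eqP c0].
  by have := congr1 (fun w : rV3 => w 0 a) Dg; rewrite c0 scale0r !mxE.
move=> v.
have hG : subm (homol la p) F \is d.-homog by apply: subm_homog.
(* With T the homology, t(u) and T u are parallel on C, so t_k(u)^d F(T u) = (T u)_k^d F(t(u)) = 0;
   then t_k^d is cancelled. *)
have vG : van F (subm (homol la p) F).
  apply: (van_cancel charK d1 hF sF Fp (dhomogMn d (ht k)) hG).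
    move/vanP => vk; apply: nk; apply/vanP => u u0 Fu.
    by have := vk u u0 Fu; rewrite rmorphXn /= => /eqP; rewrite expf_eq0 => /andP[_ /eqP].
  move=> u u0 Fu; rewrite rmorphXn /= ev_subm -(ev_scale _ _ hF).
  have -> : ev (tnth t k) u *: (u *m homol la p) = (u *m homol la p) 0 k *: rowt t u.
    apply/rowP => c; rewrite [LHS]mxE [RHS]mxE; have := Hla u u0 Fu k c.
    by rewrite !(mxE _ (fun _ => _)) => ->; rewrite mulrC.
  by rewrite (ev_scale _ _ hF) Ft // mulr0.
have := van_same_degree_form charK d1 hF sF Fp hG vG v.
rewrite !ev_subm homol_p (ev_scale _ _ hF) => ->.
by rewrite mulfK.
Qed.

End Group.

Section Group.
Variable K : closedFieldType.
Notation MP := {mpoly K[3]}.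
Notation rV3 := 'rV[K]_3.
Implicit Types (G : MP) (v w : rV3) (M : 'M[K]_3).
Local Notation ev G v := (meval (fun_of_matrix v 0) G).

Lemma homol0 (p : rV3) : homol 0 p = 1%:M.
Proof. by rewrite /homol mul0mx addr0. Qed.

Lemma scale11 (c : K) (A : 'M[K]_1) : (c *: A) 0 0 = c * A 0 0.
Proof. by rewrite mxE. Qed.

Lemma homol_inv (la : 'cV[K]_3) (p : rV3) : 1 + (p *m la) 0 0 != 0 ->
  homol la p *m homol (- (1 + (p *m la) 0 0)^-1 *: la) p = 1%:M.
Proof.
move=> b0; rewrite mul_homol_comp -[RHS](homol0 p); congr homol.
rewrite -scalemxAr scale11 -{1}[la]scale1r -!scalerDl.
rewrite (_ : _ + _ = 0) ?scale0r //.
by move: b0; move: ((p *m la) 0 0) => c b0; field.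
Qed.

Variables (d : nat) (F : MP).
Hypotheses (charK : [pchar K] =i pred0) (d1 : (1 < d)%N).
Hypotheses (hF : F \is d.-homog) (sF : smooth_form F).
Variables (p : rV3) (P : point K).
Hypotheses (Fp : ev F p != 0) (DP : val P = <[p]>%VS).

Let p0 : p != 0 := base_point_neq0 d1 hF Fp.

Lemma exists_projection : exists l, is_projection P l.
Proof.
have [M uM rM] := row_basis p0.
pose l : 2.-tuple MP := [tuple linform (col (h3 o0 o1 o1 (widen_ord (isT : (2 <= 3)%N) i)) (invmx M)) | i < 2].
have El i v : ev (tnth l i) v = (v *m invmx M) 0 (h3 o0 o1 o1 (widen_ord (isT : (2 <= 3)%N) i)).
  by rewrite tnth_mktuple ev_linform !mxE; apply: eq_bigr => j _; rewrite !mxE.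
have hl i : tnth l i \is 1.-homog by rewrite tnth_mktuple linform_homog.
have pM : p *m invmx M = \row_j h3 0 0 1 j by rewrite -rM row_o2 mulmxK.
exists l; split=> // Q; split=> [lQ|-> i].
  have [q q0 DQ] := point_gen Q; apply: val_inj; rewrite DQ DP.
  have lq i : ev (tnth l i) q = 0 by apply/(vanishes_atP (hl i) DQ).
  have Dq : q = (q *m invmx M) 0 o2 *: p.
    rewrite -{1}[q](mulmxKV uM) -[X in _ = _ *: X](mulmxKV uM) scalemxAl; congr (_ *m _).
    rewrite pM; apply/rowP; apply: forall3; rewrite [RHS]mxE [X in _ * X]mxE /h3 /= ?mulr0 ?mulr1 //.
      by have := lq 0; rewrite El.
    by have := lq 1; rewrite El.
  rewrite Dq line_scale //; apply: contraNneq q0 => c0.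
  by rewrite Dq c0 scale0r.
apply/(vanishes_atP (hl i) DP); rewrite El pM mxE.
by case: i => [[|[|//]] ?].
Qed.

Lemma homt_ratself la : homol_sym d F p la -> ratself F (homt la p).
Proof.
case=> b0 FT; split.
  split; first by exists 1%N => i; apply: homt_homog.
  have [i ni] := homt_neq0 charK d1 hF sF Fp la.
  by exists i => vi; apply: ni; apply/(vanishes_onP hF (homt_homog la p i)).
have hG : F \mPo homt la p \is (d * 1).-homog by apply: comp_homog hF (homt_homog la p).
apply/(vanishes_onP hF hG)/vanP => v v0 Fv.
rewrite comp_mpoly_meval; transitivity (ev F (v *m homol la p)).
  by apply: meval_eq => i; rewrite ev_homt.
by rewrite FT Fv mulr0.
Qed.

Lemma homt_comp_id la mu : homol la p *m homol mu p = 1%:M ->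
  ratmap_eq F (ratmap_comp (homt mu p) (homt la p)) (ratmap_id K).
Proof.
move=> E.
have hc i : tnth (ratmap_comp (homt mu p) (homt la p)) i \is (1 * 1).-homog.
  by rewrite tnth_mktuple; apply: comp_homog (homt_homog _ _ _) (homt_homog _ _).
have hid i : tnth (ratmap_id K) i \is 1.-homog by rewrite tnth_mktuple dhomogX /= mdeg1.
have evid v i : ev (tnth (ratmap_id K) i) v = v 0 i by rewrite tnth_mktuple mevalXU.
have evc v i : ev (tnth (ratmap_comp (homt mu p) (homt la p)) i) v = v 0 i.
  rewrite ev_ratmap_comp ev_homt (_ : rowt _ _ = v *m homol la p) -?mulmxA ?E ?mulmx1 //.
  by apply/rowP => j; rewrite mxE ev_homt.
have [i ni] := homt_neq0 charK d1 hF sF Fp 0.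
have nid : ~ van F (tnth (ratmap_id K) i).
  move/vanP => vi; apply: ni; apply/vanP => v v0 Fv.
  by rewrite ev_homt homol0 mulmx1 -evid; apply: vi.
apply/(ratmap_eqP hF hc hid); split; first exists i.
- by move/vanP => vi; apply: nid; apply/vanP => v v0 Fv; rewrite evid -evc; apply: vi.
- by exists i.
by move=> v v0 Fv a b; rewrite !evid !evc mulrC.
Qed.

Lemma homol_sym_in_G la : homol_sym d F p la -> in_G F P (homt la p).
Proof.
move=> L; have [b0 FT] := L; set b := 1 + _ in b0 FT.
pose mu := - b^-1 *: la.
have E1 : homol la p *m homol mu p = 1%:M by apply: homol_inv.
have E2 : homol mu p *m homol la p = 1%:M by apply: mulmx1C.
have Lmu : homol_sym d F p mu.
  have Dmu : 1 + (p *m mu) 0 0 = b^-1.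
    rewrite /mu -scalemxAr scale11.
    by move: b0; rewrite /b; move: ((p *m la) 0 0) => c b0; field.
  split; rewrite Dmu ?invr_eq0 // => v.
  have := FT (v *m homol mu p); rewrite -mulmxA E2 mulmx1 => ->.
  by rewrite mulrA -exprMn mulVf // expr1n mul1r.
split.
  split; first exact: homt_ratself.
  by exists (homt mu p); split; [apply: homt_ratself|apply: homt_comp_id|apply: homt_comp_id].
have [l pl] := exists_projection; exists l => //.
have hl := pl.1.
have hc i : tnth (ratmap_comp l (homt la p)) i \is (1 * 1).-homog.
  by rewrite tnth_mktuple; apply: comp_homog (hl i) (homt_homog _ _).
have lp i : ev (tnth l i) p = 0.
  by apply/((proj_zero DP pl p).2 _ i); exists 1; rewrite scale1r.
have evc v i : ev (tnth (ratmap_comp l (homt la p)) i) v = ev (tnth l i) v.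
  have [c Dc] := linformP (hl i).
  rewrite ev_ratmap_comp (_ : rowt _ _ = v *m homol la p); last first.
    by apply/rowP => j; rewrite mxE ev_homt.
  rewrite mul_homol !Dc mulmxDl -scalemxAl mxE [X in _ + X]mxE.
  by have := lp i; rewrite Dc => ->; rewrite mulr0 addr0.
have [i nl] : exists i, ~ van F (tnth l i).
  apply: NNPP => H; have Hi i : van F (tnth l i).
    by apply: NNPP => Hi; apply: H; exists i.
  have Z v i : ev (tnth l i) v = 0.
    have [c Dc] := linformP (hl i); rewrite Dc.
    have -> : c = 0; last by rewrite mulmx0 mxE.
    apply: (van_linear charK d1 hF sF Fp); apply/vanP => u u0 Fu.
    by rewrite ev_linform -Dc; have /vanP := Hi i; apply.
  have [M uM rM] := row_basis p0.
  have [c Dc] := (proj_zero DP pl (row o0 M)).1 (Z _).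
  have := congr1 (mulmx^~ (invmx M)) Dc; rewrite /= -scalemxAl -rM -!row_mul mulmxV //.
  move/rowP/(_ o0)/eqP; rewrite !mxE /= mulr0; exact/negP/oner_neq0.
apply/(ratmap_eqP hF hc hl); split.
- by exists i => /vanP vi; apply: nl; apply/vanP => v v0 Fv; rewrite -evc; apply: vi.
- by exists i.
by move=> v v0 Fv a b'; rewrite !evc mulrC.
Qed.

(** From here on G[P] is linear algebra: classes of rational maps correspond bijectively to linear
    forms la. *)
Lemma card_G_homol_sym n : card_G F P n <-> has_card (homol_sym d F p) n.
Proof.
have tr := ratmap_eq_trans charK d1 hF sF Fp.
have sym := @ratmap_eq_sym K F 3.
split=> [[t [tG tinj tsur]]|[la [lL linj lsur]]].
  have /fin_all_exists[la Hla] : forall i, exists la, homol_sym d F p la /\ ratmap_eq F (t i) (homt la p).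
    by move=> i; apply: (in_G_homol_sym charK d1 hF sF Fp DP).
  exists la; split=> [i|i j Eij|mu Lmu].
  - by have [] := Hla i.
  - have [_ Ei] := Hla i; have [_ Ej] := Hla j; apply: tinj.
    by apply: tr Ei _; rewrite Eij; apply: sym.
  have [i Ei] := tsur _ (homol_sym_in_G Lmu); exists i.
  apply: (homt_inj charK d1 hF sF Fp); apply: tr Ei _.
  by have [] := Hla i.
exists (fun i => homt (la i) p); split=> [i|i j Eij|x xG].
- exact: homol_sym_in_G.
- by apply: linj; apply: (homt_inj charK d1 hF sF Fp).
have [mu [Lmu Emu]] := in_G_homol_sym charK d1 hF sF Fp DP xG.
by have [i Di] := lsur _ Lmu; exists i; rewrite -Di.
Qed.

Lemma card3_quasi_galois : card_G F P 3 -> quasi_galois F P.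
Proof.
case=> t [tG tinj _]; exists (t 0), (t 1); split=> // E.
by have := tinj _ _ E.
Qed.

End Group.

(** * Homologies of a smooth form *)

Section Lines.
Variable K : closedFieldType.
Notation MP := {mpoly K[3]}.
Notation rV3 := 'rV[K]_3.
Implicit Types (G : MP) (v w p : rV3) (M : 'M[K]_3) (la mu : 'cV[K]_3).
Local Notation ev G v := (meval (fun_of_matrix v 0) G).

(** The polynomial G(v + s w) in s, the restriction of G to a line. *)
Definition lineP G v w : {poly K} := mmap polyC (fun i => (v 0 i)%:P + (w 0 i)%:P * 'X) G.

Lemma horner_lineP G v w s : (lineP G v w).[s] = ev G (v + s *: w).
Proof.
rewrite /lineP -[LHS]horner_evalE mmap_rmorph.
apply: mmap_ext => [c /=|i /=]; first by rewrite horner_evalE hornerC.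
by rewrite horner_evalE !hornerE !mxE mulrC.
Qed.

Lemma size_lineP G v w d : G \is d.-homog -> (size (lineP G v w) <= d.+1)%N.
Proof.
move=> /dhomogP hG; rewrite /lineP /mmap; apply: (leq_trans (size_sum _ _ _)).
apply/bigmax_leqP_seq => m mG _; rewrite mul_polyC; apply: leq_trans (size_scale_leq _ _) _.
have s2 (i : 'I_3) k : (size (((v 0 i)%:P + (w 0 i)%:P * 'X) ^+ k)%R <= k.+1)%N.
  apply: leq_trans (size_poly_exp_leq _ _) _; rewrite ltnS.
  rewrite -[X in (_ <= X)%N]mul1n leq_mul2r; apply/orP; right.
  rewrite -subn1 leq_subLR addrC mul_polyC; apply: leq_trans (size_polyD _ _) _.
  rewrite geq_max (leq_trans (size_scale_leq _ _)) ?size_polyX //.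
  by apply: leq_trans (size_polyC_leq1 _) _.
rewrite -(hG m mG) /= mdeg3 /mmap1 big3 /=.
apply: leq_trans (size_polyMleq _ _) _.
have := size_polyMleq (((v 0 o0)%:P + (w 0 o0)%:P * 'X) ^+ m o0) (((v 0 o1)%:P + (w 0 o1)%:P * 'X) ^+ m o1).
move: (s2 o0 (m o0)) (s2 o1 (m o1)) (s2 o2 (m o2)).
move: (size _) (size _) (size _) (size _) => x y z t; lia.
Qed.

Lemma lineP_flip G v w d s : G \is d.-homog -> s != 0 ->
  (lineP G v w).[s] = s ^+ d * (lineP G w v).[s^-1].
Proof.
move=> hG s0; rewrite !horner_lineP -(ev_scale _ _ hG) scalerDr scalerA mulfV // scale1r.
by rewrite addrC.
Qed.

Lemma lead_lineP G v w d : G \is d.-homog -> (lineP G v w)`_d = ev G w.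
Proof.
move=> hG; have -> : lineP G v w = revp d (lineP G w v).
  apply/eqP; rewrite -subr_eq0; apply/eqP.
  apply: (@horner_generic_eq0 _ 'X); first by rewrite polyX_eq0.
  move=> s; rewrite hornerX => s0; rewrite hornerD hornerN (lineP_flip _ _ hG) //.
  by rewrite horner_revp ?subrr // size_lineP.
by rewrite coef_poly ltnSn subnn -horner_coef0 horner_lineP scale0r addr0.
Qed.

Lemma deriv_lineP G v w : (lineP G v w)^`() = \sum_i (w 0 i)%:P * lineP G^`M(i) v w.
Proof.
rewrite /lineP mmap_derivation.
- apply: eq_bigr => i _ /=; rewrite derivD derivC add0r derivM derivC mul0r add0r derivX mulr1.
  by rewrite mulrC.
- by move=> a b; rewrite /= derivM.
- by move=> c; rewrite /= derivC.
Qed.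

Lemma coef0_lineP G v w : (lineP G v w)`_0 = ev G v.
Proof. by rewrite -horner_coef0 horner_lineP scale0r addr0. Qed.

Lemma coef1_lineP G v w : (lineP G v w)`_1 = \sum_i w 0 i * ev G^`M(i) v.
Proof.
have := congr1 (fun p : {poly K} => p`_0) (deriv_lineP G v w).
rewrite coef_deriv mulr1n => ->; rewrite coef_sum; apply: eq_bigr => i _.
by rewrite coefCM coef0_lineP.
Qed.

Lemma poly_const_nat (q : {poly K}) (c a : K) : [pchar K] =i pred0 -> a != 0 ->
  (forall n : nat, q.[n%:R * a] = c) -> q = c%:P.
Proof.
move=> ch a0 h; apply/eqP; rewrite -subr_eq0; apply: contraT => q0.
pose rs := [seq n%:R * a | n <- iota 0 (size (q - c%:P)%R)].
have : (size rs < size (q - c%:P)%R)%N.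
  apply: max_poly_roots => //.
    by apply/allP => _ /mapP[n _ ->]; rewrite /root !hornerE h subrr.
  rewrite map_inj_uniq ?iota_uniq // => m n /(mulIf a0) E.
  wlog le : m n E / (m <= n)%N by move=> H; case/orP: (leq_total m n) => ?; [|symmetry]; apply: H.
  apply/eqP; rewrite eqn_leq le -subn_eq0 /=; have /pcharf0P <- := ch.
  by rewrite natrB // E subrr.
by rewrite size_map size_iota ltnn.
Qed.

Section Sextic.
Variables (d : nat) (F : MP).
Hypotheses (charK : [pchar K] =i pred0) (d1 : (1 < d)%N).
Hypotheses (hF : F \is d.-homog) (sF : smooth_form F).

Lemma ev0 G e : (0 < e)%N -> G \is e.-homog -> ev G (0 : rV3) = 0.
Proof.
by move=> e0 hG; have := ev_scale 0 (0 : rV3) hG; rewrite scale0r expr0n eqn0Ngt e0 mul0r.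
Qed.

(* The orbits of an elation would make F constant on all lines through q. *)
Lemma no_elation (nu : 'cV[K]_3) q : (q *m nu) 0 0 = 0 ->
  (forall v, ev F (v *m homol nu q) = ev F v) -> nu = 0 \/ q = 0.
Proof.
move=> qnu h; have [->|nu0] := eqVneq nu 0; first by left.
have [->|q0] := eqVneq q 0; [by right|exfalso].
have hn v (n : nat) : ev F (v + (n%:R * (v *m nu) 0 0) *: q) = ev F v.
  elim: n => [|n IHn]; first by rewrite mul0r scale0r addr0.
  rewrite -[RHS]IHn -[RHS]h mul_homol mulmxDl -scalemxAl.
  have -> : (v *m nu + (n%:R * (v *m nu) 0 0) *: (q *m nu)) 0 0 = (v *m nu) 0 0.
    by rewrite mxE scale11 qnu mulr0 addr0.
  by rewrite -addrA -scalerDl -natr1 mulrDl mul1r.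
have inv v s : (v *m nu) 0 0 != 0 -> ev F (v + s *: q) = ev F v.
  move=> vnu; rewrite -horner_lineP (_ : lineP F v q = (ev F v)%:P) ?hornerC //.
  by apply: (poly_const_nat charK vnu) => n; rewrite horner_lineP hn.
have [k nuk] : exists k, nu k 0 != 0 by apply/cV0Pn.
pose v0 : rV3 := delta_mx 0 k.
have v0nu : (v0 *m nu) 0 0 != 0 by rewrite -rowE mxE.
(* A point of the plane nu = 0 is reached along v + t v0, which leaves that plane for t <> 0: an
   identity of polynomials in t. *)
have invall v s : ev F (v + s *: q) = ev F v.
  have [vn|/inv->//] := eqVneq ((v *m nu) 0 0) 0.
  have : lineP F (v + s *: q) v0 - lineP F v v0 = 0.
    apply: (@horner_generic_eq0 _ 'X); first by rewrite polyX_eq0.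
    move=> t; rewrite hornerX => t0; rewrite hornerD hornerN !horner_lineP addrAC inv ?subrr //.
    by rewrite mulmxDl -scalemxAl mxE scale11 vn add0r mulf_neq0.
  move/(congr1 (fun q : {poly K} => q`_0)); rewrite coefB !coef0_lineP coef0 => /eqP.
  by rewrite subr_eq0 => /eqP.
have d0 : (0 < d)%N by apply: ltnW.
(* Translating 0 by q gives F(q) = 0, and F(q + t u) = F(t u) = t^d F(u) for every u, so all first
   derivatives vanish at q because d > 1: the curve would be singular at q. *)
have Fq : ev F q = 0.
  by have := invall 0 1; rewrite add0r scale1r (ev0 d0 hF).
have [i Fi] := (smooth_formP F).1 sF q q0 Fq.
case/eqP: Fi; pose w : rV3 := delta_mx 0 i.
have -> : ev F^`M(i) q = (lineP F q w)`_1.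
  rewrite coef1_lineP (bigD1 i) //= big1 => [|j ji]; last by rewrite mxE (negPf ji) mul0r.
  by rewrite mxE !eqxx mul1r addr0.
have -> : lineP F q w = (ev F w)%:P * 'X^d.
  apply/eqP; rewrite -subr_eq0; apply/eqP/horner_eq0 => t.
  rewrite !hornerE horner_lineP [q + _]addrC -[q]scale1r invall (ev_scale _ _ hF) ?hornerXn.
  by rewrite mulrC subrr.
by rewrite coefCM coefXn; case: (d) d1 => [|[|n]] //= _; rewrite mulr0.
Qed.

(** The form on the right belongs to the conjugate of the homology of la by that of mu; it takes the
    same value at p as la. *)
Lemma homol_commute la mu p :
  homol la p *m homol mu p =
  homol mu p *m homol ((1 + (p *m mu) 0 0) *: la - (p *m la) 0 0 *: mu) p.
Proof.
rewrite !mul_homol_comp; congr homol.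
have -> : (p *m ((1 + (p *m mu) 0 0) *: la - (p *m la) 0 0 *: mu)) 0 0 = (p *m la) 0 0.
  rewrite mulmxBr -!scalemxAr.
  have EE (A B : 'M[K]_1) : (A - B) 0 0 = A 0 0 - B 0 0 by rewrite !mxE.
  by rewrite EE !scale11; ring.
rewrite scalerDl scale1r; apply/colP => i; rewrite ![in LHS]mxE ![in RHS]mxE; ring.
Qed.

Section AtP.
Variable p : rV3.
Hypothesis Fp : ev F p != 0.
Notation mult la := (1 + (p *m la) 0 0).

Let p0 : p != 0 := base_point_neq0 d1 hF Fp.

(** The quotient of two homologies with the same center and multiplier is an elation. *)
Lemma homol_sym_uniq la mu : homol_sym d F p la -> homol_sym d F p mu -> mult la = mult mu -> la = mu.
Proof.
case=> bla Fla [bmu Fmu] E; pose nu := (mult mu)^-1 *: (la - mu).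
have Dla : la = nu + mu + (p *m mu) 0 0 *: nu.
  rewrite /nu scalerA addrAC -scalerDl.
  rewrite -{1}[(mult mu)^-1]mul1r -mulrDl mulfV // scale1r subrK //.
have qnu : (p *m nu) 0 0 = 0.
  rewrite /nu -scalemxAr scale11 mulmxBr.
  have -> : (p *m la - p *m mu) 0 0 = 0.
    by rewrite mxE [X in _ + X]mxE; apply/eqP; rewrite subr_eq0; move/addrI: E => ->.
  by rewrite mulr0.
have h v : ev F (v *m homol nu p) = ev F v.
  have := Fla v; rewrite {1}Dla -mul_homol_comp mulmxA Fmu E.
  by apply: mulfI; rewrite expf_neq0.
have [nu0|pz] := no_elation qnu h; last by case/eqP: (p0).
by rewrite Dla nu0 scaler0 addr0 add0r.
Qed.

Lemma homol_sym0 : homol_sym d F p 0.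
Proof.
split; rewrite mulmx0 mxE addr0 ?oner_neq0 // => v.
by rewrite homol0 mulmx1 expr1n mul1r.
Qed.

Lemma homol_sym_comp la mu : homol_sym d F p la -> homol_sym d F p mu ->
  homol_sym d F p (la + mu + (p *m mu) 0 0 *: la) /\
  mult (la + mu + (p *m mu) 0 0 *: la) = mult la * mult mu.
Proof.
case=> bla Fla [bmu Fmu].
have E : mult (la + mu + (p *m mu) 0 0 *: la) = mult la * mult mu.
  rewrite !mulmxDr -scalemxAr.
  have EE (A B : 'M[K]_1) : (A + B) 0 0 = A 0 0 + B 0 0 by rewrite !mxE.
  by rewrite !EE scale11; ring.
split=> //; split; first by rewrite E mulf_neq0.
by move=> v; rewrite E -mul_homol_comp mulmxA Fmu Fla exprMn; ring.
Qed.

(** Conjugation by mu preserves the center and the multiplier, so by uniqueness the two homologies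
    commute. In particular, nontrivial ones at the same center have the same axis. *)
Lemma homol_sym_proportional la mu : homol_sym d F p la -> homol_sym d F p mu ->
  (mult mu - 1) *: la = (p *m la) 0 0 *: mu.
Proof.
move=> Lla Lmu; have [bla Fla] := Lla; have [bmu Fmu] := Lmu.
set la' := mult mu *: la - (p *m la) 0 0 *: mu.
have E : mult la' = mult la.
  rewrite /la' mulmxBr -!scalemxAr.
  have EE (A B : 'M[K]_1) : (A - B) 0 0 = A 0 0 - B 0 0 by rewrite !mxE.
  by rewrite EE !scale11; ring.
have Lla' : homol_sym d F p la'.
  split; rewrite E // => v.
  have T := homol_inv bmu; set mu' := _ *: mu in T.
  have T' : homol mu' p *m homol mu p = 1%:M by apply: mulmx1C.
  rewrite -[v]mulmx1 -T' [v *m _]mulmxA -[_ *m homol mu p *m _]mulmxA -homol_commute mulmxA.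
  by rewrite !Fmu Fla; ring.
have := homol_sym_uniq Lla' Lla E; rewrite /la' => H.
by rewrite scalerBl scale1r -{2}H opprB addrC subrK.
Qed.

(** For v on the axis the homology acts on the line v + s p by s -> m s with m the multiplier; the
    coefficients of s^j are compared. *)
Lemma lineP_mult la v j : homol_sym d F p la -> (v *m la) 0 0 = 0 ->
  (lineP F v p)`_j * mult la ^+ j = mult la ^+ d * (lineP F v p)`_j.
Proof.
case=> bla Fla vla.
have vT s : ev F (v + (mult la * s) *: p) = mult la ^+ d * ev F (v + s *: p).
  rewrite -Fla mul_homol mulmxDl -scalemxAl.
  have -> : (v *m la + s *: (p *m la)) 0 0 = s * (p *m la) 0 0.
    by rewrite mxE scale11 vla add0r.
  by rewrite -addrA -scalerDl (_ : mult la * s = s + s * (p *m la) 0 0) //; ring.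
have : \poly_(i < d.+1) ((lineP F v p)`_i * mult la ^+ i) = mult la ^+ d *: lineP F v p.
  apply/eqP; rewrite -subr_eq0; apply/eqP/horner_eq0 => s.
  rewrite hornerD hornerN hornerZ !horner_lineP -vT -horner_lineP horner_poly.
  rewrite (horner_coef_wide _ (size_lineP v p hF)) -sumrB big1 // => i _.
  by rewrite exprMn mulrA subrr.
move/(congr1 (fun q : {poly K} => q`_j)); rewrite coefZ coef_poly => <-.
case: ltnP => // dj; rewrite nth_default ?mul0r //.
exact: leq_trans (size_lineP v p hF) dj.
Qed.

End AtP.
End Sextic.
End Lines.

(** * Sextics: points whose group has order exactly 3 *)

Section Sextic.
Variable K : closedFieldType.
Notation MP := {mpoly K[3]}.
Notation rV3 := 'rV[K]_3.
Implicit Types (G : MP) (v p : rV3) (M : 'M[K]_3) (la mu : 'cV[K]_3).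
Local Notation ev G v := (meval (fun_of_matrix v 0) G).
Hypothesis charK : [pchar K] =i pred0.

Lemma natK0 n : (n.+1%:R : K) != 0.
Proof. by have /pcharf0P -> := charK. Qed.

Lemma exists_omega : exists w : K, w ^+ 2 + w + 1 = 0.
Proof.
have : size ('X^2 + 'X + 1 : {poly K}) != 1%N.
  by rewrite -addrA size_polyDl ?size_polyXn // size_XaddC.
by case/closed_rootP => w /rootP; rewrite !hornerE => E; exists w.
Qed.

Variable w : K.
Hypothesis Dw : w ^+ 2 + w + 1 = 0.

Lemma w3 : w ^+ 3 = 1.
Proof.
apply/eqP; rewrite -subr_eq0; apply/eqP.
by rewrite -[RHS](mulr0 (w - 1)) -Dw; ring.
Qed.

Lemma w_neq1 : w != 1.
Proof.
apply/eqP => w1; move: Dw; rewrite w1 expr1n => /eqP.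
have -> : 1 + 1 + 1 = 3%:R :> K by ring.
by rewrite (negPf (natK0 2)).
Qed.

Lemma w_neq0 : w != 0.
Proof. by apply/eqP => w0; have := w3; rewrite w0 expr0n => /eqP; rewrite eq_sym oner_eq0. Qed.

Lemma cube_root1 (b : K) : b ^+ 3 = 1 -> [\/ b = 1, b = w | b = w ^+ 2].
Proof.
move=> b3; have : (b - 1) * (b - w) * (b - w ^+ 2) == 0.
  have -> : (b - 1) * (b - w) * (b - w ^+ 2) =
      b ^+ 3 - w ^+ 3 - (w ^+ 2 + w + 1) * (b ^+ 2 - w * b).
    by ring.
  by rewrite Dw mul0r subr0 b3 w3 subrr.
rewrite !mulf_eq0 !subr_eq0 -orbA => /or3P[] /eqP->; [apply: Or31|apply: Or32|apply: Or33] => //.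
Qed.

Variable F : MP.
Hypotheses (hF : F \is 6.-homog) (sF : smooth_form F).

Let d6 : (1 < 6)%N := isT.

(** The multiplier 1 + la(p) is w. The factor w^6 of [homol_sym] is 1, so F itself is invariant. *)
Definition homology3 p la :=
  [/\ ev F p != 0, (p *m la) 0 0 = w - 1 & forall v, ev F (v *m homol la p) = ev F v].

(* Over the axis, F(v + s p) has a nonzero coefficient of s^3: this excludes a
   homology of order 6 at p. *)
Definition exact_order3 p la := exists v, (v *m la) 0 0 = 0 /\ (lineP F v p)`_3 != 0.

Notation mult p la := (1 + (p *m la) 0 0).

Lemma homology3_sym p la : homology3 p la -> homol_sym 6 F p la.
Proof.
case=> Fp pla inv; split; rewrite pla subrKC ?w_neq0 // => v.
by rewrite inv -[6%N]/(3 * 2)%N exprM w3 expr1n mul1r.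
Qed.

(** The three multipliers form a group, so they are the cube roots of unity. If the coefficient of
    s^3 vanished all along the axis, F(v + s p) would be even in s there and the multiplier -1 would
    also occur. *)
Lemma card3_homology3 p : ev F p != 0 -> has_card (homol_sym 6 F p) 3 ->
  exists la, homology3 p la /\ exact_order3 p la.
Proof.
move=> Fp [la [lL linj lsur]].
pose B i := mult p (la i).
have Binj : injective B.
  by move=> i j E; apply: linj; apply: (homol_sym_uniq charK _ hF sF Fp (lL i) (lL j) E).
have B0 i : B i != 0 by case: (lL i).
(* Lagrange's argument: multiplication by [B i] permutes the three multipliers, hence preserves
   their product. *)
have Bcube i : B i ^+ 3 = 1.
  have /fin_all_exists[f Df] : forall j, exists k, B k = B i * B j.
    move=> j; have [Lc Ec] := homol_sym_comp (lL i) (lL j).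
    by have [k Dk] := lsur _ Lc; exists k; rewrite /B -Dk Ec.
  have finj : injective f.
    by move=> j k E; apply: Binj; apply: (mulfI (B0 i)); rewrite -!Df E.
  have : \prod_j B j = B i ^+ 3 * \prod_j B j.
    rewrite {1}(reindex_inj finj) /= (eq_bigr (fun j => B i * B j)) //.
    by rewrite big_split /= prodr_const card_ord.
  rewrite -{1}[\prod_j B j]mul1r => /mulIf <- //.
  by apply/prodf_neq0 => j _.
(* Otherwise X^3 - 1 would have four distinct roots. *)
have [i Bi] : exists i, B i = w.
  apply: NNPP => nw; have Bn i : B i != w by apply/eqP => E; apply: nw; exists i.
  pose rs := w :: [seq B i | i <- enum 'I_3].
  have : (size rs < size ('X^3 - 1 : {poly K})%R)%N.
    apply: max_poly_roots.
    - by rewrite -size_poly_gt0 size_XnsubC.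
    - apply/allP => x; rewrite inE => /orP[/eqP->|/mapP[i _ ->]];
        by rewrite /root !hornerE ?w3 ?Bcube subrr.
    rewrite /= map_inj_uniq // enum_uniq andbT; apply/mapP => -[i _ E].
    by have := Bn i; rewrite -E eqxx.
  by rewrite size_XnsubC //= size_map size_enum_ord.
have [_ inv] := lL i.
have gi : homology3 p (la i).
  split=> // [|v]; first by rewrite -Bi /B addrAC subrr add0r.
  by rewrite inv -/(B i) Bi -[6%N]/(3 * 2)%N exprM w3 expr1n mul1r.
exists (la i); split=> //; apply: NNPP => ng.
have c3 v : (v *m la i) 0 0 = 0 -> (lineP F v p)`_3 = 0.
  by move=> vl; apply/eqP; apply: contraT => c; case: ng; exists v.
have pla : (p *m la i) 0 0 = w - 1 by case: gi.
have wn : w - 1 != 0 by rewrite subr_eq0 w_neq1.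
have cj v j : (v *m la i) 0 0 = 0 -> (lineP F v p)`_j * w ^+ j = (lineP F v p)`_j.
  move=> vl; have := @lineP_mult K 6 F hF p (la i) v j (lL i) vl.
  by rewrite -/(B i) Bi -[6%N]/(3 * 2)%N exprM w3 expr1n mul1r.
have cz (c x : K) : x != 1 -> c * x = c -> c = 0.
  move=> x1 E; apply/eqP; have : c * (x - 1) = 0 by rewrite mulrBr E mulr1 subrr.
  by move/eqP; rewrite mulf_eq0 subr_eq0 (negPf x1) orbF.
(* Among the odd exponents, 1 and 5 are excluded by the symmetry of order 3, and 3 by the
   assumption. *)
have even v s : (v *m la i) 0 0 = 0 -> ev F (v - s *: p) = ev F (v + s *: p).
  move=> vl; rewrite -scaleNr -!horner_lineP !(horner_coef_wide _ (size_lineP v p hF)).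
  apply: eq_bigr => j _; case: (boolP (odd j)) => jo; last first.
    by rewrite exprNn -signr_odd (negPf jo) expr0 mul1r.
  suff -> : (lineP F v p)`_j = 0 by rewrite !mul0r.
  have := cj v j vl; case: j jo => -[|[|[|[|[|[|[|//]]]]]]] //= _ _.
  - by rewrite expr1; apply: cz; apply: w_neq1.
  - by rewrite c3.
  - rewrite -[5%N]/(3 + 2)%N exprD w3 mul1r; apply: cz; apply/eqP => w2.
    by have := w3; rewrite exprS w2 mulr1; apply/eqP/w_neq1.
(* The homology with the same axis and multiplier -1: its form takes the value -2 at p. *)
pose mu := (- 2%:R / (w - 1)) *: la i.
have pmu : (p *m mu) 0 0 = - 2%:R by rewrite -scalemxAr scale11 pla mulfVK.
have Lmu : homol_sym 6 F p mu.
  have bE : 1 + (p *m mu) 0 0 = -1 by rewrite pmu; ring.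
  split; rewrite bE ?oppr_eq0 ?oner_neq0 // => v.
  rewrite -signr_odd expr0 mul1r.
  pose s := (v *m la i) 0 0 / (w - 1); pose u := v - s *: p.
  have ul : (u *m la i) 0 0 = 0.
    rewrite /u -scaleNr mulmxDl -scalemxAl mxE scale11 pla /s mulNr mulfVK // subrr.
    by [].
  have Dv : v = u + s *: p by rewrite /u subrK.
  rewrite mul_homol -scalemxAr scale11 mulrAC -/s.
  rewrite (_ : - 2%:R * _ / _ = - s - s); last by rewrite /s; field.
  rewrite {1}Dv -addrA -scalerDl (_ : s + (- s - s) = - s); last by ring.
  by rewrite scaleNr even // -Dv.
have [j Dj] := lsur _ Lmu; have := Bcube j.
rewrite /B -Dj pmu => /eqP; rewrite -subr_eq0.
have -> : (1 - 2%:R) ^+ 3 - 1 = - 2%:R :> K by ring.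
by rewrite oppr_eq0 (negPf (natK0 1)).
Qed.

(** All homologies at p share the axis of la, so a nonzero coefficient of s^3 over it forces m^3 =
    m^6 for every multiplier m; and the multiplier determines the homology. *)
Lemma homology3_card3 p la : homology3 p la -> exact_order3 p la -> has_card (homol_sym 6 F p) 3.
Proof.
move=> g [v [vl c3]]; have Ll := homology3_sym g; have [Fp pla inv] := g.
have wn : w - 1 != 0 by rewrite subr_eq0 w_neq1.
have prop mu : homol_sym 6 F p mu -> mu = ((p *m mu) 0 0 / (w - 1)) *: la.
  move=> Lmu; have := homol_sym_proportional charK d6 hF sF Fp Ll Lmu.
  rewrite pla addrAC subrr add0r => E.
  by rewrite mulrC -scalerA E scalerA mulVf // scale1r.
have cube mu : homol_sym 6 F p mu -> mult p mu ^+ 3 = 1.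
  move=> Lmu; have vmu : (v *m mu) 0 0 = 0.
    by rewrite (prop _ Lmu) -scalemxAr scale11 vl mulr0.
  have := @lineP_mult K 6 F hF p mu v 3 Lmu vmu; rewrite [RHS]mulrC => /(mulfI c3).
  have [b0 _] := Lmu; rewrite -[6%N]/(3 + 3)%N exprD -{1}[_ ^+ 3]mulr1 => /mulfI <- //.
  by rewrite expf_neq0.
have [Ll2 El2] := homol_sym_comp Ll Ll; set la2 := _ + _ in Ll2 El2.
have E1 : mult p la = w by rewrite pla subrKC.
have E0 : mult p (0 : 'cV[K]_3) = 1 by rewrite mulmx0 mxE addr0.
rewrite E1 -expr2 in El2.
pose t (i : 'I_3) := if val i is n.+1 then if n is _.+1 then la2 else la else 0.
have w2n1 : w ^+ 2 != 1.
  by apply/eqP => w2; have := w3; rewrite exprS w2 mulr1; apply/eqP/w_neq1.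
have w2nw : w ^+ 2 != w.
  by apply/eqP => w2; have := w3; rewrite exprS w2 -expr2; apply/eqP.
exists t; split.
- by case=> [[|[|[|//]]] ?]; rewrite /t //=; apply: homol_sym0.
- have tn (i j : 'I_3) : t i = t j -> mult p (t i) = mult p (t j) by move->.
  move=> i j /tn; case: i => [[|[|[|//]]] ?]; case: j => [[|[|[|//]]] ?];
    rewrite /t /= ?E0 ?E1 ?El2 => E; apply: val_inj => //=; exfalso; move/eqP: E;
    by rewrite ?(eq_sym 1) ?(eq_sym w (w ^+ 2)) ?(negPf w_neq1) ?(negPf w2n1) ?(negPf w2nw).
move=> mu Lmu; case: (cube_root1 (cube mu Lmu)) => E.
- by exists o0; apply: (homol_sym_uniq charK d6 hF sF Fp Lmu); [apply: homol_sym0|rewrite E E0].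
- by exists o1; apply: (homol_sym_uniq charK d6 hF sF Fp Lmu Ll); rewrite E E1.
- by exists o2; apply: (homol_sym_uniq charK d6 hF sF Fp Lmu Ll2); rewrite E El2.
Qed.

Lemma delta_pointP (P : point K) p : val P = <[p]>%VS -> p != 0 ->
  [/\ ~ vanishes_at F P, quasi_galois F P & card_G F P 3] <->
  exists la, homology3 p la /\ exact_order3 p la.
Proof.
move=> DP p0; split=> [[vP _ cG]|[la [g ge]]].
  have Fp : ev F p != 0 by apply/eqP => Fp; apply: vP; apply/(vanishes_atP hF DP).
  by apply: card3_homology3 => //; apply/(card_G_homol_sym charK d6 hF sF Fp DP).
have [Fp _ _] := g.
have cG : card_G F P 3 by apply/(card_G_homol_sym charK d6 hF sF Fp DP)/(homology3_card3 g ge).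
split=> //; first by move/(vanishes_atP hF DP)/eqP; apply/negP.
exact: card3_quasi_galois cG.
Qed.

End Sextic.

(** * The Hessian and the bound 12 *)

Section Hessian.
Variable K : closedFieldType.
Notation MP := {mpoly K[3]}.
Notation rV3 := 'rV[K]_3.
Implicit Types (F G : MP) (u v p q : rV3) (M : 'M[K]_3) (la mu : 'cV[K]_3).
Local Notation ev G v := (meval (fun_of_matrix v 0) G).
Hypothesis charK : [pchar K] =i pred0.

Lemma det3 (R : comNzRingType) (A : 'M[R]_3) : \det A =
  A o0 o0 * (A o1 o1 * A o2 o2 - A o1 o2 * A o2 o1)
  - A o0 o1 * (A o1 o0 * A o2 o2 - A o1 o2 * A o2 o0)
  + A o0 o2 * (A o1 o0 * A o2 o1 - A o1 o1 * A o2 o0).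
Proof.
have d2 (B : 'M[R]_2) : \det B = B 0 0 * B 1 1 - B 0 1 * B 1 0.
  rewrite (expand_det_row _ 0) !big_ord_recl big_ord0 addr0 /cofactor !det_mx11 !mxE /=.
  rewrite expr0 expr1 mul1r mulN1r mulrN; congr (B _ _ * B _ _ - B _ _ * B _ _); exact: val_inj.
rewrite (expand_det_row _ o0) big3 /cofactor !d2 !mxE /= !addn0 expr0 expr1 -signr_odd /= expr0.
rewrite !mul1r mulN1r mulrN.
have E i j k l (a b c d : 'I_3) : val i = val a -> val j = val b -> val k = val c -> val l = val d ->
  A i j * A k l = A a b * A c d.
  by move=> /val_inj-> /val_inj-> /val_inj-> /val_inj->.
congr (_ * (_ - _) - _ * (_ - _) + _ * (_ - _)); exact: E.
Qed.

Definition hess F : MP := \det (\matrix_(i, j) F^`M(i)^`M(j)).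
Definition hessm F v : 'M[K]_3 := \matrix_(i, j) ev F^`M(i)^`M(j) v.

Lemma ev_hess F v : ev (hess F) v = \det (hessm F v).
Proof.
rewrite -det_map_mx; congr (\det _); apply/matrixP => i j; rewrite !mxE //.
Qed.

Lemma hess_homog F d : F \is d.+2.-homog -> hess F \is (d + d + d).-homog.
Proof.
move=> hF; have h i j : F^`M(i)^`M(j) \is d.-homog by rewrite !dhomog_mderiv.
by rewrite /hess det3 !mxE !(rpredB, rpredD) // -addnA dhomogM // rpredB // dhomogM.
Qed.

Lemma mderiv_ext G H : (forall v, ev G v = ev H v) ->
  forall i v, ev G^`M(i) v = ev H^`M(i) v.
Proof.
move=> GH i v; pose e : rV3 := delta_mx 0 i.
have E (L : MP) : ev L^`M(i) v = (lineP L v e)`_1.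
  rewrite coef1_lineP (bigD1 i) //= big1 => [|j ji]; last by rewrite mxE (negPf ji) mul0r.
  by rewrite mxE !eqxx mul1r addr0.
rewrite !E; suff -> : lineP G v e = lineP H v e by [].
apply/eqP; rewrite -subr_eq0; apply/eqP/horner_eq0 => s.
by rewrite hornerD hornerN !horner_lineP GH subrr.
Qed.

Lemma mderiv_invariant M G : (forall v, ev G (v *m M) = ev G v) ->
  forall i v, ev G^`M(i) v = \sum_j M i j * ev G^`M(j) (v *m M).
Proof.
move=> h i v; rewrite -ev_mderiv_subm; apply: mderiv_ext => {}v.
by rewrite ev_subm h.
Qed.

Lemma hessm_subm M F v : hessm (subm M F) v = M *m hessm F (v *m M) *m M^T.
Proof.
apply/matrixP => i j; rewrite [LHS]mxE.
transitivity (\sum_k \sum_l M i k * (M j l * ev F^`M(k)^`M(l) (v *m M))).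
  rewrite mderiv_subm (raddf_sum (mderiv j)) (raddf_sum (meval (v 0))); apply: eq_bigr => k _ /=.
  by rewrite mderivZ mevalZ ev_mderiv_subm mulr_sumr.
rewrite exchange_big [RHS]mxE; apply: eq_bigr => l _ /=.
rewrite [(_ *m _) i l]mxE mulr_suml; apply: eq_bigr => k _.
by rewrite !mxE; ring.
Qed.

Lemma hess_subm M F v : ev (hess (subm M F)) v = (\det M) ^+ 2 * ev (hess F) (v *m M).
Proof. by rewrite !ev_hess hessm_subm !det_mulmx det_tr; ring. Qed.

Lemma hessm_ext F G v : (forall v, ev F v = ev G v) -> hessm F v = hessm G v.
Proof. by move=> FG; apply/matrixP => i j; rewrite !mxE; apply: mderiv_ext => u; apply: mderiv_ext. Qed.

Variable w : K.
Hypothesis Dw : w ^+ 2 + w + 1 = 0.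
Let w1 : w - 1 != 0.
Proof. by rewrite subr_eq0; apply: (w_neq1 charK Dw). Qed.

(** A point v of the axis is fixed by the homology T, so its Hessian matrix satisfies H = T H T^T.
    As p T = w p, first p H p^T = w^2 p H p^T vanishes, and then p H = w p H does. *)
Lemma hessm_axis F p la v : (p *m la) 0 0 = w - 1 ->
  (forall v, ev F (v *m homol la p) = ev F v) -> (v *m la) 0 0 = 0 ->
  p *m hessm F v = 0.
Proof.
move=> pla inv vl; set T := homol la p.
have vT : v *m T = v by rewrite mul_homol vl scale0r addr0.
have pT : p *m T = w *: p by rewrite homol_p pla subrKC.
set A := hessm F v.
have DA : A = T *m A *m T^T.
  rewrite /A -{2}vT -hessm_subm; apply: hessm_ext => u.
  by rewrite ev_subm inv.
have pAp : p *m A *m p^T = 0.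
  have : p *m A *m p^T = (w ^+ 2) *: (p *m A *m p^T).
    transitivity ((p *m T) *m A *m (p *m T)^T).
      by rewrite {1}DA trmx_mul !mulmxA.
    by rewrite pT linearZ /= -!scalemxAl -scalemxAr scalerA expr2.
  move/eqP; rewrite -subr_eq0 -{1}[p *m A *m p^T]scale1r -scalerBl scaler_eq0.
  have -> : 1 - w ^+ 2 = (w - 1) * w ^+ 2 by rewrite -{1}(w3 Dw); ring.
  by rewrite mulf_eq0 expf_eq0 (negPf (w_neq0 Dw)) (negPf w1) => /eqP.
have : p *m A = w *: (p *m A).
  rewrite {1}DA !mulmxA pT -!scalemxAl; congr (_ *: _).
  by rewrite /T /homol linearD /= trmx1 mulmxDr mulmx1 trmx_mul mulmxA pAp mul0mx addr0.
move/eqP; rewrite -subr_eq0 -{1}[p *m A]scale1r -scalerBl scaler_eq0 -opprB oppr_eq0 (negPf w1).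
by move/eqP.
Qed.

Lemma hess_axis F p la v : p != 0 -> (p *m la) 0 0 = w - 1 ->
  (forall v, ev F (v *m homol la p) = ev F v) -> (v *m la) 0 0 = 0 ->
  ev (hess F) v = 0.
Proof.
move=> p0 pla inv vl; rewrite ev_hess; apply/eqP; apply/det0P.
by exists p => //; apply: hessm_axis vl.
Qed.

(** Coordinates in which the center is (0:0:1) and the axis is Z = 0. The factor [homol D e]
    corrects the first two basis vectors by multiples of p and leaves the last one in place. *)
Lemma axis_basis p la : p != 0 -> (p *m la) 0 0 != 0 ->
  exists M, [/\ M \in unitmx, row o2 M = p & M *m la = (p *m la) 0 0 *: delta_mx o2 0].
Proof.
move=> p0 c0; have [M0 uM0 rM0] := row_basis p0.
set c := (p *m la) 0 0 in c0 *.
pose e : rV3 := \row_j h3 0 0 1 j.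
pose D : 'cV[K]_3 := delta_mx o2 0 - c^-1 *: (M0 *m la).
have eM : e *m M0 = p by rewrite -row_o2.
have ed : e *m delta_mx o2 0 = 1%:M :> 'M[K]_1.
  by apply/matrixP => i j; rewrite !ord1 -colE !mxE /h3 /=.
have eD : (e *m D) 0 0 = 0.
  rewrite /D mulmxBr -scalemxAr mulmxA eM ed mxE [X in _ + X]mxE scale11 -/c mulVf //.
  by rewrite mxE /= subrr.
have bE : 1 + (e *m D) 0 0 != 0 by rewrite eD addr0 oner_neq0.
exists (homol D e *m M0); split.
- by rewrite unitmx_mul uM0 andbT; have /mulmx1_unit[] := homol_inv bE.
- by rewrite row_o2 mulmxA -/e homol_p eD addr0 scale1r.
have ey : e *m (M0 *m la) = c%:M by rewrite mulmxA eM [LHS]mx11_scalar.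
rewrite -mulmxA /homol mulmxDl mul1mx -mulmxA ey mul_mx_scalar /D scalerBr scalerA mulfV //.
by rewrite scale1r addrC subrK.
Qed.

Lemma ev_add_prod G H u v : ev G u != 0 -> ev H v != 0 ->
  exists s, ev (G * H) (u + s *: (v - u)) != 0.
Proof.
move=> Gu Hv; have : lineP G u (v - u) * lineP H u (v - u) != 0.
  rewrite mulf_neq0 //.
    by apply: contraNneq Gu => E; rewrite -(coef0_lineP _ _ (v - u)) E coef0.
  apply: contraNneq Hv => E; have := horner_lineP H u (v - u) 1.
  by rewrite E horner0 scale1r addrC subrK => <-.
case/closed_nonrootP => s; rewrite /root hornerM !horner_lineP => h.
by exists s; rewrite mevalM.
Qed.

End Hessian.

(** * Nonvanishing of the Hessian, and counting lines inside a plane curve *)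

Section Bound.
Variable K : closedFieldType.
Notation MP := {mpoly K[3]}.
Notation rV3 := 'rV[K]_3.
Implicit Types (G : MP) (u v p q : rV3) (M : 'M[K]_3) (la mu : 'cV[K]_3).
Local Notation ev G v := (meval (fun_of_matrix v 0) G).
Hypothesis charK : [pchar K] =i pred0.
Variable w : K.
Hypothesis Dw : w ^+ 2 + w + 1 = 0.
Let w1 : w - 1 != 0.
Proof. by rewrite subr_eq0; apply: (w_neq1 charK Dw). Qed.

Lemma sub11 (A B : 'M[K]_1) : (A - B) 0 0 = A 0 0 - B 0 0.
Proof. by rewrite !mxE. Qed.

Definition ebase (k : 'I_3) : rV3 := delta_mx 0 k.

Lemma deriv_lineP_ebase G v k : (lineP G v (ebase k))^`() = lineP G^`M(k) v (ebase k).
Proof.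
rewrite deriv_lineP (bigD1 k) //= big1 => [|j jk]; last by rewrite mxE (negPf jk) mul0r.
by rewrite mxE !eqxx mul1r addr0.
Qed.

Lemma coef3_lineP G v k : ev G^`M(k)^`M(k)^`M(k) v = (lineP G v (ebase k))`_3 * 6%:R.
Proof.
rewrite -(coef0_lineP _ v (ebase k)) -!deriv_lineP_ebase !coef_deriv.
by rewrite mulr1n -!mulrnA mulr_natr.
Qed.

Section Normal.
Variable F : MP.
Hypotheses (hF : F \is 6.-homog) (sF : smooth_form F).
Variables (p : rV3) (la : 'cV[K]_3).
Hypotheses (g : homology3 w F p la) (ge : exact_order3 F p la).

(* Let Z = 0 be the axis.  On it, the Z-derivative of the Hessian is
   F_ZZZ (F_XX F_YY - F_XY^2); the first factor is not identically zero there, and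
   by Euler's identities neither is the second, at a point of the curve. *)
Lemma hess_neq0 : exists v, ev (hess F) v != 0.
Proof.
have [Fp pla inv] := g; have p0 := base_point_neq0 (isT : (1 < 6)%N) hF Fp.
have plan : (p *m la) 0 0 != 0 by rewrite pla.
have [M [uM rM Mla]] := axis_basis p0 plan.
pose F' := subm M F; pose e := ebase o2.
have hF' : F' \is 6.-homog by apply: subm_homog.
have sF' : smooth_form F' by apply: smooth_subm.
have eM : e *m M = p by rewrite -rowE.
pose la' := M *m la.
have ela : (e *m la') 0 0 = w - 1 by rewrite /la' mulmxA eM.
have inv' v : ev F' (v *m homol la' e) = ev F' v.
  rewrite !ev_subm -mulmxA.
  suff -> : homol la' e *m M = M *m homol la p by rewrite mulmxA inv.
  by rewrite /homol mulmxDl mulmxDr mul1mx mulmx1 /la' -!mulmxA eM.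
have vla v : (v *m la') 0 0 = (w - 1) * v 0 o2.
  by rewrite /la' Mla pla -scalemxAr scale11 -colE mxE.
have H0 v j : v 0 o2 = 0 -> ev F'^`M(o2)^`M(j) v = 0.
  move=> v2; have vl : (v *m la') 0 0 = 0 by rewrite vla v2 mulr0.
  have /rowP/(_ j) := hessm_axis charK Dw ela inv' vl.
  by rewrite -rowE !mxE.
have H0' v j : v 0 o2 = 0 -> ev F'^`M(j)^`M(o2) v = 0.
  by move=> v2; rewrite mderiv_comm H0.
have hF1 i : F'^`M(i) \is 5.-homog by apply: dhomog_mderiv.
have F2 v : v 0 o2 = 0 -> ev F'^`M(o2) v = 0.
  move=> v2; have := euler_eval (v 0) (hF1 o2); rewrite !H0 // !mulr0 !addr0 => /esym/eqP.
  by rewrite mulf_eq0 (negPf (natK0 charK 4)) => /eqP.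
apply: NNPP => nH.
have Z v : ev (hess F') v = 0.
  rewrite hess_subm; have [->|h] := eqVneq (ev (hess F) (v *m M)) 0; first by rewrite mulr0.
  by case: nH; exists (v *m M).
pose G := F'^`M(o2)^`M(o2)^`M(o2).
pose D2 := F'^`M(o0)^`M(o0) * F'^`M(o1)^`M(o1) - F'^`M(o0)^`M(o1) * F'^`M(o1)^`M(o0).
have GD v : v 0 o2 = 0 -> ev (G * D2) v = 0.
  move=> v2.
  have : ev (hess F')^`M(o2) v = 0.
    by rewrite (mderiv_ext (H := 0)) ?mderiv0 ?meval0 // => u; rewrite Z meval0.
  rewrite /hess det3 !mxE !(mderivD, mderivN, mderivM) !(mevalD, mevalN, mevalM).
  rewrite !H0 // !H0' // !(mul0r, mulr0, add0r, addr0, oppr0) => E.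
  by rewrite /G /D2 ?(mevalD, mevalN, mevalM) -E; ring.
pose r0 := ebase o0; pose r1 := ebase o1.
have r01 s : (r0 + s *: r1) 0 o2 = 0 by rewrite !mxE /= mulr0 addr0.
(* The restriction of F' to the axis either has a root or is constant; in the latter case its
   coefficient of s^6, which is F'(r1), is zero. *)
have [R [R0 R2 FR]] : exists R : rV3, [/\ R != 0, R 0 o2 = 0 & ev F' R = 0].
  have [s1|/closed_rootP[s]] := eqVneq (size (lineP F' r0 r1)) 1%N; last first.
    rewrite /root horner_lineP => /eqP Fs; exists (r0 + s *: r1); split=> //.
    by apply/rV0Pn; exists o0; rewrite !mxE /= mulr0 addr0 oner_neq0.
  exists r1; split; last by rewrite -(lead_lineP r0 _ hF') nth_default // s1.
    by apply/rV0Pn; exists o1; rewrite mxE oner_neq0.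
  by rewrite mxE.
have D2R : ev D2 R != 0.
  have [i Fi] := (smooth_formP F').1 sF' R R0 FR.
  have e0 := euler_eval (R 0) (hF1 o0); have e1 := euler_eval (R 0) (hF1 o1).
  have e2 := euler_eval (R 0) hF'.
  rewrite FR R2 !mul0r !addr0 mulr0 in e0 e1 e2.
  have E01 : ev F'^`M(o1)^`M(o0) R = ev F'^`M(o0)^`M(o1) R by rewrite mderiv_comm.
  rewrite /D2 mevalB !mevalM E01; rewrite E01 in e1.
  move: e0 e1 e2 Fi; set x := R 0 o0; set y := R 0 o1.
  set a := ev F'^`M(o0)^`M(o0) R; set b := ev F'^`M(o0)^`M(o1) R.
  set c := ev F'^`M(o1)^`M(o1) R; set f0 := ev F'^`M(o0) R; set f1 := ev F'^`M(o1) R.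
  move=> e0 e1 e2 Fi.
  have n5 : (5%:R : K) != 0 := natK0 charK 4.
  (* A combination of the Euler relations at R for F', F'_X and F'_Y, the last two of degree 5. A
     vanishing minor would make all first derivatives zero at R, against smoothness. *)
  have Ey : y ^+ 2 * (a * c - b * b) = - (5%:R * f0) ^+ 2.
    transitivity (- (5%:R * f0) ^+ 2 + 5%:R * a * (x * f0 + y * f1)
      - (y * b + 5%:R * f0) * (x * a + y * b - 5%:R * f0) + a * y * (x * b + y * c - 5%:R * f1)).
      by ring.
    by rewrite e0 e1 e2 !subrr !mulr0 subr0 !addr0.
  have Ex : x ^+ 2 * (a * c - b * b) = - (5%:R * f1) ^+ 2.
    transitivity (- (5%:R * f1) ^+ 2 + 5%:R * c * (x * f0 + y * f1)
      - (x * b + 5%:R * f1) * (x * b + y * c - 5%:R * f1) + c * x * (x * a + y * b - 5%:R * f0)).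
      by ring.
    by rewrite e0 e1 e2 !subrr !mulr0 subr0 !addr0.
  apply: contraNneq Fi => D0; move: Ex Ey; rewrite D0 !mulr0.
  move=> /esym/eqP; rewrite oppr_eq0 expf_eq0 mulf_eq0 (negPf n5) => /eqP f10.
  move=> /esym/eqP; rewrite oppr_eq0 expf_eq0 mulf_eq0 (negPf n5) => /eqP f00.
  by case: (ord3P i) => ->; rewrite -/f0 -/f1 ?f00 ?f10 ?F2.
have [v [vl c3]] := ge; pose v1 := v *m invmx M.
have v1M : v1 *m M = v by rewrite mulmxKV.
have v12 : v1 0 o2 = 0.
  have := vla v1; rewrite /la' mulmxA v1M vl => /esym/eqP.
  by rewrite mulf_eq0 (negPf w1) => /eqP.
have Gv1 : ev G v1 != 0.
  rewrite /G coef3_lineP mulf_neq0 ?(natK0 charK 5) //.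
  suff -> : lineP F' v1 (ebase o2) = lineP F v p by [].
  apply/eqP; rewrite -subr_eq0; apply/eqP/horner_eq0 => s.
  by rewrite hornerD hornerN !horner_lineP ev_subm mulmxDl v1M -scalemxAl eM subrr.
have [s] := ev_add_prod Gv1 D2R; rewrite GD ?eqxx //.
have -> : (v1 + s *: (R - v1)) 0 o2 = v1 0 o2 + s * (R 0 o2 - v1 0 o2) by rewrite !mxE.
by rewrite R2 v12 subrr mulr0 addr0.
Qed.

End Normal.

(** The two homologies have the same form la and the same multiplier, so they differ by an elation
    with vector p - q. *)
Lemma same_axis (F : MP) p q la : F \is 6.-homog -> smooth_form F ->
  homology3 w F p la -> homology3 w F q la -> p = q.
Proof.
move=> hF sF [Fp pla pinv] [_ qla qinv].
have pq : ((p - q) *m la) 0 0 = 0.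
  rewrite mulmxBl mxE [X in _ + X]mxE pla qla subrr.
  by [].
have h v : ev F (v *m homol la (p - q)) = ev F v.
  rewrite -[LHS]qinv -pinv -mulmxA; congr (meval ((_ *m _) 0) F).
  rewrite /homol mulmxDl mul1mx mulmxDr mulmx1.
  have -> : la *m (p - q) *m (la *m q) = 0.
    rewrite -mulmxA [(p - q) *m _]mulmxA [(p - q) *m la]mx11_scalar pq.
    by rewrite (_ : 0%:M = 0) ?mul0mx ?mulmx0 //; apply/matrixP => i j; rewrite !mxE mul0rn.
  by rewrite addr0 -addrA [la *m q + _]addrC -mulmxDr subrK.
have [la0|/eqP] := no_elation charK (isT : (1 < 6)%N) hF sF pq h; last first.
  by rewrite subr_eq0 => /eqP.
by move: w1; rewrite -pla la0 mulmx0 mxE eqxx.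
Qed.

Lemma homology3_scale (F : MP) p la c : F \is 6.-homog -> c != 0 -> homology3 w F p la ->
  homology3 w F (c *: p) (c^-1 *: la).
Proof.
move=> hF c0 [Fp pla pinv]; split.
- by rewrite (ev_scale _ _ hF) mulf_neq0 ?expf_neq0.
- by rewrite -scalemxAl -scalemxAr scalerA mulfV // scale1r.
move=> v; rewrite -[RHS]pinv /homol -scalemxAl -scalemxAr scalerA mulVf // scale1r.
by [].
Qed.

Lemma avoid_zeros (cs : seq 'cV[K]_3) : (forall c, c \in cs -> c != 0) ->
  exists u, forall c, c \in cs -> (u *m c) 0 0 != 0.
Proof.
elim: cs => [|c cs IHcs] h; first by exists 0.
have [|u Hu] := IHcs; first by move=> c' c'cs; apply: h; rewrite inE c'cs orbT.
have /cV0Pn[k ck] := h c (mem_head _ _).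
pose P := (((u *m c) 0 0)%:P + (c k 0)%:P * 'X) *
   \prod_(c' <- cs) (((u *m c') 0 0)%:P + (c' k 0)%:P * 'X).
have P0 : P != 0.
  rewrite mulf_neq0 //.
    apply/eqP => /(congr1 (fun q : {poly K} => q`_1)).
    by rewrite coefD coefC coefCM coefX /= mulr1 add0r coef0 => /eqP; apply/negP.
  rewrite prodf_seq_neq0; apply/allP => c' c'cs /=.
  apply/eqP => /(congr1 (fun q : {poly K} => q`_0)).
  by rewrite coefD coefC coefCM coefX /= mulr0 addr0 coef0 => /eqP; apply/negP/Hu.
have [s] := closed_nonrootP _ P0; rewrite /root hornerM mulf_eq0 negb_or => /andP[s0 s1].
have E c' : ((u + s *: delta_mx 0 k) *m c') 0 0 = (u *m c') 0 0 + c' k 0 * s.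
  by rewrite mulmxDl -scalemxAl -rowE mxE [X in _ + X]mxE [row _ _ _ _]mxE mulrC.
exists (u + s *: delta_mx 0 k) => c'; rewrite inE E => /orP[/eqP->|c'cs].
  by move: s0; rewrite !hornerE.
move: s1; rewrite horner_prod prodf_seq_neq0 => /allP/(_ c' c'cs) /=.
by rewrite !hornerE.
Qed.

(** A generic line through a point v0 with H(v0) <> 0 meets the lines la_i = 0 in distinct points,
    all of them roots of the restriction of H, which has degree at most d. *)
Lemma axes_bound (H : MP) d (I : finType) (la : I -> 'cV[K]_3) :
  H \is d.-homog -> (exists v, ev H v != 0) ->
  (forall i v, (v *m la i) 0 0 = 0 -> ev H v = 0) ->
  (forall i j c, la i = c *: la j -> i = j) -> (forall i, la i != 0) ->
  (#|I| <= d)%N.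
Proof.
move=> hH [v0 Hv0] Hla linj la0.
have lv0 i : (v0 *m la i) 0 0 != 0 by apply: contraNneq Hv0 => /Hla->.
(* Directions u to avoid: those of lines through v0 parallel to some plane la_i = 0, and those for
   which two of the planes are met at the same parameter. *)
pose cs := [seq la i | i <- enum I] ++
  [seq (v0 *m la ij.1) 0 0 *: la ij.2 - (v0 *m la ij.2) 0 0 *: la ij.1
    | ij <- enum {: I * I} & ij.1 != ij.2].
have [|u Hu] := @avoid_zeros cs.
  move=> c; rewrite mem_cat => /orP[/mapP[i _ ->]//|/mapP[[i j]]].
  rewrite mem_filter /= => /andP[ij _] ->; apply: contraNneq ij => /eqP.
  rewrite subr_eq0 => /eqP E; apply/eqP; apply: esym; apply: (linj j i (((v0 *m la i) 0 0)^-1 * (v0 *m la j) 0 0)).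
  by rewrite -scalerA -E scalerA mulVf // scale1r.
have lu i : (u *m la i) 0 0 != 0.
  by apply: Hu; rewrite mem_cat map_f // mem_enum.
have lu2 i j : i != j -> (v0 *m la i) 0 0 * (u *m la j) 0 0 != (v0 *m la j) 0 0 * (u *m la i) 0 0.
  move=> ij; have := Hu ((v0 *m la i) 0 0 *: la j - (v0 *m la j) 0 0 *: la i).
  rewrite mulmxBr -!scalemxAr sub11 !scale11 subr_eq0; apply.
  rewrite mem_cat; apply/orP; right; apply/mapP; exists (i, j) => //.
  by rewrite mem_filter /= ij mem_enum.
pose rt i := - ((v0 *m la i) 0 0 / (u *m la i) 0 0).
have rinj : injective rt.
  move=> i j /oppr_inj E; apply/eqP; apply: contraT => ij.
  case/eqP: (lu2 i j ij); move/(congr1 (fun x => x * ((u *m la i) 0 0 * (u *m la j) 0 0))): E.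
  by rewrite mulrA divfK // mulrCA divfK // => ->; rewrite mulrC.
have q0 : lineP H v0 u != 0.
  by apply: contraNneq Hv0 => E; rewrite -(coef0_lineP _ _ u) E coef0.
have : (size [seq rt i | i <- enum I] < size (lineP H v0 u))%N.
  apply: max_poly_roots => //; last by rewrite map_inj_uniq ?enum_uniq.
  apply/allP => _ /mapP[i _ ->]; rewrite /root horner_lineP (Hla i) //.
  rewrite mulmxDl -scalemxAl mxE [X in _ + X]mxE /rt mulNr divfK ?subrr //.
by rewrite size_map -cardE => /leq_trans/(_ (size_lineP v0 u hH)); rewrite ltnS.
Qed.

End Bound.

(** An injective family in S that misses an element of S can be extended; the bound N makes this
    stop, at a family that enumerates S. *)
Lemma bounded_has_card (T : Type) (S : T -> Prop) N :
  (forall n (t : 'I_n -> T), injective t -> (forall i, S (t i)) -> (n <= N)%N) ->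
  exists2 m, has_card S m & (m <= N)%N.
Proof.
move=> bnd; pose Q n := exists2 t : 'I_n -> T, injective t & forall i, S (t i).
have Q0 : Q 0%N.
  have t : 'I_0 -> T by case.
  by exists t => -[].
have step k n : (N - n = k)%N -> Q n -> exists2 m, has_card S m & (m <= N)%N.
  elim: k n => [|k IHk] n; last first.
    move=> Nn [t tinj tS]; have [[x [Sx nx]]|H] :=
      classic (exists x, S x /\ forall i, x <> t i); last first.
      exists n; last exact: bnd tinj tS.
      exists t; split=> // x Sx; apply: NNPP => nx; apply: H; exists x; split=> // i E.
      by apply: nx; exists i.
    apply: (IHk n.+1); first by lia.
    exists (fun i => if unlift ord0 i is Some j then t j else x) => [i j|i].
      case: unliftP => [i' ->|->]; case: unliftP => [j' ->|->] //.
      - by move/tinj->.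
      - by move/esym/nx.
      by move/nx.
    by case: unliftP.
  move=> Nn [t tinj tS]; exists n; last exact: bnd tinj tS.
  exists t; split=> // x Sx; apply: NNPP => nx.
  have := bnd n.+1 (fun i => if unlift ord0 i is Some j then t j else x).
  have -> : (n.+1 <= N)%N = false by lia.
  have H : forall i, x <> t i by move=> i E; apply: nx; exists i.
  move=> B; suff: false by []; apply: B => [i j|i].
    case: unliftP => [i' ->|->]; case: unliftP => [j' ->|->] //.
    - by move/tinj->.
    - by move/esym/H.
    by move/H.
  by case: unliftP.
exact: step erefl Q0.
Qed.

(** * From the counted points to homologies of order 3, and the bound *)

Section Counting.
Variable K : closedFieldType.
Notation MP := {mpoly K[3]}.
Notation rV3 := 'rV[K]_3.
Implicit Types (G : MP) (u v p q : rV3) (M : 'M[K]_3) (la mu : 'cV[K]_3).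
Local Notation ev G v := (meval (fun_of_matrix v 0) G).
Hypothesis charK : [pchar K] =i pred0.
Variable w : K.
Hypothesis Dw : w ^+ 2 + w + 1 = 0.

Lemma smooth_plane_curveP d (F : MP) : (0 < d)%N -> smooth_plane_curve d F ->
  F \is d.-homog /\ smooth_form F.
Proof.
case: d => // d _ [_ hF sF]; split=> //; apply/smooth_formP => v v0 Fv.
have [|i Fi] := sF (pt v0); first exact/(vanishes_atP (P := pt v0) hF erefl).
exists i; apply/eqP => Fiv; apply: Fi.
exact/(vanishes_atP (P := pt v0) (dhomog_mderiv i hF) erefl).
Qed.

Definition delta3 (F : MP) (P : point K) :=
  [/\ ~ vanishes_at F P, quasi_galois F P & card_G F P 3].

Lemma point_eq (P Q : point K) p q : val P = <[p]>%VS -> val Q = <[q]>%VS ->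
  (exists2 c, c != 0 & p = c *: q) -> P = Q.
Proof.
by move=> DP DQ [c c0 Dp]; apply: val_inj; rewrite DP DQ Dp line_scale.
Qed.

Variable F : MP.
Hypotheses (hF : F \is 6.-homog) (sF : smooth_form F).

Lemma delta3_frames n (t : 'I_n -> point K) : (forall i, delta3 F (t i)) ->
  exists (p : 'I_n -> rV3) (la : 'I_n -> 'cV[K]_3), forall i, [/\ val (t i) = <[p i]>%VS, p i != 0, homology3 w F (p i) (la i) & exact_order3 F (p i) (la i)].
Proof.
move=> tS; suff /fin_all_exists[f Hf] : forall i, exists pl : rV3 * 'cV[K]_3,
    [/\ val (t i) = <[pl.1]>%VS, pl.1 != 0, homology3 w F pl.1 pl.2 & exact_order3 F pl.1 pl.2].
  by exists (fun i => (f i).1), (fun i => (f i).2).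
move=> i; have [p p0 Dp] := point_gen (t i).
by have [la [g ge]] := (delta_pointP charK Dw hF sF Dp p0).1 (tS i); exists (p, la).
Qed.

Lemma axes_independent n (t : 'I_n -> point K) (p : 'I_n -> rV3) (la : 'I_n -> 'cV[K]_3) : injective t ->
  (forall i, [/\ val (t i) = <[p i]>%VS, p i != 0, homology3 w F (p i) (la i) & exact_order3 F (p i) (la i)]) ->
  (forall i j c, la i = c *: la j -> i = j) /\ forall i, la i != 0.
Proof.
move=> tinj H.
have la0 i : la i != 0.
  have [_ _ [_ pla _] _] := H i; apply: contraNneq (w_neq1 charK Dw) => la0.
  by rewrite -subr_eq0 -pla la0 mulmx0 mxE.
split=> // i j c E; have c0 : c != 0.
  by apply: contraNneq (la0 i) => c0; rewrite E c0 scale0r.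
have [Di pi0 gi _] := H i; have [Dj pj0 gj _] := H j; apply: tinj.
apply: (point_eq Di Dj); exists c^-1; first by rewrite invr_eq0.
have c'0 : c^-1 != 0 by rewrite invr_eq0.
apply: (same_axis charK Dw hF sF gi); rewrite E.
by have := homology3_scale hF c'0 gj; rewrite invrK.
Qed.

Lemma delta3_bound n (t : 'I_n -> point K) : injective t -> (forall i, delta3 F (t i)) ->
  (n <= 12)%N.
Proof.
move=> tinj tS; have [p [la H]] := delta3_frames tS.
have [linj la0] := axes_independent tinj H.
case: n t tinj tS p la H linj la0 => // n t tinj tS p la H linj la0.
have hH : hess F \is 12.-homog by apply: (hess_homog (d := 4)).
have := @axes_bound K (hess F) 12 'I_n.+1 la hH _ _ linj la0; rewrite card_ord; apply.
  by have [_ _ g ge] := H ord0; apply: hess_neq0 g ge.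
move=> i v vl; have [_ p0 [_ pla pinv] _] := H i.
exact: (hess_axis charK Dw p0 pla pinv vl).
Qed.

Lemma delta3_card : exists2 m, delta'_eq F 3 m & (m <= 12)%N.
Proof. by apply: bounded_has_card => n t; apply: delta3_bound. Qed.

End Counting.

(** * Forms in the cubes of the coordinates *)

(* The cubic h with hess F = 27 XYZ h(X^3, Y^3, Z^3), see [hess_sextic]. *)
Definition hq (R : comNzRingType) (e1 e2 e3 a b c u v w : R) : R :=
  let m11 := 10%:R * e1 * u + 2%:R * a * v + 2%:R * b * w in
  let m22 := 10%:R * e2 * v + 2%:R * a * u + 2%:R * c * w in
  let m33 := 10%:R * e3 * w + 2%:R * b * u + 2%:R * c * v in
  m11 * (m22 * m33 - 3%:R * c * w * (3%:R * c * v))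
  - 3%:R * a * v * (3%:R * a * u * m33 - 3%:R * c * w * (3%:R * b * u))
  + 3%:R * b * w * (3%:R * a * u * (3%:R * c * v) - m22 * (3%:R * b * u)).

Lemma hq_swap23 (R : comNzRingType) (e1 e2 e3 a b c u v w : R) :
  hq e1 e3 e2 b a c u w v = hq e1 e2 e3 a b c u v w.
Proof. by rewrite /hq; ring. Qed.

Lemma hq_swap12 (R : comNzRingType) (e1 e2 e3 a b c u v w : R) :
  hq e2 e1 e3 a c b v u w = hq e1 e2 e3 a b c u v w.
Proof. by rewrite /hq; ring. Qed.

Section HessianCubic.
Variable K : closedFieldType.
Hypothesis charK : [pchar K] =i pred0.

Let nat0 n : (n.+1%:R : K) != 0.
Proof. exact: natK0. Qed.

(** This excludes axes of the form al X + be Y = 0: such a line contains (x:y:z) for a fixed ratio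
    x:y and every z, so h(U, V, W) vanishes identically in W. *)
Lemma mixed_zero (e1 e2 e3 a b c U V : K) : e1 != 0 -> e2 != 0 -> e3 != 0 ->
  U != 0 -> V != 0 -> (forall z, z != 0 -> hq e1 e2 e3 a b c U V (z ^+ 3) = 0) ->
  b = 0 /\ c = 0.
Proof.
move=> e10 e20 e30 U0 V0 h.
(* At W = 0 the entries [m11], [m22], [m33] of [hq] become [al], [be], [ga]; then ga n0, h1, h2 and
   h3 are the coefficients of 1, W, W^2 and W^3. *)
pose al := 10%:R * e1 * U + 2%:R * a * V; pose be := 10%:R * e2 * V + 2%:R * a * U.
pose ga := 2%:R * b * U + 2%:R * c * V.
pose n0 := al * be - 9%:R * a ^+ 2 * U * V; pose n1 := 2%:R * c * al + 2%:R * b * be.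
pose h1 := ga * n1 + 10%:R * e3 * n0 - 9%:R * c ^+ 2 * V * al
  + 54%:R * a * b * c * U * V - 9%:R * b ^+ 2 * U * be.
pose h2 := ga * (4%:R * b * c) + 10%:R * e3 * n1 - 18%:R * b * c ^+ 2 * V - 18%:R * b ^+ 2 * c * U.
pose h3 := 40%:R * b * c * e3.
have : (ga * n0)%:P + h1%:P * 'X^3 + h2%:P * 'X^6 + h3%:P * 'X^9 = 0.
  apply: (@horner_generic_eq0 _ 'X); first by rewrite polyX_eq0.
  move=> z; rewrite hornerX => z0; rewrite -[RHS](h z z0) !hornerE /= /hq /h1 /h2 /h3 /n1 /n0 /ga /be /al.
  ring.
move=> P0.
have E0 : ga * n0 = 0.
  have := congr1 (fun p : {poly K} => p`_0) P0.
  by rewrite !coefD !coefCM !coefXn coefC coef0 /= !mulr0 !addr0.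
have E2 : h2 = 0.
  have := congr1 (fun p : {poly K} => p`_6) P0.
  by rewrite !coefD !coefCM !coefXn coefC coef0 /= !mulr0 !addr0 mulr1 add0r.
have E3 : h3 = 0.
  have := congr1 (fun p : {poly K} => p`_9) P0.
  by rewrite !coefD !coefCM !coefXn coefC coef0 /= !mulr0 !addr0 mulr1 add0r.
have a0 : ga != 0 -> al = 0 \/ be = 0 -> a = 0.
  move=> ga0 alb; move/eqP: E0; rewrite mulf_eq0 (negPf ga0) /= /n0.
  have -> : al * be = 0 by case: alb => ->; rewrite ?mul0r ?mulr0.
  rewrite sub0r oppr_eq0 !mulf_eq0 (negPf (nat0 8)) (negPf U0) (negPf V0) !orbF /=.
  by rewrite orbb => /eqP.
move: E3; rewrite /h3 => /eqP; rewrite !mulf_eq0 (negPf (nat0 39)) (negPf e30) orbF /=.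
case/orP => /eqP z; split=> //; apply/eqP; apply: contraT => y.
- have E : al = 0.
    apply/eqP; have : 20%:R * e3 * c * al == 0.
      by rewrite -E2 /h2 /n1 z; apply/eqP; ring.
    by rewrite !mulf_eq0 (negPf (nat0 19)) (negPf e30) (negPf y).
  have g0 : ga != 0 by rewrite /ga z mulr0 mul0r add0r !mulf_neq0.
  have A0 := a0 g0 (or_introl E); move: E; rewrite /al A0 mulr0 mul0r addr0 => /eqP.
  by rewrite !mulf_eq0 (negPf (nat0 9)) (negPf e10) (negPf U0).
have E : be = 0.
  apply/eqP; have : 20%:R * e3 * b * be == 0.
    by rewrite -E2 /h2 /n1 z; apply/eqP; ring.
  by rewrite !mulf_eq0 (negPf (nat0 19)) (negPf e30) (negPf y).
have g0 : ga != 0 by rewrite /ga z mulr0 mul0r addr0 !mulf_neq0.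
have A0 := a0 g0 (or_intror E); move: E; rewrite /be A0 mulr0 mul0r addr0 => /eqP.
by rewrite !mulf_eq0 (negPf (nat0 9)) (negPf e20) (negPf V0).
Qed.

(* Only the coefficients of 1, t and t^2 are used: modulo t^3 the polynomial is
   hq(1, 0, -(1 + t)^3). *)
Lemma flex_triangle (e1 e2 e3 a b c : K) : e1 != 0 -> e3 != 0 ->
  (forall t, t != 0 -> t != -1 -> hq e1 e2 e3 a b c 1 (t ^+ 3) (- (1 + t) ^+ 3) = 0) ->
  a = c /\ (c = 0 \/ e1 = e3 /\ b ^+ 2 + 8%:R * b * e3 - 20%:R * e1 * e3 = 0).
Proof.
move=> e10 e30 h.
pose s : {poly K} := 3%:R%:P + 3%:R%:P * 'X + 'X^2.
(* At V = 0, hq is m22 (m11 m33 - 9 b^2 W). With W = -1 - T, T = t s, the factors are B0 - 2 c T and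
   N + L T + Q T^2, with product k0 + k1 T + k2 T^2 + k3 T^3. Since T = 3 t + 3 t^2 + t^3, the
   coefficients of 1, t, t^2 are k0, 3 k1, 3 k1 + 9 k2; [r] collects what V contributes. *)
pose A0 := 10%:R * e1 - 2%:R * b; pose B0 := 2%:R * a - 2%:R * c; pose C0 := 2%:R * b - 10%:R * e3.
pose N := A0 * C0 + 9%:R * b ^+ 2.
pose L := A0 * (- (10%:R * e3)) - 2%:R * b * C0 + 9%:R * b ^+ 2.
pose Q := 20%:R * b * e3.
pose k0 := B0 * N; pose k1 := - (2%:R * c) * N + B0 * L; pose k2 := - (2%:R * c) * L + B0 * Q.
pose k3 := - (2%:R * c) * Q.
pose w : {poly K} := - (1 + 'X) ^+ 3.
pose Ap := 10%:R%:P * e1%:P + 2%:R%:P * b%:P * w.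
pose Bp := 2%:R%:P * a%:P + 2%:R%:P * c%:P * w.
pose Cp := 10%:R%:P * e3%:P * w + 2%:R%:P * b%:P.
pose r := 2%:R%:P * a%:P * ((Bp + 10%:R%:P * e2%:P * 'X^3) * (Cp + 2%:R%:P * c%:P * 'X^3) - 9%:R%:P * c%:P ^+ 2 * w * 'X^3)
  + Ap * (Bp * 2%:R%:P * c%:P + 10%:R%:P * e2%:P * (Cp + 2%:R%:P * c%:P * 'X^3)) - Ap * 9%:R%:P * c%:P ^+ 2 * w
  - 3%:R%:P * a%:P * (3%:R%:P * a%:P * (Cp + 2%:R%:P * c%:P * 'X^3) - 9%:R%:P * b%:P * c%:P * w)
  + 3%:R%:P * b%:P * w * (9%:R%:P * a%:P * c%:P - 30%:R%:P * b%:P * e2%:P).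
pose r2 := k1%:P + k2%:P * (18%:R%:P + 15%:R%:P * 'X + 6%:R%:P * 'X^2 + 'X^3) + k3%:P * s ^+ 3.
have : k0%:P + (3%:R * k1)%:P * 'X + (3%:R * k1 + 9%:R * k2)%:P * 'X^2 + 'X^3 * (r2 + r) = 0.
  apply: (@horner_generic_eq0 _ ('X * ('X + 1%:P))).
    by rewrite mulf_neq0 ?polyX_eq0 // -size_poly_eq0 size_XaddC.
  move=> t; rewrite !hornerE mulf_eq0 negb_or addr_eq0 => /andP[t0 t1].
  rewrite /= -[RHS](h t t0 t1) /hq /k0 /k1 /k2 /k3 /N /L /Q /A0 /B0 /C0.
  by ring.
move=> P0.
have co i : (i < 3)%N -> (k0%:P + (3%:R * k1)%:P * 'X + (3%:R * k1 + 9%:R * k2)%:P * 'X^2)`_i = 0.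
  move=> i3; have := congr1 (fun p : {poly K} => p`_i) P0.
  by rewrite coefD coefXnM i3 addr0 coef0.
have K0 : k0 = 0.
  by have := co 0%N isT; rewrite !coefD !coefCM coefX !coefXn coefC /= !mulr0 !addr0.
have K1 : k1 = 0.
  have := co 1%N isT; rewrite !coefD !coefCM coefX !coefXn coefC /= !mulr0 !addr0 mulr1 add0r.
  by move/eqP; rewrite mulf_eq0 (negPf (nat0 2)) => /eqP.
have K2 : k2 = 0.
  have := co 2%N isT; rewrite !coefD !coefCM coefX !coefXn coefC /= !mulr0 mulr1 !add0r K1 mulr0 add0r.
  by move/eqP; rewrite mulf_eq0 (negPf (nat0 8)) => /eqP.
have LE : L = 5%:R * (b ^+ 2 + 8%:R * b * e3 - 20%:R * e1 * e3) by rewrite /L /A0 /C0; ring.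
have bn0 : L = 0 -> b != 0.
  rewrite LE => /eqP; apply: contraTneq => ->.
  rewrite (_ : _ * _ = - (100%:R * e1 * e3)); last by ring.
  by rewrite oppr_eq0 !mulf_neq0.
(* If B0 <> 0, then k0 = k1 = k2 = 0 gives N = L = Q = 0 in turn; but L = 0 forces b <> 0, hence Q
   <> 0. *)
have ac : a = c.
  apply/eqP; apply: contraT => nac.
  have B00 : B0 != 0 by rewrite /B0 -mulrBr mulf_neq0 // subr_eq0.
  have N0 : N = 0 by move/eqP: K0; rewrite mulf_eq0 (negPf B00) => /eqP.
  have L0 : L = 0 by move/eqP: K1; rewrite /k1 N0 mulr0 add0r mulf_eq0 (negPf B00) => /eqP.
  move/eqP: K2; rewrite /k2 L0 mulr0 add0r mulf_eq0 (negPf B00) /= !mulf_eq0.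
  by rewrite (negPf (nat0 19)) (negPf e30) (negPf (bn0 L0)).
split=> //; have [->|c0] := eqVneq c 0; [by left|right].
have B00 : B0 = 0 by rewrite /B0 ac subrr.
have c20 : - (2%:R * c) != 0 by rewrite oppr_eq0 mulf_neq0.
have N0 : N = 0.
  by move/eqP: K1; rewrite /k1 B00 mul0r addr0 mulf_eq0 (negPf c20) => /eqP.
have L0 : L = 0.
  by move/eqP: K2; rewrite /k2 B00 mul0r addr0 mulf_eq0 (negPf c20) => /eqP.
split; last by move/eqP: L0; rewrite LE mulf_eq0 (negPf (nat0 4)) => /eqP.
apply/eqP; rewrite -subr_eq0; have : N - L = 20%:R * b * (e1 - e3).
  by rewrite /N /L /A0 /C0; ring.
by rewrite N0 L0 subrr => /esym/eqP; rewrite !mulf_eq0 (negPf (nat0 19)) (negPf (bn0 L0)).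
Qed.

End HessianCubic.

(** * Normal form of a sextic invariant under two diagonal homologies *)

Section Frame.
Variable K : closedFieldType.
Notation MP := {mpoly K[3]}.
Notation rV3 := 'rV[K]_3.
Implicit Types (G : MP) (u v p q : rV3) (M : 'M[K]_3) (la mu : 'cV[K]_3).
Local Notation ev G v := (meval (fun_of_matrix v 0) G).
Hypothesis charK : [pchar K] =i pred0.
Variable w : K.
Hypothesis Dw : w ^+ 2 + w + 1 = 0.
Let w1 : w - 1 != 0.
Proof. by rewrite subr_eq0; apply: (w_neq1 charK Dw). Qed.

(** Invariance under multiplication of the k-th coordinate by w. *)
Definition diag_inv k G := forall v, ev G (v *m homol ((w - 1) *: delta_mx k 0) (ebase K k)) = ev G v.

Lemma homolE la p i j : homol la p i j = (i == j)%:R + la i 0 * p 0 j.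
Proof. by rewrite /homol !mxE big_ord1. Qed.

Lemma mul_diag v k : v *m homol ((w - 1) *: delta_mx k 0) (ebase K k) =
  v + ((w - 1) * v 0 k) *: ebase K k.
Proof. by rewrite mul_homol -scalemxAr scale11 -colE mxE. Qed.

Lemma diag_inv_mderiv i k G : i != k -> diag_inv k G -> diag_inv k G^`M(i).
Proof.
move=> ik h v; have E j : homol ((w - 1) *: delta_mx k 0) (ebase K k) i j = (i == j)%:R.
  by rewrite homolE mxE [delta_mx k 0 i 0]mxE (negPf ik) mulr0 mul0r addr0.
rewrite (mderiv_invariant h i v) (bigD1 i) //= big1 => [|j ji]; rewrite E ?eqxx ?mul1r ?addr0 //.
by rewrite eq_sym (negPf ji) mul0r.
Qed.

Lemma diag_coef k G d v j : G \is d.-homog -> diag_inv k G -> v 0 k = 0 ->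
  ~~ (3 %| j)%N -> (lineP G v (ebase K k))`_j = 0.
Proof.
move=> hG inv vk j3.
have E s : ev G (v + (w * s) *: ebase K k) = ev G (v + s *: ebase K k).
  rewrite -[RHS]inv mul_diag !mxE vk !eqxx add0r mulr1 -addrA -scalerDl; congr (ev G (v + _ *: _)).
  by ring.
have : \poly_(i < d.+1) ((lineP G v (ebase K k))`_i * w ^+ i) = lineP G v (ebase K k).
  apply/eqP; rewrite -subr_eq0; apply/eqP/horner_eq0 => s.
  rewrite hornerD hornerN !horner_lineP -E -horner_lineP horner_poly.
  rewrite (horner_coef_wide _ (size_lineP v _ hG)) -sumrB big1 // => i _.
  by rewrite exprMn mulrA subrr.
move/(congr1 (fun q : {poly K} => q`_j)); rewrite coef_poly.
case: ltnP => [jd|dj]; last by move=> <-.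
set c := _`_j => cE; apply/eqP; have : c * (w ^+ j - 1) == 0 by rewrite mulrBr cE mulr1 subrr.
rewrite mulf_eq0 => /orP[//|]; rewrite subr_eq0 => /eqP wj.
case/negP: j3; rewrite /dvdn; move: wj; rewrite {1}(divn_eq j 3) exprD mulnC exprM (w3 Dw) expr1n mul1r.
have := ltn_mod j 3; case: (j %% 3)%N => [|[|[|//]]] //= _ wE; case/eqP: (w_neq1 charK Dw).
  by rewrite -wE expr1.
by rewrite -(w3 Dw) exprS wE mulr1.
Qed.

Lemma diag_expand6 k G v s : G \is 6.-homog -> diag_inv k G -> v 0 k = 0 ->
  ev G (v + s *: ebase K k) =
  ev G v + s ^+ 3 * ev (6%:R^-1 *: G^`M(k)^`M(k)^`M(k)) v + s ^+ 6 * ev G (ebase K k).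
Proof.
move=> hG inv vk; have c := diag_coef hG inv vk; rewrite mevalZ.
rewrite -horner_lineP (horner_coef_wide _ (size_lineP v _ hG)).
rewrite !big_ord_recr big_ord0 /= (c 1%N) // (c 2%N) // (c 4%N) // (c 5%N) //.
rewrite coef0_lineP (lead_lineP _ _ hG) coef3_lineP.
have := natK0 charK 5; set x := _`_3 => n6; field.
by [].
Qed.

Lemma diag_expand3 k G v s : G \is 3.-homog -> diag_inv k G -> v 0 k = 0 ->
  ev G (v + s *: ebase K k) = ev G v + s ^+ 3 * ev G (ebase K k).
Proof.
move=> hG inv vk; have c := diag_coef hG inv vk.
rewrite -horner_lineP (horner_coef_wide _ (size_lineP v _ hG)).
rewrite !big_ord_recr big_ord0 /= (c 1%N) // (c 2%N) //.
by rewrite coef0_lineP (lead_lineP _ _ hG); ring.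
Qed.

Definition s6 (e1 e2 e3 a b c x y z : K) :=
  e1 * x ^+ 6 + e2 * y ^+ 6 + e3 * z ^+ 6
  + a * (x ^+ 3 * y ^+ 3) + b * (x ^+ 3 * z ^+ 3) + c * (y ^+ 3 * z ^+ 3).

Lemma row_ebase3 v : v = v 0 o2 *: ebase K o2 + v 0 o1 *: ebase K o1 + v 0 o0 *: ebase K o0.
Proof.
apply/rowP; apply: forall3; rewrite !mxE /= ?mulr0 ?mulr1 ?addr0 ?add0r //.
Qed.

(** Only exponents of X divisible by 3 occur. The coefficient of X^3 is a cubic in Y and Z, again
    invariant in Y, so it has only Y^3 and Z^3; the division by 6 = 3! recovers it from the third
    derivative. *)
Lemma diag_normal_form G : G \is 6.-homog -> diag_inv o0 G -> diag_inv o1 G ->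
  let c3 k := 6%:R^-1 *: G^`M(k)^`M(k)^`M(k) in
  forall v, ev G v = s6 (ev G (ebase K o0)) (ev G (ebase K o1)) (ev G (ebase K o2))
    (ev (c3 o0) (ebase K o1)) (ev (c3 o0) (ebase K o2)) (ev (c3 o1) (ebase K o2))
    (v 0 o0) (v 0 o1) (v 0 o2) /\
  (v 0 o0 = 0 -> ev (c3 o0) v = ev (c3 o0) (ebase K o1) * v 0 o1 ^+ 3 +
                 ev (c3 o0) (ebase K o2) * v 0 o2 ^+ 3).
Proof.
move=> hG i0 i1 c3 v.
have h3G k : c3 k \is 3.-homog by rewrite dhomogZ // !dhomog_mderiv.
have i1c : diag_inv o1 (c3 o0).
  have h : diag_inv o1 G^`M(o0)^`M(o0)^`M(o0) by do 3!apply: diag_inv_mderiv => //.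
  by move=> u; rewrite !mevalZ h.
set x := v 0 o0; set y := v 0 o1; set z := v 0 o2.
pose u := z *: ebase K o2 + y *: ebase K o1.
have Dv : v = u + x *: ebase K o0 by rewrite /u -row_ebase3.
have z1 : (z *: ebase K o2) 0 o1 = 0 by rewrite !mxE mulr0.
have z0 : (z *: ebase K o2) 0 o0 = 0 by rewrite !mxE mulr0.
have u0 : u 0 o0 = 0 by rewrite !mxE !mulr0 addr0.
have c3u : ev (c3 o0) u = ev (c3 o0) (ebase K o1) * y ^+ 3 + ev (c3 o0) (ebase K o2) * z ^+ 3.
  rewrite (diag_expand3 _ (h3G o0) i1c z1) (ev_scale _ _ (h3G o0)); ring.
split; last first.
  move=> x0; rewrite -c3u; congr (meval (fun_of_matrix _ 0) _).
  by rewrite Dv x0 scale0r addr0.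
rewrite Dv (diag_expand6 _ hG i0 u0) (diag_expand6 _ hG i1 z1) (ev_scale _ _ hG).
rewrite -/(c3 o0) c3u -/(c3 o1) (ev_scale _ _ (h3G o1)) /s6; ring.
Qed.

Definition mono (i j k : nat) : 'X_{1..3} := [multinom h3 i j k l | l < 3].

Definition sextic (e1 e2 e3 a b c : K) : MP :=
  e1 *: 'X_[mono 6 0 0] + e2 *: 'X_[mono 0 6 0] + e3 *: 'X_[mono 0 0 6]
  + a *: 'X_[mono 3 3 0] + b *: 'X_[mono 3 0 3] + c *: 'X_[mono 0 3 3].

Lemma ev_mono i j k v : ev 'X_[mono i j k] v = v 0 o0 ^+ i * v 0 o1 ^+ j * v 0 o2 ^+ k.
Proof. by rewrite mevalX big3 !mnmE. Qed.

Lemma ev_sextic e1 e2 e3 a b c v :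
  ev (sextic e1 e2 e3 a b c) v = s6 e1 e2 e3 a b c (v 0 o0) (v 0 o1) (v 0 o2).
Proof.
rewrite /sextic !mevalD !mevalZ !ev_mono /s6 !expr0 !mulr1 !mul1r; ring.
Qed.

Lemma ev_mderiv_mono m i v : ev ('X_[m])^`M(i) v = (m i)%:R * \prod_l v 0 l ^+ (m l - U_(i)%MM l).
Proof.
by rewrite mderivX mevalZ mevalX; congr (_ * _); apply: eq_bigr => l _; rewrite mnmBE.
Qed.

Lemma ev_mderiv2_mono m i j v : ev ('X_[m])^`M(i)^`M(j) v =
  (m i)%:R * ((m j - U_(i)%MM j)%:R * \prod_l v 0 l ^+ (m l - U_(i)%MM l - U_(j)%MM l)).
Proof.
rewrite mderivX mderivZ mevalZ ev_mderiv_mono mnmBE; congr (_ * (_ * _)).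
by apply: eq_bigr => l _; rewrite mnmBE.
Qed.

Lemma ev_mderiv2_sextic e1 e2 e3 a b c i j v :
  ev (sextic e1 e2 e3 a b c)^`M(i)^`M(j) v =
  e1 * ev ('X_[mono 6 0 0])^`M(i)^`M(j) v + e2 * ev ('X_[mono 0 6 0])^`M(i)^`M(j) v
  + e3 * ev ('X_[mono 0 0 6])^`M(i)^`M(j) v + a * ev ('X_[mono 3 3 0])^`M(i)^`M(j) v
  + b * ev ('X_[mono 3 0 3])^`M(i)^`M(j) v + c * ev ('X_[mono 0 3 3])^`M(i)^`M(j) v.
Proof. by rewrite /sextic !(mderivD, mderivZ) !mevalD !mevalZ. Qed.

Lemma ev_mderiv_sextic e1 e2 e3 a b c i v :
  ev (sextic e1 e2 e3 a b c)^`M(i) v =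
  e1 * ev ('X_[mono 6 0 0])^`M(i) v + e2 * ev ('X_[mono 0 6 0])^`M(i) v
  + e3 * ev ('X_[mono 0 0 6])^`M(i) v + a * ev ('X_[mono 3 3 0])^`M(i) v
  + b * ev ('X_[mono 3 0 3])^`M(i) v + c * ev ('X_[mono 0 3 3])^`M(i) v.
Proof. by rewrite /sextic !(mderivD, mderivZ) !mevalD !mevalZ. Qed.

Lemma hess_sextic e1 e2 e3 a b c v : ev (hess (sextic e1 e2 e3 a b c)) v =
  27%:R * (v 0 o0 * v 0 o1 * v 0 o2) *
  hq e1 e2 e3 a b c (v 0 o0 ^+ 3) (v 0 o1 ^+ 3) (v 0 o2 ^+ 3).
Proof.
rewrite ev_hess det3 /hessm !(mxE _ (fun _ => _)).
rewrite (mderiv_comm o1 o0) (mderiv_comm o2 o0) (mderiv_comm o2 o1).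
have E i j := ev_mderiv2_sextic e1 e2 e3 a b c i j v.
have E00 := E o0 o0; have E01 := E o0 o1; have E02 := E o0 o2.
have E11 := E o1 o1; have E12 := E o1 o2; have E22 := E o2 o2.
rewrite !ev_mderiv2_mono !big3 !mnm1E !mnmE /= /h3 /= !expr0 !subn0 ?subn1 /= in E00.
rewrite !ev_mderiv2_mono !big3 !mnm1E !mnmE /= /h3 /= !expr0 !subn0 ?subn1 /= in E01.
rewrite !ev_mderiv2_mono !big3 !mnm1E !mnmE /= /h3 /= !expr0 !subn0 ?subn1 /= in E02.
rewrite !ev_mderiv2_mono !big3 !mnm1E !mnmE /= /h3 /= !expr0 !subn0 ?subn1 /= in E11.
rewrite !ev_mderiv2_mono !big3 !mnm1E !mnmE /= /h3 /= !expr0 !subn0 ?subn1 /= in E12.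
rewrite !ev_mderiv2_mono !big3 !mnm1E !mnmE /= /h3 /= !expr0 !subn0 ?subn1 /= in E22.
rewrite {E}E00 E01 E02 E11 E12 E22.
move: (v 0 o0) (v 0 o1) (v 0 o2) => x y z. rewrite /hq; ring.
Qed.

End Frame.

Section Frames.
Variable K : closedFieldType.
Notation MP := {mpoly K[3]}.
Notation rV3 := 'rV[K]_3.
Implicit Types (G : MP) (u v p q : rV3) (M : 'M[K]_3) (la mu : 'cV[K]_3).
Local Notation ev G v := (meval (fun_of_matrix v 0) G).
Hypothesis charK : [pchar K] =i pred0.
Variable w : K.
Hypothesis Dw : w ^+ 2 + w + 1 = 0.
Let w1 : w - 1 != 0.
Proof. by rewrite subr_eq0; apply: (w_neq1 charK Dw). Qed.

Variable F : MP.
Hypotheses (hF : F \is 6.-homog) (sF : smooth_form F).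

Lemma mul_sdelta v k (c : K) : (v *m (c *: (delta_mx k 0 : 'cV[K]_3))) 0 0 = c * v 0 k.
Proof. by rewrite -scalemxAr scale11 -colE mxE. Qed.

Definition frame_mx p0 p1 p2 : 'M[K]_3 := \matrix_(i, j) h3 p0 p1 p2 i 0 j.

Lemma frame_mx_mul n p0 p1 p2 (c : 'M[K]_(3, n)) i j :
  (frame_mx p0 p1 p2 *m c) i j = (h3 p0 p1 p2 i *m c) 0 j.
Proof. by rewrite !mxE; apply: eq_bigr => k _; rewrite mxE. Qed.

Lemma mul_frame_mx v p0 p1 p2 :
  v *m frame_mx p0 p1 p2 = v 0 o0 *: p0 + v 0 o1 *: p1 + v 0 o2 *: p2.
Proof. by apply/rowP => j; rewrite !mxE big3 !mxE. Qed.

(** Each of the two centers lies on the axis of the other, and [p2] spans the intersection of the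
    two axes; no symmetry centered at [p2] is asked for. *)
Record frame (p0 : rV3) (la0 : 'cV[K]_3) (p1 : rV3) (la1 : 'cV[K]_3) (p2 : rV3) : Prop := Frame {
  good0 : homology3 w F p0 la0; gen0 : exact_order3 F p0 la0;
  good1 : homology3 w F p1 la1; gen1 : exact_order3 F p1 la1;
  orth01 : (p0 *m la1) 0 0 = 0; orth10 : (p1 *m la0) 0 0 = 0;
  orth20 : (p2 *m la0) 0 0 = 0; orth21 : (p2 *m la1) 0 0 = 0;
  p2_neq0 : p2 != 0 }.

Section OneFrame.
Variables (p0 : rV3) (la0 : 'cV[K]_3) (p1 : rV3) (la1 : 'cV[K]_3) (p2 : rV3).
Hypothesis fr : frame p0 la0 p1 la1 p2.
Let M := frame_mx p0 p1 p2.

Lemma frame_la0 : M *m la0 = (w - 1) *: delta_mx o0 0.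
Proof.
have [[_ pl0 _] _ _ _ _ o10 o20 _ _] := fr.
apply/colP; apply: forall3; rewrite frame_mx_mul /h3 /= ?pl0 ?o10 ?o20;
  by rewrite [in RHS]mxE [delta_mx _ _ _ _]mxE /= ?mulr1 ?mulr0.
Qed.

Lemma frame_la1 : M *m la1 = (w - 1) *: delta_mx o1 0.
Proof.
have [_ _ [_ pl1 _] _ o01 _ _ o21 _] := fr.
apply/colP; apply: forall3; rewrite frame_mx_mul /h3 /= ?pl1 ?o01 ?o21;
  by rewrite [in RHS]mxE [delta_mx _ _ _ _]mxE /= ?mulr1 ?mulr0.
Qed.

Lemma frame_unit : M \in unitmx.
Proof.
rewrite -row_free_unit -kermx_eq0; apply/eqP/row_matrixP => i; rewrite row0.
have : row i (kermx M) *m M = 0 by rewrite -row_mul mulmx_ker row0.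
move: (row i _) => v vM.
have v0 : v 0 o0 = 0.
  have := congr1 (fun A : 'M[K]_1 => A 0 0) (congr1 (mulmx^~ la0) vM).
  rewrite /= -mulmxA frame_la0 mul_sdelta mul0mx mxE => /eqP.
  by rewrite mulf_eq0 (negPf w1) => /eqP.
have v1 : v 0 o1 = 0.
  have := congr1 (fun A : 'M[K]_1 => A 0 0) (congr1 (mulmx^~ la1) vM).
  rewrite /= -mulmxA frame_la1 mul_sdelta mul0mx mxE => /eqP.
  by rewrite mulf_eq0 (negPf w1) => /eqP.
have := vM; rewrite mul_frame_mx v0 v1 !scale0r !add0r => /eqP.
rewrite scaler_eq0 (negPf (p2_neq0 fr)) orbF => /eqP v2.
by rewrite (row_ebase3 v) v0 v1 v2 !scale0r !addr0.
Qed.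

Lemma ebaseM k : ebase K k *m M = h3 p0 p1 p2 k.
Proof. by rewrite -rowE; apply/rowP => j; rewrite !mxE. Qed.

Lemma frame_diag0 : diag_inv w o0 (subm M F).
Proof.
move=> v; rewrite !ev_subm -mulmxA.
have [[_ _ inv] _ _ _ _ _ _ _ _] := fr.
suff -> : homol ((w - 1) *: delta_mx o0 0) (ebase K o0) *m M = M *m homol la0 p0 by rewrite mulmxA inv.
by rewrite /homol mulmxDl mulmxDr mul1mx mulmx1 -frame_la0 -!mulmxA ebaseM.
Qed.

Lemma frame_diag1 : diag_inv w o1 (subm M F).
Proof.
move=> v; rewrite !ev_subm -mulmxA.
have [_ _ [_ _ inv] _ _ _ _ _ _] := fr.
suff -> : homol ((w - 1) *: delta_mx o1 0) (ebase K o1) *m M = M *m homol la1 p1 by rewrite mulmxA inv.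
by rewrite /homol mulmxDl mulmxDr mul1mx mulmx1 -frame_la1 -!mulmxA ebaseM.
Qed.

(** The centers are off the curve, so e1 and e2 are nonzero. If e3 = 0 the curve is singular at the
    third vertex: the X- and Y-derivatives vanish by the symmetries of order 3 and the Z-derivative
    by Euler. The mixed coefficients are controlled by [exact_order3] at p0 and p1. *)
Lemma frame_normal_form : exists e1 e2 e3 a b c,
  [/\ e1 != 0, e2 != 0, e3 != 0, ~ (a = 0 /\ b = 0) /\ ~ (a = 0 /\ c = 0) &
      forall v, ev F (v *m M) = s6 e1 e2 e3 a b c (v 0 o0) (v 0 o1) (v 0 o2)].
Proof.
have [[Fp0 pl0 _] [v [vl c3v]] [Fp1 pl1 _] [u [ul c3u]] o01 o10 o20 o21 p20] := fr.
have uM := frame_unit; have i0 := frame_diag0; have i1 := frame_diag1.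
pose F' := subm M F; have hF' : F' \is 6.-homog by apply: subm_homog.
have nf := diag_normal_form charK Dw hF' i0 i1.
set c3 := fun k => 6%:R^-1 *: F'^`M(k)^`M(k)^`M(k) in nf.
have n6 : (6%:R : K) != 0 := natK0 charK 5.
have evF' (x : rV3) : ev F' x = ev F (x *m M) by rewrite /F' ev_subm.
have z3 : ev F' (ebase K o2) != 0.
  apply/eqP => F2; have sF' : smooth_form F' by apply: smooth_subm.
  have e20 : ebase K o2 != 0 by apply/rV0Pn; exists o2; rewrite mxE oner_neq0.
  have [k] := (smooth_formP F').1 sF' _ e20 F2; apply/negP; rewrite negbK; apply/eqP.
  have d1 i : ev F'^`M(i) (ebase K o2) = (lineP F' (ebase K o2) (ebase K i))`_1.
    rewrite -(coef0_lineP _ _ (ebase K i)) -deriv_lineP_ebase coef_deriv mulr1n.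
    by [].
  move: k; apply: forall3.
  - by rewrite d1 (diag_coef charK Dw hF' i0) // mxE.
  - by rewrite d1 (diag_coef charK Dw hF' i1) // mxE.
  have := euler_eval (ebase K o2 0) hF'; rewrite F2 !mxE /= mulr0 !mul0r !add0r mul1r.
  by [].
exists (ev F' (ebase K o0)), (ev F' (ebase K o1)), (ev F' (ebase K o2)),
  (ev (c3 o0) (ebase K o1)), (ev (c3 o0) (ebase K o2)), (ev (c3 o1) (ebase K o2)).
have lineE k (x y : rV3) : y *m M = x -> lineP F' y (ebase K k) = lineP F x (h3 p0 p1 p2 k).
  move=> yx; apply/eqP; rewrite -subr_eq0; apply/eqP/horner_eq0 => s.
  by rewrite hornerD hornerN !horner_lineP evF' mulmxDl yx -scalemxAl ebaseM subrr.
split.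
- by rewrite evF' ebaseM.
- by rewrite evF' ebaseM.
- exact: z3.
- split=> -[a0 b0].
    have [y yv] : exists y, y *m M = v by exists (v *m invmx M); rewrite mulmxKV.
    have y0 : y 0 o0 = 0.
      move: vl; rewrite -yv -mulmxA frame_la0 mul_sdelta => /eqP.
      by rewrite mulf_eq0 (negPf w1) => /eqP.
    have [_ /(_ y0)] := nf y; rewrite a0 b0 !mul0r addr0 mevalZ => /eqP.
    rewrite mulf_eq0 invr_eq0 (negPf n6) /= coef3_lineP mulf_eq0 (negPf n6) orbF.
    by rewrite (lineE _ _ _ yv) (negPf c3v).
  have [y yv] : exists y, y *m M = u by exists (u *m invmx M); rewrite mulmxKV.
  have y1 : y 0 o1 = 0.
    move: ul; rewrite -yv -mulmxA frame_la1 mul_sdelta => /eqP.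
    by rewrite mulf_eq0 (negPf w1) => /eqP.
  case/eqP: c3u; have := lineE o1 _ _ yv; rewrite /h3 /= => <-.
  have E : lineP F' y (ebase K o1) = (ev F' y)%:P + (ev F' (ebase K o1))%:P * 'X^6.
    apply/eqP; rewrite -subr_eq0; apply/eqP/horner_eq0 => s.
    rewrite !hornerE horner_lineP (nf (y + s *: ebase K o1)).1 (nf y).1 (nf (ebase K o1)).1 a0 b0 !mxE /= y1.
    by rewrite /s6; ring.
  by rewrite E coefD coefC coefCM coefXn /= mulr0 addr0.
by move=> x; rewrite -evF'; apply: (nf x).1.
Qed.

End OneFrame.

Lemma frame_rescale p0 la0 p1 la1 p2 x y z : x != 0 -> y != 0 -> z != 0 ->
  frame p0 la0 p1 la1 p2 -> frame (x *: p0) (x^-1 *: la0) (y *: p1) (y^-1 *: la1) (z *: p2).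
Proof.
move=> x0 y0 z0 [g0 ge0 g1 ge1 o01 o10 o20 o21 p20].
have gs p la c : c != 0 -> exact_order3 F p la -> exact_order3 F (c *: p) (c^-1 *: la).
  move=> c0 [v [vl c3]]; exists v; rewrite -scalemxAr scale11 vl mulr0; split=> //.
  have -> : lineP F v (c *: p) = \poly_(i < 7) ((lineP F v p)`_i * c ^+ i).
    apply/eqP; rewrite -subr_eq0; apply/eqP/horner_eq0 => s.
    rewrite hornerD hornerN horner_lineP scalerA -horner_lineP horner_poly.
    rewrite (horner_coef_wide _ (size_lineP v p hF)) -sumrB big1 // => i _.
    by rewrite exprMn; ring.
  by rewrite coef_poly /= mulf_neq0 // expf_neq0.
have sc (a b : K) p la : (p *m la) 0 0 = 0 -> ((a *: p) *m (b *: la)) 0 0 = 0.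
  by move=> E; rewrite -scalemxAl -scalemxAr !scale11 E !mulr0.
split; try exact: sc; try exact: homology3_scale; try exact: gs.
by rewrite scaler_eq0 negb_or z0.
Qed.

End Frames.

(** * Curves with twelve points *)

(** The number of fixed points of a 3-group is congruent to #|T| modulo 3, so it cannot be 1. *)
Lemma order3_fixed (T : finType) (s : T -> T) i0 : (3 %| #|T|)%N ->
  (forall i, s (s (s i)) = i) -> s i0 = i0 -> exists2 i, i != i0 & s i = i.
Proof.
move=> T3 s3 si0; have sinj : injective s by apply: (can_inj (g := s \o s)) => i /=.
pose g := perm sinj.
have g3 : (g ^+ 3 = 1)%g by apply/permP => i; by rewrite !expgS expg0 !permM perm1 !permE s3.
have pg : (3.-group <[g]>)%g.
  by rewrite /pgroup -orderE; apply: (@pnat_dvd _ 3); rewrite ?order_dvdn ?g3.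
have act : [acts <[g]>%g, on [set: T] | 'P%act]%g by apply/actsP => x _ y; rewrite !inE.
have := pgroup_fix_mod pg act; rewrite cardsT.
have -> : ('Fix_([set: T] | 'P)(<[g]>))%g = [set i | s i == i].
  apply/setP => i; rewrite setTI afix_cycle_in ?inE ?in_setT //.
  by rewrite sub1set inE /aperm /= ?apermE permE.
rewrite (eqP T3) => /esym/eqP; rewrite -/(dvdn 3 _) => fix3.
have i0f : i0 \in [set i | s i == i] by rewrite inE si0.
case: (pickP [pred i in [set i | s i == i] | i != i0]) => [i /andP[]|none].
  by rewrite inE => /eqP; exists i.
have E : [set i | s i == i] = [set i0].
  apply/setP => i; rewrite in_set1; apply/idP/eqP => [if_|->//].
  by have /= := none i; rewrite if_ => /negbFE/eqP.
by move: fix3; rewrite E cards1.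
Qed.

Section Equality.
Variable K : closedFieldType.
Notation MP := {mpoly K[3]}.
Notation rV3 := 'rV[K]_3.
Implicit Types (G : MP) (u v p q : rV3) (M : 'M[K]_3) (la mu : 'cV[K]_3).
Local Notation ev G v := (meval (fun_of_matrix v 0) G).
Hypothesis charK : [pchar K] =i pred0.
Variable w : K.
Hypothesis Dw : w ^+ 2 + w + 1 = 0.

Lemma lineP_conj G H M v p : (forall x : rV3, ev G (x *m M) = ev H x) ->
  lineP G (v *m M) (p *m M) = lineP H v p.
Proof.
move=> inv; apply/eqP; rewrite -subr_eq0; apply/eqP/horner_eq0 => s.
by rewrite hornerD hornerN !horner_lineP scalemxAl -mulmxDl inv subrr.
Qed.

Lemma homology3_conj G H M p la : M \in unitmx -> (forall x : rV3, ev G (x *m M) = ev H x) ->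
  homology3 w H p la -> homology3 w G (p *m M) (invmx M *m la).
Proof.
move=> uM inv [Hp pla invp]; split; first by rewrite inv.
  by rewrite -mulmxA mulKVmx.
move=> v; have -> : v *m homol (invmx M *m la) (p *m M) = v *m invmx M *m homol la p *m M.
  by rewrite /homol !mulmxDr !mulmx1 mulmxDl mulmxKV // !mulmxA.
by rewrite inv invp -inv mulmxKV.
Qed.

Lemma exact_order3_conj G H M p la : M \in unitmx -> (forall x : rV3, ev G (x *m M) = ev H x) ->
  exact_order3 H p la -> exact_order3 G (p *m M) (invmx M *m la).
Proof.
move=> uM inv [v [vl c3]]; exists (v *m M).
by rewrite -mulmxA mulKVmx // (lineP_conj _ _ inv).
Qed.

Section Points12.
Variable F : MP.
Hypotheses (hF : F \is 6.-homog) (sF : smooth_form F).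
Variable t : 'I_12 -> point K.
Hypotheses (tinj : injective t) (tS : forall i, delta3 F (t i)).
Hypothesis tsur : forall P, delta3 F P -> exists i, P = t i.

Lemma homol_unit p la : (p *m la) 0 0 = w - 1 -> homol la p \in unitmx.
Proof.
move=> pla; have m0 : 1 + (p *m la) 0 0 != 0 by rewrite pla subrKC (w_neq0 Dw).
by case: (mulmx1_unit (homol_inv m0)).
Qed.

Lemma homol_cube v p la : (p *m la) 0 0 = w - 1 ->
  v *m homol la p *m homol la p *m homol la p = v.
Proof.
move=> pla; have ph : p *m homol la p = w *: p by rewrite homol_p pla subrKC.
rewrite (mul_homol v) mulmxDl (mul_homol v) -scalemxAl ph !mulmxDl (mul_homol v) -!scalemxAl ph.
rewrite -!addrA -[RHS]addr0; congr (_ + _).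
by rewrite !scalerA -!scalerDl; apply/eqP; rewrite scaler_eq0; apply/orP; left; rewrite -(mulr0 ((v *m la) 0 0)) -Dw; apply/eqP; ring.
Qed.

Lemma orthogonal_points : exists p0 la0 p1 la1 p2, frame w F p0 la0 p1 la1 p2.
Proof.
have [p [la H]] := delta3_frames charK Dw hF sF tS.
have [linj lan0] := axes_independent charK Dw hF sF tinj H.
pose i0 : 'I_12 := ord0; pose sg := homol (la i0) (p i0).
have [_ p00 [Fp0 pla0 inv0] gen0] := H i0.
have uS : sg \in unitmx by apply: homol_unit.
have pS0 i : p i *m sg != 0 by apply: mulmx_unit_neq0 => //; case: (H i).
have gS i : homology3 w F (p i *m sg) (invmx sg *m la i).
  by have [_ _ g _] := H i; apply: homology3_conj g.
have /fin_all_exists[s Hs] : forall i, exists j, val (t j) = <[p i *m sg]>%VS.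
  move=> i; have [_ _ _ ge] := H i.
  have := @tsur (pt (pS0 i)); case=> [|j Ej]; last by exists j; rewrite -Ej.
  apply/(delta_pointP charK Dw hF sF (P := pt (pS0 i)) erefl (pS0 i)).
  by exists (invmx sg *m la i); split; [exact: gS | apply: exact_order3_conj ge].
have par_s i : exists2 c, c != 0 & p i *m sg = c *: p (s i).
  by apply: eq_line (pS0 i) _; rewrite -Hs; case: (H (s i)).
have tpar i j c : c != 0 -> p i = c *: p j -> i = j.
  move=> c0 E; apply: tinj; have [Di _ _ _] := H i; have [Dj _ _ _] := H j.
  by apply: (point_eq Di Dj); exists c.
have s3 i : s (s (s i)) = i.
  have [c c0 Ec] := par_s i; have [d d0 Ed] := par_s (s i).
  have [e e0 Ee] := par_s (s (s i)).
  have := homol_cube (p i) pla0; rewrite -/sg Ec -!scalemxAl Ed -!scalemxAl Ee !scalerA.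
  by move/esym/tpar => E; rewrite -E ?mulf_neq0.
have s0 : s i0 = i0.
  have [c c0 Ec] := par_s i0; apply/esym.
  move: Ec; rewrite /sg homol_p pla0 subrKC => Ec.
  apply: (tpar _ _ (w^-1 * c)); first by rewrite mulf_neq0 ?invr_eq0 ?(w_neq0 Dw).
  by rewrite -scalerA -Ec scalerA mulVf ?(w_neq0 Dw) ?scale1r.
have [|i1 i10 si1] := @order3_fixed _ s i0 _ s3 s0; first by rewrite card_ord.
have [_ p10 g1 ge1] := H i1; have [Fp1 pla1 inv1] := g1.
(* The image of p1 is p1 + la0(p1) p0; if it is proportional to p1 and la0(p1) <> 0, then p0 and p1
   span the same point. *)
have o10 : (p i1 *m la i0) 0 0 = 0.
  apply/eqP; apply: contraNT i10 => a0; apply/eqP/esym.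
  have [c c0] := par_s i1; rewrite si1 /sg mul_homol => Ec.
  set a := (p i1 *m la i0) 0 0 in a0 Ec.
  have E : p i0 = (a^-1 * (c - 1)) *: p i1.
    rewrite -scalerA scalerBl scale1r -Ec addrAC subrr add0r scalerA mulVf ?scale1r //.
  apply: (tpar _ _ _ _ E); apply: contraNneq p00 => z.
  by rewrite E z scale0r.
have E : p i1 *m sg = p i1 by rewrite /sg mul_homol o10 scale0r addr0.
(* The conjugate by [sg] of the homology at p1 has the same center and multiplier, so it is that
   homology; hence [sg] fixes la1, and la1(p0) = 0. *)
have o01 : (p i0 *m la i1) 0 0 = 0.
  have g1' := gS i1; rewrite E in g1'.
  have L1 := homology3_sym Dw g1; have L1' := homology3_sym Dw g1'.
  have [_ pla1' _] := g1'.
  have := homol_sym_uniq charK (isT : (1 < 6)%N) hF sF Fp1 L1 L1'; rewrite pla1 pla1' => /(_ erefl) El.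
  have : sg *m la i1 = la i1 by rewrite {1}El mulKVmx.
  rewrite /sg /homol mulmxDl mul1mx -mulmxA -[RHS]addr0 => /addrI.
  rewrite (mx11_scalar (p i0 *m _)) mul_mx_scalar => /eqP.
  by rewrite scaler_eq0 (negPf (lan0 i0)) orbF -mx11_scalar => /eqP.
have [p2 p20 p2la] : exists2 p2 : rV3, p2 != 0 & p2 *m row_mx (la i0) (la i1) = 0.
  have : kermx (row_mx (la i0) (la i1)) != 0.
    rewrite -mxrank_eq0 mxrank_ker -lt0n subn_gt0.
    by apply: leq_ltn_trans (rank_leq_col _) _.
  case/rowV0Pn => p2 /sub_kermxP E2 p20; by exists p2.
exists (p i0), (la i0), (p i1), (la i1), p2.
move: p2la; rewrite mul_mx_row -row_mx0 => /eq_row_mx[E1 E2].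
split=> //; try by case: (H i0).
  by rewrite E1 mxE.
by rewrite E2 mxE.
Qed.

End Points12.
End Equality.

(** * Position of the twelve axes with respect to the adapted basis *)

Section Triangle.
Variable K : closedFieldType.
Notation MP := {mpoly K[3]}.
Notation rV3 := 'rV[K]_3.
Implicit Types (G : MP) (u v p q : rV3) (M : 'M[K]_3) (la mu : 'cV[K]_3).
Local Notation ev G v := (meval (fun_of_matrix v 0) G).
Hypothesis charK : [pchar K] =i pred0.
Variable w : K.
Hypothesis Dw : w ^+ 2 + w + 1 = 0.

Lemma mono_homog d i j k : (i + j + k = d)%N -> ('X_[mono i j k] : MP) \is d.-homog.
Proof. by move=> <-; rewrite dhomogX /= mdeg3 !mnmE /h3 /=. Qed.

Lemma sextic_homog (e1 e2 e3 a b c : K) : sextic e1 e2 e3 a b c \is 6.-homog.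
Proof. by rewrite !rpredD // rpredZ // mono_homog. Qed.

Variable F : MP.
Hypotheses (hF : F \is 6.-homog) (sF : smooth_form F).

Section Normal.
Variables (M : 'M[K]_3) (e1 e2 e3 a b c : K).
Hypotheses (uM : M \in unitmx) (e10 : e1 != 0) (e20 : e2 != 0) (e30 : e3 != 0).
Hypothesis nf : forall v : rV3, ev F (v *m M) = s6 e1 e2 e3 a b c (v 0 o0) (v 0 o1) (v 0 o2).

Lemma flex_axis p la x y z : p != 0 -> homology3 w F p la ->
  x * (M *m la) o0 0 + y * (M *m la) o1 0 + z * (M *m la) o2 0 = 0 ->
  x != 0 -> y != 0 -> z != 0 -> hq e1 e2 e3 a b c (x ^+ 3) (y ^+ 3) (z ^+ 3) = 0.
Proof.
move=> p0 [_ pla inv] xyz x0 y0 z0.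
pose v : rV3 := \row_i h3 x y z i.
have vE i : v 0 i = h3 x y z i by rewrite mxE.
have vl : (v *m M *m la) 0 0 = 0.
  by rewrite -mulmxA mxE big3 !vE /h3 /= xyz.
have := hess_axis charK Dw p0 pla inv vl => H.
have : ev (hess (sextic e1 e2 e3 a b c)) v = 0.
  rewrite ev_hess -(@hessm_ext K (subm M F)).
    by rewrite -ev_hess hess_subm H mulr0.
  by move=> u; rewrite ev_subm nf ev_sextic.
rewrite hess_sextic !vE /h3 /= => /eqP; rewrite !mulf_eq0.
by rewrite (negPf x0) (negPf y0) (negPf z0) (negPf (natK0 charK 26)) => /eqP.
Qed.

Hypotheses (ab : ~ (a = 0 /\ b = 0)) (ac : ~ (a = 0 /\ c = 0)).
Variables (p : 'I_12 -> rV3) (la : 'I_12 -> 'cV[K]_3).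
Hypothesis p0 : forall i, p i != 0.
Hypothesis g : forall i, homology3 w F (p i) (la i).
Hypotheses (linj : forall i j k, la i = k *: la j -> i = j) (lan0 : forall i, la i != 0).

Lemma axes_bound_frame G d : G \is d.-homog -> (exists v, ev G v != 0) ->
  (forall i v, v 0 o0 * (M *m la i) o0 0 + v 0 o1 * (M *m la i) o1 0 + v 0 o2 * (M *m la i) o2 0 = 0 ->
     ev G v = 0) -> (12 <= d)%N.
Proof.
move=> hG G0 vG; rewrite -[12%N]card_ord.
apply: (axes_bound (la := fun i => M *m la i) hG G0).
- by move=> i v; rewrite mxE big3; apply: vG.
- move=> i j k E; apply: (linj (k := k)).
  by rewrite -[la i](mulKmx uM) E -scalemxAr mulKmx.
by move=> i; apply: contraNneq (lan0 i) => E; rewrite -[la i](mulKmx uM) E mulmx0.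
Qed.

(** If b = c = 0, the Hessian is, up to a constant, XYZ times Z^3 times a binary sextic in X and Y.
    Repeated factors do not matter for containing lines, so degree 9 is left for 12 axes. *)
Lemma bc_neq0 : ~ (b = 0 /\ c = 0).
Proof.
move=> [b0 c0]; have a0 : a != 0 by apply/eqP => a0; apply: ab.
(* m11 m22 - 9 a^2 U V = A U^2 + B V^2 + C U V when b = c = 0. *)
pose A := 20%:R * a * e1; pose B := 20%:R * a * e2.
pose C := 100%:R * e1 * e2 - 5%:R * a ^+ 2.
have A0 : A != 0 by rewrite !mulf_neq0 // (natK0 charK 19).
have evH v : ev ('X_[mono 1 1 1] * sextic A B 0 C 0 0) v =
    (v 0 o0 * v 0 o1 * v 0 o2) * s6 A B 0 C 0 0 (v 0 o0) (v 0 o1) (v 0 o2).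
  by rewrite mevalM ev_mono ev_sextic !expr1.
suff : (12 <= 9)%N by [].
apply: (axes_bound_frame (G := 'X_[mono 1 1 1] * sextic A B 0 C 0 0)).
- by apply: (dhomogM (d := 3) (e := 6)); [apply: mono_homog | apply: sextic_homog].
- apply: NNPP => none.
  have H0 t : t != 0 -> A + B * t ^+ 6 + C * t ^+ 3 = 0.
    move=> t0; have /eqP : ev ('X_[mono 1 1 1] * sextic A B 0 C 0 0) (\row_i h3 1 t 1 i) = 0.
      by apply: NNPP => /eqP H; apply: none; exists (\row_i h3 1 t 1 i).
    rewrite evH !mxE /h3 /= mul1r mulr1 mulf_eq0 (negPf t0) => /eqP <-.
    by rewrite /s6; ring.
  have n1 : (-1 : K) != 0 by rewrite oppr_eq0 oner_neq0.
  have E1 := H0 1 (oner_neq0 _); have E2 := H0 (-1) n1.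
  have E3 := H0 2%:R (natK0 charK 1).
  (* The combination 72, 56, -2 of the values at t = 1, -1, 2 eliminates B and C. *)
  suff : 126%:R * A = 0.
    by move/eqP; rewrite mulf_eq0 (negPf A0) (negPf (natK0 charK 125)).
  transitivity (72%:R * (A + B * 1 ^+ 6 + C * 1 ^+ 3) + 56%:R * (A + B * (-1) ^+ 6 + C * (-1) ^+ 3) - 2%:R * (A + B * 2%:R ^+ 6 + C * 2%:R ^+ 3)).
    by ring.
  by rewrite E1 E2 E3 !mulr0 addr0 subr0.
move=> i v vl; rewrite evH.
have [->|x0] := eqVneq (v 0 o0) 0; first by rewrite !mul0r.
have [->|y0] := eqVneq (v 0 o1) 0; first by rewrite mulr0 !mul0r.
have [->|z0] := eqVneq (v 0 o2) 0; first by rewrite mulr0 !mul0r.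
have := flex_axis (p0 i) (g i) vl x0 y0 z0.
rewrite b0 c0 => E; apply/eqP; rewrite !mulf_eq0 (negPf x0) (negPf y0) (negPf z0) /=.
have : 10%:R * e3 * v 0 o2 ^+ 3 * s6 A B 0 C 0 0 (v 0 o0) (v 0 o1) (v 0 o2) == 0.
  by apply/eqP; apply: etrans E; rewrite /s6 /hq /A /B /C; ring.
by rewrite !mulf_eq0 ?expf_eq0 ?(negPf z0) (negPf e30) (negPf (natK0 charK 9)) ?orbF /= ?orbb.
Qed.

(** An axis with exactly one zero coefficient is excluded by [mixed_zero], up to a permutation of
    the coordinates, against [bc_neq0], [ac] or [ab]. If every axis had a zero coefficient, all
    twelve would be among the three lines of XYZ = 0. *)
Lemma generic_axis : exists i, forall k, (M *m la i) k 0 != 0.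
Proof.
apply: NNPP => none; suff : (12 <= 3)%N by [].
apply: (axes_bound_frame (G := 'X_[mono 1 1 1])).
- exact: mono_homog.
- by exists (\row_i h3 1 1 1 i); rewrite ev_mono !mxE /h3 /= !expr1n !mulr1 oner_neq0.
move=> i v; rewrite ev_mono !expr1.
have nz : exists k, (M *m la i) k 0 != 0.
  have : M *m la i != 0.
    by apply: contraNneq (lan0 i) => E; rewrite -[la i](mulKmx uM) E mulmx0.
  by case/cV0Pn => k; exists k.
have fx := @flex_axis _ _ _ _ _ (p0 i) (g i).
have ng : ~ forall k, (M *m la i) k 0 != 0 by move=> H; apply: none; exists i.
move: fx nz ng; move: (M *m la i) => nu fx nz ng.
have {ng} ng : [|| nu o0 0 == 0, nu o1 0 == 0 | nu o2 0 == 0].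
  by apply/negPn/negP; rewrite !negb_or => /and3P[n0 n1 n2]; apply: ng; apply: forall3.
have c3 (x : K) : x != 0 -> x ^+ 3 != 0 by move=> x0; rewrite expf_neq0.
have m2 : nu o2 0 = 0 -> nu o0 0 = 0 \/ nu o1 0 = 0.
  move=> n2; have [|n0] := eqVneq (nu o0 0) 0; first by left.
  have [|n1] := eqVneq (nu o1 0) 0; first by right.
  case: bc_neq0; have N1 : - nu o1 0 != 0 by rewrite oppr_eq0.
  apply: (mixed_zero charK e10 e20 e30 (c3 _ N1) (c3 _ n0)) => z z0.
  by apply: fx => //; rewrite n2; ring.
have m1 : nu o1 0 = 0 -> nu o0 0 = 0 \/ nu o2 0 = 0.
  move=> n1; have [|n0] := eqVneq (nu o0 0) 0; first by left.
  have [|n2] := eqVneq (nu o2 0) 0; first by right.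
  case: ac; have N2 : - nu o2 0 != 0 by rewrite oppr_eq0.
  apply: (mixed_zero (b := a) (a := b) charK e10 e30 e20 (c3 _ N2) (c3 _ n0)) => z z0.
  by rewrite hq_swap23; apply: fx => //; rewrite n1; ring.
have m0 : nu o0 0 = 0 -> nu o1 0 = 0 \/ nu o2 0 = 0.
  move=> n0; have [|n1] := eqVneq (nu o1 0) 0; first by left.
  have [|n2] := eqVneq (nu o2 0) 0; first by right.
  case: ab; have N2 : - nu o2 0 != 0 by rewrite oppr_eq0.
  apply: (mixed_zero (a := c) charK e20 e30 e10 (c3 _ N2) (c3 _ n1)) => z z0.
  by rewrite hq_swap23 hq_swap12; apply: fx => //; rewrite n0; ring.
have {nz} nz : ~ [/\ nu o0 0 = 0, nu o1 0 = 0 & nu o2 0 = 0].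
  case=> n0 n1 n2; case: nz; apply: forall3; by rewrite ?n0 ?n1 ?n2 eqxx.
have fin x n : n != 0 -> x * n = 0 -> x = 0 :> K.
  by move=> n0 /eqP; rewrite mulf_eq0 (negPf n0) orbF => /eqP.
have [n0|n0] := eqVneq (nu o0 0) 0; have [n1|n1] := eqVneq (nu o1 0) 0;
  have [n2|n2] := eqVneq (nu o2 0) 0.
- by case: nz.
- by rewrite n0 n1 !mulr0 !add0r => /(fin _ _ n2) ->; rewrite mulr0.
- by rewrite n0 n2 !mulr0 add0r addr0 => /(fin _ _ n1) ->; rewrite mulr0 mul0r.
- by case: (m0 n0) => /eqP; rewrite ?(negPf n1) ?(negPf n2).
- by rewrite n1 n2 !mulr0 !addr0 => /(fin _ _ n0) ->; rewrite !mul0r.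
- by case: (m1 n1) => /eqP; rewrite ?(negPf n0) ?(negPf n2).
- by case: (m2 n2) => /eqP; rewrite ?(negPf n0) ?(negPf n1).
by move: ng; rewrite (negPf n0) (negPf n1) (negPf n2).
Qed.

End Normal.

(** [flex_triangle], used for (Y, Z) and again with Y and Z exchanged, makes the pure coefficients
    equal and the mixed ones equal, with (c - 2 e1)(c + 10 e1) = 0. *)
Lemma hesse_normal_form M e1 e2 e3 a b c p la : M \in unitmx ->
  e1 != 0 -> e2 != 0 -> e3 != 0 ->
  (forall v : rV3, ev F (v *m M) = s6 e1 e2 e3 a b c (v 0 o0) (v 0 o1) (v 0 o2)) ->
  ~ (a = 0 /\ b = 0) -> p != 0 -> homology3 w F p la -> (forall k, (M *m la) k 0 = 1) ->
  forall v : rV3, ev F (v *m M) =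
    e1 * s6 1 1 1 (- 10%:R) (- 10%:R) (- 10%:R) (v 0 o0) (v 0 o1) (v 0 o2).
Proof.
move=> uM e10 e20 e30 nf ab p0 gd nu1.
have fx := flex_axis nf p0 gd; have t1 t : t != -1 -> 1 + t != 0 :> K.
  by move=> tn; rewrite addrC -[1]opprK subr_eq0.
have [] := @flex_triangle K charK e1 e2 e3 a b c e10 e30.
  move=> t t0 /t1 t'0; have -> : - (1 + t) ^+ 3 = (- (1 + t)) ^+ 3 by ring.
  have := fx 1 t (- (1 + t)); rewrite expr1n !nu1 oppr_eq0 oner_neq0; apply=> //; ring.
move=> ac H1.
have [] := @flex_triangle K charK e1 e3 e2 b a c e10 e20.
  move=> t t0 /t1 t'0; have -> : - (1 + t) ^+ 3 = (- (1 + t)) ^+ 3 by ring.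
  have := fx 1 (- (1 + t)) t; rewrite hq_swap23 expr1n !nu1 oppr_eq0 oner_neq0; apply=> //; ring.
move=> bc H2; case: H1 => [c0|[e13 Eb]]; first by case: ab; rewrite ac bc.
case: H2 => [c0|[e12 _]]; first by case: ab; rewrite ac bc.
move: nf Eb; rewrite -e12 -e13 ac bc => nf Eb.
have : (c - 2%:R * e1) * (c + 10%:R * e1) == 0 by rewrite -Eb; apply/eqP; ring.
rewrite mulf_eq0 => /orP[Ec|/eqP Ec] v; last first.
  by rewrite nf; have -> : c = - 10%:R * e1; [by rewrite -[RHS]add0r -Ec; ring | rewrite /s6; ring].
(* For c = 2 e1 the form is e1 (X^3 + Y^3 + Z^3)^2, singular for instance at (1 : -1 : 0). *)
move: Ec; rewrite subr_eq0 => /eqP Ec; exfalso.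
have sG : smooth_form (subm M F) by apply: smooth_subm.
pose u : rV3 := \row_i h3 1 (-1) 0 i.
have uE i : u 0 i = h3 1 (-1) 0 i by rewrite mxE.
have u0 : u != 0 by apply/rV0Pn; exists o0; rewrite uE oner_neq0.
have Fu : ev (subm M F) u = 0 by rewrite ev_subm nf !uE /h3 /= Ec /s6; ring.
have [k] := (smooth_formP (subm M F)).1 sG u u0 Fu.
have ext (x : rV3) : ev (subm M F) x = ev (sextic e1 e1 e1 c c c) x by rewrite ev_subm nf ev_sextic.
rewrite (mderiv_ext ext) ev_mderiv_sextic !ev_mderiv_mono !big3 !uE !mnmE Ec.
by move: k; apply: forall3; rewrite /h3 /= => /eqP; apply; ring.
Qed.

End Triangle.

(** * The Hesse sextic *)

Section Hesse.
Variable K : closedFieldType.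
Notation MP := {mpoly K[3]}.
Notation rV3 := 'rV[K]_3.
Implicit Types (G : MP) (u v p q : rV3) (M : 'M[K]_3) (la mu : 'cV[K]_3).
Local Notation ev G v := (meval (fun_of_matrix v 0) G).

Definition hesse_val (x y z : K) := s6 1 1 1 (- 10%:R) (- 10%:R) (- 10%:R) x y z.
Notation hv v := (hesse_val (v 0 o0) (v 0 o1) (v 0 o2)).

Lemma inordE : (inord 0 = o0 :> 'I_3) * (inord 1 = o1 :> 'I_3) * (inord 2 = o2 :> 'I_3).
Proof. by do !split; apply: val_inj; rewrite /= inordK. Qed.

Lemma ev_hesse v : ev (hesse_sextic K) v = hv v.
Proof.
rewrite /hesse_sextic !inordE !(rmorphB, rmorphD, rmorphM, rmorphXn, rmorph_nat) /= !mevalXU.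
by rewrite /hesse_val /s6; ring.
Qed.

Lemma hesse_homog : hesse_sextic K \is 6.-homog.
Proof.
have X i k : ('X_i ^+ k : MP) \is k.-homog.
  have X1 : ('X_i : MP) \is 1.-homog by rewrite dhomogX /= mdeg1.
  by have := dhomogMn k X1; rewrite mul1n.
have XX i j : ('X_i ^+ 3 * 'X_j ^+ 3 : MP) \is 6.-homog by apply: (dhomogM (d := 3) (e := 3)).
by rewrite /hesse_sextic mulr_natl rpredB ?rpredMn // !rpredD.
Qed.

Lemma hesse_val_cube x y z a b c : a ^+ 3 = 1 -> b ^+ 3 = 1 -> c ^+ 3 = 1 ->
  hesse_val (a * x) (b * y) (c * z) = hesse_val x y z.
Proof.
move=> a3 b3 c3; pose h X Y Z : K := X ^+ 2 + Y ^+ 2 + Z ^+ 2 - 10%:R * (X * Y + X * Z + Y * Z).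
have hE x' y' z' : hesse_val x' y' z' = h (x' ^+ 3) (y' ^+ 3) (z' ^+ 3) by rewrite /hesse_val /s6 /h; ring.
by rewrite !hE !exprMn a3 b3 c3 !mul1r.
Qed.

Variable w : K.
Hypothesis Dw : w ^+ 2 + w + 1 = 0.

(* The discrete Fourier transform on the coordinates is a symmetry of the
   Hesse sextic. *)
Lemma hesse_val_fourier x y z :
  hesse_val (x + y + z) (x + w * y + w ^+ 2 * z) (x + w ^+ 2 * y + w * z) = - 27%:R * hesse_val x y z.
Proof.
have w2 : w ^+ 2 = - w - 1 by rewrite -[LHS]subr0 -Dw; ring.
set s := x + y + z; set h := x + w * y + _; set t := x + _ + w * z.
have Eht : h + t = 2%:R * x - y - z by rewrite /h /t w2; ring.
have Pht : h * t = x ^+ 2 + y ^+ 2 + z ^+ 2 - x * y - y * z - z * x.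
  transitivity (x ^+ 2 + w ^+ 3 * (y ^+ 2 + z ^+ 2) + (w ^+ 2 + w) * (x * y + z * x) + (w ^+ 4 + w ^+ 2) * (y * z)).
    by rewrite /h /t; ring.
  have -> : w ^+ 4 = w by rewrite exprSr w3 // mul1r.
  by rewrite w3 // (addrC w) w2; ring.
(* The form is symmetric in h and t, so it is a polynomial in h + t and h t, from which w has been
   eliminated. *)
have -> : hesse_val s h t = s ^+ 6 + ((h + t) ^+ 3 - 3%:R * (h * t) * (h + t)) ^+ 2 - 12%:R * (h * t) ^+ 3
    - 10%:R * s ^+ 3 * ((h + t) ^+ 3 - 3%:R * (h * t) * (h + t)).
  by rewrite /hesse_val /s6; ring.
by rewrite Eht Pht /s /hesse_val /s6; ring.
Qed.

Hypothesis charK : [pchar K] =i pred0.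

Section GoodPoints.
Variables (G : MP) (k : K).
Hypothesis k0 : k != 0.
Hypothesis evG : forall v : rV3, ev G v = k * hv v.

(** X -> w X is a homology at the first vertex, with coefficient -10 of X^3 Y^3 showing the exact
    order; a symmetry M, up to a scalar, carries this vertex to p0. *)
Lemma hesse_frame (p0 p1 p2 : rV3) (M := frame_mx p0 p1 p2) (c : K) : M \in unitmx -> c != 0 ->
  (forall v : rV3, hv (v *m M) = c * hv v) -> exists la, homology3 w G p0 la /\ exact_order3 G p0 la.
Proof.
move=> uM c0 hM; pose e := ebase K o0; pose la : 'cV[K]_3 := (w - 1) *: delta_mx o0 0.
have evH (v : rV3) : ev G (v *m M) = ev (c *: G) v by rewrite evG hM mevalZ evG; ring.
have evc v : ev (c *: G) v = c * k * hv v by rewrite mevalZ evG mulrA.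
have eM : e *m M = p0.
  by rewrite mul_frame_mx !mxE /= scale1r !scale0r !addr0.
have w30 : w ^+ 3 = 1 by apply: w3.
exists (invmx M *m la); rewrite -eM; split.
  apply: (homology3_conj uM evH); split.
  - rewrite evc !mxE /= (_ : hesse_val 1 0 0 = 1) ?mulr1 ?mulf_neq0 //; rewrite /hesse_val /s6; ring.
  - by rewrite mul_sdelta mxE /= mulr1.
  move=> v; rewrite mul_diag !evc !mxE /=; congr (_ * _).
  rewrite -[RHS](@hesse_val_cube _ _ _ w 1 1) ?expr1n //; congr (hesse_val _ _ _); ring.
apply: (exact_order3_conj uM evH); exists (ebase K o1); split; first by rewrite mul_sdelta mxE mulr0.
have -> : lineP (c *: G) (ebase K o1) e = (c * k)%:P * (1 + 'X^6 - 10%:R%:P * 'X^3).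
  apply/eqP; rewrite -subr_eq0; apply/eqP/horner_eq0 => s.
  rewrite hornerD hornerN horner_lineP evc !mxE /= !hornerE /hesse_val /s6 /=; ring.
rewrite coefCM !coefD coefN coefCM coef1 !coefXn /= !add0r mulr1.
by rewrite !mulf_neq0 // oppr_eq0 (natK0 charK 9).
Qed.

(** These 3 + 9 points are the vertices of the four triangles in the Hesse pencil spanned by X^3 +
    Y^3 + Z^3 and XYZ. *)
Definition hesse_pt (i : 'I_3 + 'I_3 * 'I_3) : rV3 :=
  match i with
  | inl k => ebase K k
  | inr (i, j) => \row_k h3 1 (w ^+ i) (w ^+ j) k
  end.

Lemma hesse_pt_homology3 i : exists la, homology3 w G (hesse_pt i) la /\ exact_order3 G (hesse_pt i) la.
Proof.
have e_unit p0 p1 p2 : \det (frame_mx p0 p1 p2 : 'M[K]_3) != 0 -> frame_mx p0 p1 p2 \in unitmx.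
  by rewrite unitmxE unitfE.
case: i => [i|[i j]] /=.
  have perm_frame x y z : frame_mx (ebase K x) (ebase K y) (ebase K z) \in unitmx ->
      (forall v : rV3, hv (v *m frame_mx (ebase K x) (ebase K y) (ebase K z)) = hv v) ->
      exists la, homology3 w G (ebase K x) la /\ exact_order3 G (ebase K x) la.
    move=> uM hM; apply: (hesse_frame uM (oner_neq0 _)) => v; by rewrite hM mul1r.
  move: i; apply: forall3.
  - apply: (@perm_frame o0 o1 o2).
      by apply: e_unit; rewrite det3 !mxE /h3 /= (_ : _ + _ = 1) ?oner_neq0 //; ring.
    by move=> v; rewrite mul_frame_mx !mxE /= /hesse_val /s6; ring.
  - apply: (@perm_frame o1 o2 o0).
      by apply: e_unit; rewrite det3 !mxE /h3 /= (_ : _ + _ = 1) ?oner_neq0 //; ring.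
    by move=> v; rewrite mul_frame_mx !mxE /= /hesse_val /s6; ring.
  apply: (@perm_frame o2 o0 o1).
    by apply: e_unit; rewrite det3 !mxE /h3 /= (_ : _ + _ = 1) ?oner_neq0 //; ring.
  by move=> v; rewrite mul_frame_mx !mxE /= /hesse_val /s6; ring.
have y3 : (w ^+ i) ^+ 3 = 1 by rewrite -exprM mulnC exprM w3 // expr1n.
have z3 : (w ^+ j) ^+ 3 = 1 by rewrite -exprM mulnC exprM w3 // expr1n.
have nw := w_neq0 Dw; have nw1 := w_neq1 charK Dw.
have y0 : w ^+ i != 0 by rewrite expf_neq0.
have z0 : w ^+ j != 0 by rewrite expf_neq0.
move: (w ^+ i) (w ^+ j) y3 z3 y0 z0 => y z y3 z3 y0 z0.
(* The rows (1, y, z), [p1], [p2] form the Fourier matrix followed by the diagonal matrix (1, y, z)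
   of cube roots of unity; the scalar -27 comes from [hesse_val_fourier]. *)
pose p1 : rV3 := \row_k h3 1 (w * y) (w ^+ 2 * z) k.
pose p2 : rV3 := \row_k h3 1 (w ^+ 2 * y) (w * z) k.
apply: (@hesse_frame _ p1 p2 (- 27%:R)).
- apply: e_unit; rewrite det3 !mxE /h3 /=.
  rewrite (_ : _ + _ = 3%:R * w * (w - 1) * (y * z) - (y * z) * w * (w ^+ 3 - 1)); last by ring.
  by rewrite w3 // subrr mulr0 subr0 !mulf_neq0 ?subr_eq0 // (natK0 charK 2).
- by rewrite oppr_eq0 (natK0 charK 26).
move=> v; rewrite mul_frame_mx !mxE /h3 /= -hesse_val_fourier.
rewrite -[RHS](@hesse_val_cube _ _ _ 1 y z) ?expr1n //; congr (hesse_val _ _ _); ring.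
Qed.

End GoodPoints.
End Hesse.

(** * Projective equivalence with the Hesse sextic, and the case of twelve points *)

Section Equivalence.
Variable K : closedFieldType.
Notation MP := {mpoly K[3]}.
Notation rV3 := 'rV[K]_3.
Implicit Types (G : MP) (u v p q : rV3) (M : 'M[K]_3) (la mu : 'cV[K]_3).
Local Notation ev G v := (meval (fun_of_matrix v 0) G).
Notation hv v := (hesse_val (v 0 o0) (v 0 o1) (v 0 o2)).
Hypothesis charK : [pchar K] =i pred0.

Variable F : MP.
Hypotheses (hF : F \is 6.-homog) (sF : smooth_form F).

Definition hesse_form := exists M (e : K),
  [/\ M \in unitmx, e != 0 & forall v : rV3, ev F (v *m M) = e * hv v].

Lemma smooth_form_neq0 : exists v : rV3, ev F v != 0.
Proof.
apply: NNPP => none; have F0 (v : rV3) : ev F v = ev (0 : MP) v.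
  by rewrite meval0; apply: NNPP => /eqP Fv; apply: none; exists v.
have e0 : ebase K o0 != 0 by apply/rV0Pn; exists o0; rewrite mxE oner_neq0.
have [|i] := (smooth_formP F).1 sF _ e0; first by rewrite F0 meval0.
by rewrite (mderiv_ext F0) raddf0 meval0 eqxx.
Qed.

(** Equality of zero sets gives equality of equations up to a nonzero scalar, since the pulled-back
    sextic vanishes on C and has the degree of F ([van_same_degree_form]). *)
Lemma proj_equivP : proj_equiv F (hesse_sextic K) <-> hesse_form.
Proof.
have hG := hesse_homog K; split.
  case=> phi kphi zeros; pose A := lin1_mx phi.
  have phiE v : phi v = v *m A by rewrite mul_rV_lin1.
  have uA : A \in unitmx.
    rewrite -row_free_unit -kermx_eq0; apply/rowV0P => v /sub_kermxP vA.
    by apply: (lker0P kphi); rewrite linear0 phiE.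
  have zA p : p != 0 -> ev F p = 0 <-> ev (hesse_sextic K) (p *m A) = 0.
    move=> p0; have pA0 : p *m A != 0 by apply: mulmx_unit_neq0.
    rewrite -(vanishes_atP (P := pt pA0) hG erefl) zeros -(vanishes_atP (P := pt p0) hF erefl).
    split=> [Fp|[P FP DP]]; first by exists (pt p0); rewrite //= limg_line phiE.
    suff <- : P = pt p0 by [].
    have [q q0 Dq] := point_gen P; apply: (point_eq Dq (erefl : val (pt p0) = _)).
    move: DP; rewrite Dq limg_line phiE /= => /(eq_line pA0)[c c0 E].
    exists c^-1; first by rewrite invr_eq0.
    rewrite -[p](mulmxK uA) E -scalemxAl mulmxK // scalerA mulVf ?scale1r //.
  have [p Fp] := smooth_form_neq0; pose G := subm A (hesse_sextic K).
  have hG' : G \is 6.-homog by apply: subm_homog.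
  have vG : van F G.
    apply/vanP => v v0 Fv; rewrite /G ev_subm; exact/zA.
  have p0 : p != 0 by apply: (base_point_neq0 (isT : (1 < 6)%N) hF Fp).
  have Gp : ev G p != 0.
    by rewrite /G ev_subm; apply: contraNneq Fp => Gp; apply/eqP/(zA _ p0).
  have E := van_same_degree_form charK (isT : (1 < 6)%N) hF sF Fp hG' vG.
  exists (invmx A), (ev G p / ev F p)^-1; split.
  - by rewrite unitmx_inv.
  - by rewrite invr_eq0 mulf_neq0 ?invr_eq0.
  move=> v; have := E (v *m invmx A); rewrite /G ev_subm mulmxKV // ev_hesse => ->.
  by rewrite mulKf // mulf_neq0 ?invr_eq0.
case=> M [e [uM e0 FM]]; pose phi : 'End(rV3) := linfun (mulmxr (invmx M)).
have phiE v : phi v = v *m invmx M by rewrite lfunE.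
exists phi.
  apply/lker0P => u v; rewrite !phiE => /(congr1 (mulmx^~ M)) /=.
  by rewrite !mulmxKV.
move=> Q; split=> [GQ|[P FP DQ]].
  have [q q0 Dq] := point_gen Q; have qM0 : q *m M != 0 by apply: mulmx_unit_neq0.
  exists (pt qM0); last by rewrite /= limg_line phiE mulmxK.
  apply/(vanishes_atP (P := pt qM0) hF erefl); rewrite FM -ev_hesse.
  by move/(vanishes_atP hG Dq): GQ => ->; rewrite mulr0.
have [p p0 Dp] := point_gen P; move/(vanishes_atP hF Dp): FP => Fp.
have {}DQ : val Q = <[p *m invmx M]>%VS by rewrite DQ Dp limg_line phiE.
apply/(vanishes_atP hG DQ); apply: (mulfI e0); rewrite ev_hesse -FM mulmxKV //.
by rewrite Fp mulr0.
Qed.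

Variable w : K.
Hypothesis Dw : w ^+ 2 + w + 1 = 0.

Lemma delta12_hesse_form : delta'_eq F 3 12 -> hesse_form.
Proof.
case=> t [tS tinj tsur].
have [p0 [la0 [p1 [la1 [p2 fr]]]]] := orthogonal_points charK Dw hF sF tinj tS tsur.
have [p [la H]] := delta3_frames charK Dw hF sF tS.
have [linj lan0] := axes_independent charK Dw hF sF tinj H.
have pn0 i : p i != 0 by case: (H i).
have gd i : homology3 w F (p i) (la i) by case: (H i).
have uM := frame_unit charK Dw fr; pose M := frame_mx p0 p1 p2.
have [e1 [e2 [e3 [a [b [c [e10 e20 e30 [ab ac] nf]]]]]]] := frame_normal_form charK Dw hF sF fr.
have [i nu0] := generic_axis charK Dw uM e10 e20 e30 nf ab ac pn0 gd linj lan0.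
have inu0 k : ((M *m la i) k 0)^-1 != 0 by rewrite invr_eq0.
(* Rescaling the basis turns the generic axis into X + Y + Z = 0; the normal form is then taken anew
   in the rescaled basis. *)
have fr' := frame_rescale hF (inu0 o0) (inu0 o1) (inu0 o2) fr.
have uM' := frame_unit charK Dw fr'.
have [e1' [e2' [e3' [a' [b' [c' [e10' e20' e30' [ab' _] nf']]]]]]] := frame_normal_form charK Dw hF sF fr'.
have nu1 : forall k, (frame_mx (((M *m la i) o0 0)^-1 *: p0) (((M *m la i) o1 0)^-1 *: p1)
    (((M *m la i) o2 0)^-1 *: p2) *m la i) k 0 = 1.
  have nuE k : (h3 p0 p1 p2 k *m la i) 0 0 = (M *m la i) k 0 by rewrite frame_mx_mul.
  apply: forall3; [have := nuE o0 | have := nuE o1 | have := nuE o2];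
    by rewrite /h3 /= => E; rewrite frame_mx_mul /h3 /= -scalemxAl scale11 E mulVf.
exists (frame_mx (((M *m la i) o0 0)^-1 *: p0) (((M *m la i) o1 0)^-1 *: p1) (((M *m la i) o2 0)^-1 *: p2)), e1'.
by split=> //; apply: (hesse_normal_form charK Dw sF uM' e10' e20' e30' nf' ab' (pn0 i) (gd i) nu1).
Qed.

Lemma hesse_pt_inj i j c : hesse_pt w i = c *: hesse_pt w j -> i = j.
Proof.
have nw1 := w_neq1 charK Dw; have nw0 := w_neq0 Dw.
have wk k : w ^+ k != 0 by rewrite expf_neq0.
have winj (k l : 'I_3) : w ^+ k = w ^+ l -> k = l.
  have nww : w ^+ 2 != w by rewrite expr2 -subr_eq0 -[X in _ - X]mulr1 -mulrBr mulf_neq0 // subr_eq0.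
  have nw2 : w ^+ 2 != 1.
    by apply: contra_neq nw1 => w2; rewrite -[LHS]mulr1 -[in LHS]w2 -exprS w3.
  move: k l; apply: forall3; apply: forall3 => //= /eqP;
    by rewrite ?expr0 ?expr1 ?(negPf nw1) ?(negPf nww) ?(negPf nw2) // eq_sym ?(negPf nw1) ?(negPf nww) ?(negPf nw2).
move=> E; have Ek k : hesse_pt w i 0 k = c * hesse_pt w j 0 k by rewrite E mxE.
have h0 a b k : (\row_l h3 1 (w ^+ a) (w ^+ b) l : rV3) 0 k != 0.
  by rewrite mxE; move: k; apply: forall3; rewrite /h3 /= ?oner_neq0.
case: i j E Ek => [i|[i i']] [j|[j j']] /= _ Ek.
- have := Ek i; rewrite !mxE !eqxx /=; case: eqP => [-> //|_].
  by rewrite mulr0 => /eqP; rewrite oner_eq0.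
- pose k : 'I_3 := if i == o0 then o1 else o0.
  have ki : k != i by rewrite /k; case: (eqVneq i o0) => [->|]; rewrite // eq_sym.
  have c0 : c = 0.
    have := Ek k; rewrite [LHS]mxE (negPf ki) /= => /esym/eqP.
    by rewrite mulf_eq0 (negPf (h0 _ _ _)) orbF => /eqP.
  by have := Ek i; rewrite c0 mul0r mxE !eqxx => /eqP; rewrite oner_eq0.
- pose k : 'I_3 := if j == o0 then o1 else o0.
  have kj : k != j by rewrite /k; case: (eqVneq j o0) => [->|]; rewrite // eq_sym.
  have := Ek k; rewrite [X in _ = _ * X]mxE (negPf kj) /= mulr0 => /eqP.
  by rewrite (negPf (h0 _ _ _)).
have c1 : c = 1 by have := Ek o0; rewrite !mxE /h3 /= mulr1.
have := Ek o1; have := Ek o2; rewrite c1 !mul1r !mxE /h3 /=.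
by move=> /winj -> /winj ->.
Qed.

(** The number m of counted points is at most 12 by [delta3_card]; the twelve points [hesse_pt],
    moved by M, inject into them. *)
Lemma hesse_form_delta12 : hesse_form -> delta'_eq F 3 12.
Proof.
case=> M [e [uM e0 FM]].
have [m [t [tS tinj tsur]] m12] := delta3_card charK Dw hF sF.
suff <- : m = 12%N by exists t.
apply/eqP; rewrite eqn_leq m12 /=.
have hS : subm M F \is 6.-homog by apply: subm_homog.
have evS v : ev (subm M F) v = e * hv v by rewrite ev_subm FM.
have pM0 i : hesse_pt w i *m M != 0.
  apply: mulmx_unit_neq0 => //; have [la [[Sp _ _] _]] := hesse_pt_homology3 Dw charK e0 evS i.
  exact: (base_point_neq0 (isT : (1 < 6)%N) hS Sp).
have /fin_all_exists[f Hf] : forall i, exists j, pt (pM0 i) = t j.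
  move=> i; apply: tsur; have [la [gd ge]] := hesse_pt_homology3 Dw charK e0 evS i.
  apply/(delta_pointP charK Dw hF sF (P := pt (pM0 i)) erefl (pM0 i)).
  have evM (x : rV3) : ev F (x *m M) = ev (subm M F) x by rewrite ev_subm.
  by exists (invmx M *m la); split; [apply: homology3_conj gd | apply: exact_order3_conj ge].
have finj : injective f.
  move=> i j E; have := Hf i; rewrite E -Hf => /(congr1 val) /= /(eq_line (pM0 i))[c _ Ec].
  apply: (@hesse_pt_inj _ _ c); rewrite -[LHS](mulmxK uM) Ec -scalemxAl mulmxK //.
by have := leq_card f finj; rewrite card_sum card_prod !card_ord.
Qed.

End Equivalence.

Theorem theorem4p12 (K : closedFieldType) (charK : [pchar K] =i pred0)
    (F : {mpoly K[3]}) (smF : smooth_plane_curve 6 F) :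
  (exists2 m : nat, delta'_eq F 3 m & (m <= 12)%N)
  /\ (delta'_eq F 3 12 <-> proj_equiv F (hesse_sextic K)).
Proof.
have [hF sF] := smooth_plane_curveP (isT : (0 < 6)%N) smF.
have [w Dw] := exists_omega K; split; first exact: (delta3_card charK Dw hF sF).
rewrite (proj_equivP charK hF sF); split; first exact: (delta12_hesse_form charK hF sF Dw).
exact: (hesse_form_delta12 charK hF sF Dw).
Qed.
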